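(* Let $s \ge 3$ be an integer. There exists a constant $C>0$, independent of $N$, $f$, $u$ and $\sigma$, such that the following holds. Let $f \in L^2(\mathbb{B}^3)$, let $(\sigma,u) \in H_0^1(\mathbb{B}^3)\times H_0^1(\mathbb{B}^3)$ be the solution of $$a(\sigma,v) = (f,v)_{L^2(\mathbb{B}^3)} \quad \forall v \in H_0^1(\mathbb{B}^3), \qquad a(u,\tau) = (\sigma,\tau)_{L^2(\mathbb{B}^3)} \quad \forall \tau \in H_0^1(\mathbb{B}^3),$$ and, for an integer $N\ge 2$, let $(\sigma_N,u_N)\in V_N\times V_N$ be the solution of $$a(\sigma_N,v_N) = (f,v_N)_{L^2(\mathbb{B}^3)} \quad \forall v_N \in V_N, \qquad a(u_N,\tau_N) = (\sigma_N,\tau_N)_{L^2(\mathbb{B}^3)} \quad \forall \tau_N \in V_N.$$ If $\sigma \in H^{s-2}(\mathbb{B}^3)$, then $$\|\sigma-\sigma_N\|_{H^1(\mathbb{B}^3)} \le C N^{3-s}\|\sigma\|_{H^{s-2}(\mathbb{B}^3)}, \qquad \|\sigma-\sigma_N\| \le C N^{2-s}\|\sigma\|_{H^{s-2}(\mathbb{B}^3)}.$$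
   Context: All functions are real-valued. $\mathbb{B}^3=\{x\in\mathbb{R}^3:\|x\|\le 1\}$ is the unit ball and $\mathbb{S}^2$ its boundary sphere. $\mathbb{N}$ and $\mathbb{N}_0$ denote the positive and the nonnegative integers. $H^m(\mathbb{B}^3)$, $m\in\mathbb{N}_0$, is the standard Sobolev space with its usual norm; $H_0^m(\mathbb{B}^3)$ is the closure of $C_0^\infty(\mathbb{B}^3)$ in $H^m(\mathbb{B}^3)$. $(u,v)_{L^2(\mathbb{B}^3)}=\int_{\mathbb{B}^3}uv\,\mathrm{d}x$, and $\|\cdot\|$ without subscript (applied to a function) is the $L^2(\mathbb{B}^3)$-norm. The bilinear form is $a(u,v)=\int_{\mathbb{B}^3}\nabla u\cdot\nabla v\,\mathrm{d}x$. The continuous problem is the mixed weak formulation, with $\sigma=-\Delta u$, of the biharmonic problem $\Delta^2u=f$ in $\mathbb{B}^3$, $u=\Delta u=0$ on $\mathbb{S}^2$; both the continuous and the discrete problem have unique solutions. Approximation space $V_N$. For $n\in\mathbb{N}_0$ let $\{Y_l^n\}_{l=1}^{2n+1}$ be an orthonormal basis, in $L^2(\mathbb{S}^2)$, of the space of spherical harmonics of degree $n$ (restrictions to $\mathbb{S}^2$ of homogeneous harmonic polynomials of degree $n$ in three variables); $Y_l^n(x)$ for $x\in\mathbb{B}^3$ denotes the corresponding homogeneous harmonic polynomial of degree $n$. Let $P_k^{\alpha,\beta}$ be the Jacobi polynomial of degree $k$, orthogonal on $(-1,1)$ with weight $(1-t)^\alpha(1+t)^\beta$, in the standard normalization $P_k^{\alpha,\beta}(1)=\binom{k+\alpha}{k}$.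 For $k\in\mathbb{N}_0$ set $$B_{k,l}^{0,n}(x)=P_k^{0,n+\frac12}(2\|x\|^2-1)\,Y_l^n(x),$$ and for $k\in\mathbb{N}$ set $B_{k,l}^{-1,n}=B_{k,l}^{0,n}-B_{k-1,l}^{0,n}$ (these functions vanish on $\mathbb{S}^2$). Then $$V_N=\operatorname{span}\{B_{k,l}^{-1,n}: 2\le 2k+n\le N,\ k\in\mathbb{N},\ n\in\mathbb{N}_0,\ n\le N,\ 1\le l\le 2n+1\}\subset H_0^1(\mathbb{B}^3).$$ *)

(* Defs.v *)
From HB Require Import structures.
From mathcomp Require Import all_boot all_order all_algebra.
From mathcomp Require Import all_classical all_reals all_analysis.

Set Implicit Arguments.
Unset Strict Implicit.
Unset Printing Implicit Defensive.

Import Order.TTheory GRing.Theory Num.Theory numFieldNormedType.Exports.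
Local Open Scope classical_set_scope.
Local Open Scope ring_scope.

(* Functions on the unit ball are represented by functions on the whole space;
   the L2 and Sobolev notions below only depend on their class modulo equality
   almost everywhere in the ball. *)
Notation point3 R := (R * R * R)%type.

Definition coord3 (R : realType) (i : 'I_3) (x : point3 R) : R :=
  nth 0 [:: x.1.1; x.1.2; x.2] i.

Definition axis3 (R : realType) (i : 'I_3) : point3 R :=
  ((i == 0 :> nat)%N%:R, (i == 1 :> nat)%N%:R, (i == 2 :> nat)%N%:R).

(* The norm that the library puts on a product is the sup norm. *)
Definition enorm (R : realType) (x : point3 R) : R :=
  Num.sqrt (\sum_(i < 3) coord3 i x ^+ 2).

Definition ball3 (R : realType) : set (point3 R) := [set x | enorm x <= 1].

Definition open_ball3 (R : realType) : set (point3 R) := [set x | enorm x < 1].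

Definition mu3 (R : realType) :=
  (@lebesgue_measure R \x @lebesgue_measure R \x @lebesgue_measure R)%E.

(* Measurability is with respect to the Borel sigma-algebra: every Lebesgue
   measurable function is almost everywhere equal to a Borel one. *)
Definition L2 (R : realType) (u : point3 R -> R) : Prop :=
  u \_ (@ball3 R) \in Lfun (@mu3 R) 2%:E.

Definition L2norm (R : realType) (u : point3 R -> R) : R :=
  fine ('N[@mu3 R]_2%:E[EFin \o (u \_ (@ball3 R))])%E.

Definition L2dot (R : realType) (u v : point3 R -> R) : R :=
  \int[@mu3 R]_(x in @ball3 R) (u x * v x).

Definition partial (R : realType) (i : 'I_3) (f : point3 R -> R) :
  point3 R -> R := fun x => 'D_(axis3 R i) f x.

Definition Dmulti (R : realType) (a : 'I_3 -> nat) (f : point3 R -> R) :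
  point3 R -> R := foldr (fun i g => iter (a i) (partial i) g) f (enum 'I_3).

Definition smooth (R : realType) (f : point3 R -> R) : Prop :=
  forall s : seq 'I_3, let g := foldr (@partial R) f s in
    continuous g /\ forall i x, derivable g x (axis3 R i).

Definition support3 (R : realType) (f : point3 R -> R) : set (point3 R) :=
  closure [set x | f x != 0].

Definition test_function (R : realType) (phi : point3 R -> R) : Prop :=
  [/\ smooth phi, compact (support3 phi) & support3 phi `<=` @open_ball3 R].

Definition is_wderiv (R : realType) (a : 'I_3 -> nat) (u g : point3 R -> R) :
  Prop := L2 g /\ forall phi, test_function phi ->
    L2dot u (Dmulti a phi) = (-1) ^+ (\sum_(i < 3) a i)%N * L2dot g phi.

(* A representative of the weak derivative, which is unique almost everywhere in
   the ball; zero when u has no weak derivative of order a in L2. *)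
Definition wderiv (R : realType) (a : 'I_3 -> nat) (u : point3 R -> R) :
  point3 R -> R := xget (cst 0) [set g | is_wderiv a u g].

Definition sobolev (R : realType) (m : nat) (u : point3 R -> R) : Prop :=
  L2 u /\ forall a : 'I_3 -> nat, (\sum_(i < 3) a i <= m)%N ->
    exists g, is_wderiv a u g.

Definition Hnorm (R : realType) (m : nat) (u : point3 R -> R) : R :=
  Num.sqrt (\sum_(a : {ffun 'I_3 -> 'I_m.+1} | (\sum_(i < 3) a i <= m)%N)
    L2norm (wderiv (fun i => a i) u) ^+ 2).

Definition sobolev0 (R : realType) (m : nat) (u : point3 R -> R) : Prop :=
  sobolev m u /\ forall eps : R, 0 < eps ->
    exists2 phi, test_function phi & Hnorm m (u \- phi) < eps.

Definition wpartial (R : realType) (i : 'I_3) : (point3 R -> R) ->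
  point3 R -> R := wderiv (fun j => (j == i) : nat).

Definition aform (R : realType) (u v : point3 R -> R) : R :=
  \int[@mu3 R]_(x in @ball3 R) \sum_(i < 3) wpartial i u x * wpartial i v x.

(* Generalised binomial coefficient ((k + alpha) choose k), alpha real. *)
Definition binomial_shift (R : realType) (alpha : R) (k : nat) : R :=
  \prod_(i < k) ((alpha + i.+1%:R) / i.+1%:R).

Definition is_jacobi (R : realType) (alpha beta : R) (k : nat) (p : {poly R}) :
  Prop :=
  [/\ size p = k.+1,
      forall q : {poly R}, (size q <= k)%N ->
        \int[@lebesgue_measure R]_(t in `]-1, 1[)
          (p.[t] * q.[t] * (1 - t) `^ alpha * (1 + t) `^ beta) = 0
    & p.[1] = binomial_shift alpha k].

Definition jacobi (R : realType) (alpha beta : R) (k : nat) : {poly R} :=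
  xget 0 [set p | is_jacobi alpha beta k p].

Definition homogeneous_poly (R : realType) (n : nat) (h : point3 R -> R) :
  Prop :=
  exists c : {ffun 'I_3 -> 'I_n.+1} -> R, forall x,
    h x = \sum_(a : {ffun 'I_3 -> 'I_n.+1} | (\sum_(i < 3) a i == n)%N)
            c a * \prod_(i < 3) coord3 i x ^+ a i.

Definition harmonic (R : realType) (h : point3 R -> R) : Prop :=
  forall x, \sum_(i < 3) partial i (partial i h) x = 0.

(* Surface integral over the unit sphere, in spherical coordinates. *)
Definition sphere_int (R : realType) (g : point3 R -> R) : R :=
  \int[@lebesgue_measure R]_(theta in `[0, pi])
    \int[@lebesgue_measure R]_(phi in `[0, 2 * pi])
      (g (sin theta * cos phi, sin theta * sin phi, cos theta) * sin theta).

(* A homogeneous polynomial is determined by its restriction to the sphere, so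
   a spherical harmonic is identified with the polynomial it comes from. The
   index l runs over 0, ..., 2n instead of 1, ..., 2n + 1. *)
Definition harmonic_basis (R : realType)
    (Y : forall n : nat, 'I_(n.*2.+1) -> point3 R -> R) : Prop :=
  forall n,
  [/\ forall l, homogeneous_poly n (Y n l) /\ harmonic (Y n l),
      forall l l', sphere_int (fun x => Y n l x * Y n l' x) = (l == l')%:R
    & forall h, homogeneous_poly n h -> harmonic h ->
        exists c : 'I_(n.*2.+1) -> R, forall x, h x = \sum_l c l * Y n l x].

Definition B0 (R : realType)
    (Y : forall n : nat, 'I_(n.*2.+1) -> point3 R -> R)
    (k n : nat) (l : 'I_(n.*2.+1)) : point3 R -> R :=
  fun x => (jacobi 0 (n%:R + 2^-1) k).[2 * enorm x ^+ 2 - 1] * Y n l x.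

(* Only meant for 0 < k. *)
Definition Bm1 (R : realType)
    (Y : forall n : nat, 'I_(n.*2.+1) -> point3 R -> R)
    (k n : nat) (l : 'I_(n.*2.+1)) : point3 R -> R :=
  B0 Y k l \- B0 Y k.-1 l.

Definition VN (R : realType)
    (Y : forall n : nat, 'I_(n.*2.+1) -> point3 R -> R)
    (N : nat) (v : point3 R -> R) : Prop :=
  exists c : nat -> forall n : nat, 'I_(n.*2.+1) -> R,
    forall x, ball3 x ->
      v x = \sum_(k < N.+1 | (0 < k)%N) \sum_(n < N.+1 | (2 <= k.*2 + n <= N)%N)
              \sum_(l < n.*2.+1) c k n l * Bm1 Y k l x.

Definition mixed_solution (R : realType) (f sigma u : point3 R -> R) : Prop :=
  [/\ sobolev0 1 sigma, sobolev0 1 u,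
      forall v, sobolev0 1 v -> aform sigma v = L2dot f v
    & forall tau, sobolev0 1 tau -> aform u tau = L2dot sigma tau].

Definition discrete_solution (R : realType)
    (Y : forall n : nat, 'I_(n.*2.+1) -> point3 R -> R) (N : nat)
    (f sigmaN uN : point3 R -> R) : Prop :=
  [/\ VN Y N sigmaN, VN Y N uN,
      forall v, VN Y N v -> aform sigmaN v = L2dot f v
    & forall tau, VN Y N tau -> aform uN tau = L2dot sigmaN tau].

(* Main.v *)
(* With e = sigma - sigma_N, Galerkin orthogonality against the functions
   (|x|^(2i+2) - 1) Y of V_N, Y a spherical harmonic, reads (e, |x|^(2i) Y) = 0 after
   an integration by parts; hence e is orthogonal in L2 to the space Pi_(N-2) of
   polynomials of degree at most N - 2. The operator
     L q = - Lap q + (x . grad)^2 q + 3 x . grad q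
   is symmetric on the ball without boundary conditions, preserves every Pi_n, acts on
   Pi_n / Pi_(n-1) as n (n + 3), and satisfies (L q, q) <= |grad q|^2. Since
   polynomials are dense, the distance from a function w to Pi_K is at most
   |grad w| / sqrt ((K + 1) (K + 4)), and, iterating the symmetry of L, at most
   C K^(-j) times the H^j norm of w. For w = e this gives |e| <= |grad e| / N, and then
     |grad e|^2 = a(sigma, e) = (f, e) = (f - p, e) <= |f - p| |grad e| / N
   with p the projection of f = - Lap sigma to Pi_(N-2) gives the H^1 estimate. *)

(* The gain in |e| comes from orthogonality to polynomials alone, so neither duality nor elliptic
   regularity enters; the smoothness of f is inherited from sigma through f = - Lap sigma. The
   operator L is - div (I - x x^T) grad, and (I - x x^T) grad q is tangential on the sphere. Hence L
   can be moved onto a Sobolev function whose boundary values are unknown, where the Laplacian would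
   leave boundary terms. The obstacle is to integrate by parts for functions known only through
   their pairings with test functions, without traces, extension or mollification. This is met by
   explicit cutoffs exp (-1/t) with t = (1 - |x|^2)/d - 1: the gradient of a cutoff has size 1/d
   near the sphere, and a factor 1 - |x|^2 has to be found in the integrand to compensate it. With K
   = N - 2 the eigenvalue (K + 1)(K + 4) is at least N^2, so every use of it gives a clean power of
   N. For s = 3 the function f is not controlled by the H^1 norm of sigma; the energy bound a(e, e)
   <= a(sigma, sigma) then takes the place of approximating f. *)
Require Import Defs.
From HB Require Import structures.
From mathcomp Require Import all_boot all_order all_algebra.
From mathcomp Require Import all_classical all_reals all_analysis.
From mathcomp Require Import measurable_realfun ring lra zify.

Set Implicit Arguments.
Unset Strict Implicit.
Unset Printing Implicit Defensive.

Import Order.TTheory GRing.Theory Num.Theory numFieldNormedType.Exports.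
Local Open Scope classical_set_scope.
Local Open Scope ring_scope.

(** * The space L2 of the ball *)

Section L2_ball.
Context {R : realType}.
Local Notation pt :=
  (measurableTypeR R * measurableTypeR R * measurableTypeR R)%type.
Local Notation B := (@ball3 R : set pt).
Local Notation mu := (@mu3 R).
Implicit Types (f g h u v b : pt -> R) (x : pt) (M c : R).

Lemma measurable_coord3 (i : 'I_3) : measurable_fun [set: pt] (coord3 i).
Proof.
case: i => -[|[|[|//]]] /= ?.
- exact: (measurableT_comp measurable_fst measurable_fst).
- exact: (measurableT_comp measurable_snd measurable_fst).
- exact: measurable_snd.
Qed.

Definition sqnorm (x : pt) : R := \sum_(i < 3) coord3 i x ^+ 2.

Lemma measurable_sqnorm : measurable_fun [set: pt] sqnorm.
Proof.
by apply: measurable_sum => i; exact: measurable_funX (measurable_coord3 i).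
Qed.

Lemma sqnorm_ge0 x : 0 <= sqnorm x.
Proof. by apply: sumr_ge0 => i _; exact: sqr_ge0. Qed.

Lemma ball3E x : ball3 x <-> sqnorm x <= 1.
Proof.
by rewrite /ball3/= /enorm -[leRHS]sqrtr1 ler_sqrt.
Qed.

Lemma open_ball3E x : open_ball3 x <-> sqnorm x < 1.
Proof.
by rewrite /open_ball3/= /enorm -[ltRHS]sqrtr1 ltr_sqrt.
Qed.

Lemma measurable_ball3 : measurable B.
Proof.
have -> : B = [set: pt] `&` sqnorm @^-1` `]-oo, 1].
  by apply/seteqP; split=> x /=; rewrite in_itv/=; [move/ball3E|case=> _ ?; exact/ball3E].
exact: measurable_sqnorm.
Qed.

Lemma coord3_ball (i : 'I_3) x : ball3 x -> `|coord3 i x| <= 1.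
Proof.
move=> /ball3E xB; rewrite -(@ler_sqr _ _ 1) ?nnegrE// expr1n real_normK ?num_real//.
apply: le_trans xB; rewrite /sqnorm (bigD1 i)//= lerDl.
by apply: sumr_ge0 => j _; exact: sqr_ge0.
Qed.

Lemma mu3_ball_fin : (mu B < +oo)%E.
Proof.
apply: (@le_lt_trans _ _ (mu ((`[-1, 1] `*` `[-1, 1]) `*` `[-1, 1]))).
  apply: le_measure; rewrite ?inE; first exact: measurable_ball3.
    by apply: measurableX => //; exact: measurableX.
  move=> [[x y] z] xB /=; rewrite !in_itv/= -!ler_norml.
  by have := coord3_ball 0 xB; have := coord3_ball 1 xB; have := coord3_ball 2 xB.
rewrite /mu3 product_measure1E//=; last exact: measurableX.
rewrite product_measure1E//= lebesgue_measure_itv/= lte_fin.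
by case: ifP => _; rewrite -?EFinD -?EFinM ltry.
Qed.

Lemma measurable_restrict_ball f :
  measurable_fun B f <-> measurable_fun setT (f \_ B).
Proof. by rewrite -(measurable_restrictT f measurable_ball3). Qed.

Lemma L2P f : L2 f <->
  measurable_fun B f /\ mu.-integrable B (EFin \o (fun x => f x ^+ 2)).
Proof.
have sq : EFin \o (fun x => (f \_ B) x ^+ 2) = (EFin \o (fun x => f x ^+ 2)) \_ B.
  apply/funext => x /=; rewrite /patch; case: ifP => //= _.
  by rewrite expr0n.
split=> [fL|[mf intf]].
  split; first by apply/measurable_restrict_ball; move: fL => /andP[/[!inE]].
  apply: (integrable_mkcond (mu:=mu) _ measurable_ball3).2.
  by rewrite -sq; exact: Lfun2_integrable_sqr.
rewrite /L2 inE; apply/andP; split; rewrite inE/=; first exact/measurable_restrict_ball.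
rewrite /finite_norm unlock; apply: poweR_lty.
move: intf => /(integrable_mkcond (mu:=mu) _ measurable_ball3).1; rewrite -sq.
move=> /integrableP[_]; apply: le_lt_trans.
rewrite le_eqVlt; apply/orP; left; apply/eqP; apply: eq_integral => x _ /=.
by rewrite powR_mulrn// -normrX.
Qed.

Lemma L2_measurable f : L2 f -> measurable_fun B f.
Proof. by move=> /L2P[]. Qed.

Lemma L2_integrableM f g : L2 f -> L2 g ->
  mu.-integrable B (EFin \o (fun x => f x * g x)).
Proof.
move=> /L2P[mf if2] /L2P[mg ig2].
have i2 := integrableD measurable_ball3 if2 ig2.
apply: (le_integrable measurable_ball3 _ _ i2).
  by apply/measurable_EFinP; exact: measurable_funM.
move=> x _ /=; rewrite lee_fin [leRHS]ger0_norm ?addr_ge0 ?sqr_ge0//.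
rewrite ler_norml; apply/andP; split.
  by have := sqr_ge0 (f x + g x); have := sqr_ge0 (f x); have := sqr_ge0 (g x); nra.
by have := sqr_ge0 (f x - g x); have := sqr_ge0 (f x); have := sqr_ge0 (g x); nra.
Qed.

Lemma L2D f g : L2 f -> L2 g -> L2 (f \+ g).
Proof.
move=> /[dup] fL /L2P[mf if2] /[dup] gL /L2P[mg ig2]; apply/L2P; split.
  exact: measurable_funD.
have i2 := integrableZl measurable_ball3 2 (L2_integrableM fL gL).
have := integrableD measurable_ball3 (integrableD measurable_ball3 if2 ig2) i2.
apply: eq_integrable => //=; first exact: measurable_ball3.
by move=> x _ /=; rewrite -?EFinM -?EFinD; congr EFin; ring.
Qed.

Lemma L2_bounded b M : measurable_fun B b -> (forall x, ball3 x -> `|b x| <= M) ->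
  L2 b.
Proof.
move=> mb bM; apply/L2P; split=> //.
apply: measurable_bounded_integrable => //.
- exact: measurable_ball3.
- exact: mu3_ball_fin.
- exact: measurable_funX.
- exists (M ^+ 2); split; first exact: num_real.
  move=> y My x xB /=; rewrite (le_trans _ (ltW My))// normrX.
  by rewrite lerXn2r ?nnegrE ?bM// (le_trans (normr_ge0 (b x)))// bM.
Qed.

Lemma L2_mulb b M f : measurable_fun B b -> (forall x, ball3 x -> `|b x| <= M) ->
  L2 f -> L2 (fun x => b x * f x).
Proof.
move=> mb bM /L2P[mf if2]; apply/L2P; split; first exact: measurable_funM.
have i2 := integrableZl measurable_ball3 (M ^+ 2) if2.
apply: (le_integrable measurable_ball3 _ _ i2).
  by apply/measurable_EFinP; apply: measurable_funX; exact: measurable_funM.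
move=> x xB /=; rewrite lee_fin exprMn !normrM.
have bx : `|b x| <= `|M| by rewrite (le_trans (bM x xB))// ler_norm.
by apply: ler_wpM2r; rewrite ?mulr_ge0// ler_pM.
Qed.

Lemma L2_cst c : L2 (cst c : pt -> R).
Proof. exact: (@L2_bounded _ `|c|). Qed.

Lemma L2Z c f : L2 f -> L2 (fun x => c * f x).
Proof. exact: (@L2_mulb (cst c) `|c|). Qed.

Lemma L2N f : L2 f -> L2 (\- f).
Proof.
move=> fL; have -> : \- f = fun x => -1 * f x by apply/funext => x; rewrite /= mulN1r.
exact: L2Z.
Qed.

Lemma L2B f g : L2 f -> L2 g -> L2 (f \- g).
Proof. by move=> fL gL; exact: L2D (L2N gL). Qed.

Lemma L2_eq f g : (forall x, ball3 x -> f x = g x) -> L2 f -> L2 g.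
Proof.
rewrite /L2 => fg.
rewrite (_ : f \_ _ = g \_ (@ball3 R))//; apply/funext => x.
by rewrite /patch; case: ifPn => // /set_mem; exact: fg.
Qed.

Lemma L2dotC f g : L2dot f g = L2dot g f.
Proof. by apply: eq_Rintegral => x _; rewrite mulrC. Qed.

Lemma L2dotDl f g h : L2 f -> L2 g -> L2 h ->
  L2dot (f \+ g) h = L2dot f h + L2dot g h.
Proof.
move=> fL gL hL; rewrite /L2dot.
rewrite -(RintegralD measurable_ball3 (L2_integrableM fL hL) (L2_integrableM gL hL)).
by apply: eq_Rintegral => x _; rewrite /= mulrDl.
Qed.

Lemma L2dotZl c f h : L2 f -> L2 h -> L2dot (fun x => c * f x) h = c * L2dot f h.
Proof.
move=> fL hL; rewrite /L2dot.
rewrite -(RintegralZl _ measurable_ball3 (L2_integrableM fL hL)).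
by apply: eq_Rintegral => x _; rewrite /= mulrA.
Qed.

Lemma L2dot_ge0 f : 0 <= L2dot f f.
Proof. by apply: Rintegral_ge0 => x _; rewrite -expr2 sqr_ge0. Qed.

Lemma L2dotM b f g : L2dot (fun x => b x * f x) g = L2dot f (fun x => b x * g x).
Proof. by apply: eq_Rintegral => x _; rewrite mulrCA mulrA. Qed.

Lemma L2normE f : L2 f -> L2norm f = Num.sqrt (L2dot f f).
Proof.
move=> fL; rewrite /L2norm unlock.
have ffL := integrable_fin_num measurable_ball3 (L2_integrableM fL fL).
have -> : (\int[mu]_x `|(EFin \o (f \_ B)%R) x| `^ 2 = (L2dot f f)%:E)%E.
  rewrite /L2dot /Rintegral fineK; last exact: ffL.
  rewrite [RHS]integral_mkcond; apply: eq_integral => x _ /=.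
  rewrite powR_mulrn// -normrX /patch; case: ifPn => _ /=.
    by rewrite ger0_norm ?sqr_ge0.
  by rewrite expr0n/= normr0.
by rewrite poweR_EFin/= powR12_sqrt//; exact: L2dot_ge0.
Qed.

End L2_ball.

(** Functions are not identified when equal almost everywhere, and the integral is bilinear only on
    square integrable ones; hence a form that may have null vectors and a domain predicate. *)
Record semi_inner (R : realType) (V : lmodType R) := SemiInner {
  dom : V -> Prop;
  ip : V -> V -> R;
  dom0 : dom 0;
  domD : forall u v, dom u -> dom v -> dom (u + v);
  domZ : forall c u, dom u -> dom (c *: u);
  ipC : forall u v, ip u v = ip v u;
  ipDl : forall u v w, dom u -> dom v -> dom w -> ip (u + v) w = ip u w + ip v w;
  ipZl : forall c u v, dom u -> dom v -> ip (c *: u) v = c * ip u v;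
  ip_ge0 : forall u, dom u -> 0 <= ip u u }.

(** * Projections onto a filtration preserved by a symmetric operator *)

Section SemiInnerTheory.
Context {R : realType} {V : lmodType R} (H : semi_inner V).
Local Notation dom := (dom H).
Local Notation "<< u , v >>" := (ip H u v) (at level 0, u, v at level 99).
Implicit Types (u v w f g q : V) (P : V -> Prop).

Lemma domN u : dom u -> dom (- u).
Proof. by move=> du; rewrite -scaleN1r; exact: domZ. Qed.

Lemma domB u v : dom u -> dom v -> dom (u - v).
Proof. by move=> du dv; apply: domD => //; exact: domN. Qed.

Lemma ipBl u v w : dom u -> dom v -> dom w -> << u - v, w >> = << u, w >> - << v, w >>.
Proof.
move=> du dv dw; rewrite ipDl//; last exact: domN.
by rewrite -scaleN1r ipZl// mulN1r.
Qed.

Lemma ipDr u v w : dom u -> dom v -> dom w -> << w, u + v >> = << w, u >> + << w, v >>.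
Proof. by move=> du dv dw; rewrite ipC ipDl// ![ip _ _ w]ipC. Qed.

Lemma ipBr u v w : dom u -> dom v -> dom w -> << w, u - v >> = << w, u >> - << w, v >>.
Proof. by move=> du dv dw; rewrite ipC ipBl// ![ip _ _ w]ipC. Qed.

Lemma ipZr c u v : dom u -> dom v -> << u, c *: v >> = c * << u, v >>.
Proof. by move=> du dv; rewrite ipC ipZl// ipC. Qed.

Lemma ip0l v : dom v -> << 0, v >> = 0.
Proof. by move=> dv; rewrite -(scale0r (0 : V)) ipZl ?mul0r//; exact: dom0. Qed.

Lemma ip_sqD c u v : dom u -> dom v ->
  << u + c *: v, u + c *: v >> = << u, u >> + 2 * c * << u, v >> + c ^+ 2 * << v, v >>.
Proof.
move=> du dv; have dcv := domZ c dv; have dw := domD du dcv.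
by rewrite ipDl// !ipDr// !ipZr// !ipZl// (ipC H v u); ring.
Qed.

Lemma ip_CS u v : dom u -> dom v -> << u, v >> ^+ 2 <= << u, u >> * << v, v >>.
Proof.
move=> du dv; have vv := ip_ge0 dv; have [v0|v0] := eqVneq (<< v, v >>) 0; last first.
  have vp : 0 < << v, v >> by rewrite lt_neqAle eq_sym v0.
  have := ip_ge0 (domD du (domZ (- (<< u, v >> / << v, v >>)) dv)).
  rewrite ip_sqD//; move: vp v0.
  move: (<< u, u >>) (<< v, v >>) (<< u, v >>) => a c b c0 c_neq0.
  have -> : a + 2 * - (b / c) * b + (- (b / c)) ^+ 2 * c = a - b ^+ 2 / c by field.
  by rewrite subr_ge0 ler_pdivrMr.
rewrite v0 mulr0; have [->|uv0] := eqVneq (<< u, v >>) 0; first by rewrite expr0n.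
(* For a null v the square of u + c v is affine in c; this c makes it equal to - <u, u> - 2, a
   contradiction. *)
have := ip_ge0 (domD du (domZ (- ((<< u, u >> + 1) / << u, v >>)) dv)).
rewrite ip_sqD// v0 mulr0 addr0 mulrN mulNr -mulrA divfK//.
by have := ip_ge0 du; lra.
Qed.

Lemma ip_null u v : dom u -> dom v -> << u, u >> = 0 -> << u, v >> = 0.
Proof.
move=> du dv u0; have := ip_CS du dv; rewrite u0 mul0r => h.
by apply/eqP; rewrite -sqrf_eq0 eq_le h sqr_ge0.
Qed.

Lemma ip_null_eq u v w : dom u -> dom v -> dom w -> << u - v, u - v >> = 0 ->
  << u, w >> = << v, w >>.
Proof.
move=> du dv dw uv; apply/eqP; rewrite -subr_eq0 -ipBl//.
by rewrite ip_null//; exact: domB.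
Qed.

Definition subspace P := [/\ forall u, P u -> dom u, P 0 &
  forall c u v, P u -> P v -> P (c *: u + v)].

(** A relation and not a function: best approximations are determined only up to null vectors. *)
Definition projection P f g := P g /\ forall v, P v -> << f - g, v >> = 0.

Definition projectable P := forall f, dom f -> exists g, projection P f g.

Definition adjoin P w : V -> Prop := fun u => exists c p, P p /\ u = c *: w + p.

Lemma subspace_dom P u : subspace P -> P u -> dom u.
Proof. by case=> + _ _; apply. Qed.

Lemma subspaceD P u v : subspace P -> P u -> P v -> P (u + v).
Proof. by case=> _ _ h Pu Pv; rewrite -[u]scale1r; exact: h. Qed.

Lemma subspaceZ P c u : subspace P -> P u -> P (c *: u).
Proof. by case=> _ P0 h Pu; rewrite -[_ *: _]addr0; exact: h. Qed.

Lemma subspaceB P u v : subspace P -> P u -> P v -> P (u - v).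
Proof.
by move=> sP Pu Pv; apply: subspaceD => //; rewrite -scaleN1r; exact: subspaceZ.
Qed.

Lemma subspace_adjoin P w : dom w -> subspace P -> subspace (adjoin P w).
Proof.
move=> dw sP; split.
- move=> _ [c [p [Pp ->]]]; apply: domD; first exact: domZ.
  exact: subspace_dom Pp.
- by exists 0, 0; rewrite scale0r addr0; case: sP.
- move=> c _ _ [a [p [Pp ->]]] [b [q [Pq ->]]].
  exists (c * a + b), (c *: p + q); split; first by case: sP => _ _; apply.
  by rewrite scalerDl scalerDr scalerA addrACA.
Qed.

(** One Gram-Schmidt step: the projection of f is corrected along the residual r of w.
    Finite-dimensional spaces thus become projectable one vector at a time, without completeness. *)
Lemma projectable_adjoin P w : dom w -> subspace P -> projectable P ->
  projectable (adjoin P w).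
Proof.
move=> dw sP pP f df.
have [w' [Pw' ow]] := pP _ dw; have [g [Pg og]] := pP _ df.
have dg := subspace_dom sP Pg; have dw' := subspace_dom sP Pw'.
have dr := domB dw dw'; have dfg := domB df dg.
pose r := w - w'; pose c := << f - g, r >> / << r, r >>.
(* If r is null, the division in c is degenerate, but both sides vanish by Cauchy-Schwarz. *)
have cE : << f - g, r >> = c * << r, r >>.
  have [r0|r0] := eqVneq (<< r, r >>) 0; last by rewrite /c divfK.
  by rewrite r0 mulr0 ipC; exact: ip_null.
exists (g + c *: r); split.
  exists c, (g - c *: w'); split.
    by apply: subspaceB => //; exact: subspaceZ.
  by rewrite /r scalerBr addrCA.
have dcr := domZ c dr; have dgc := domD dg dcr.
have orth v : P v -> << f - (g + c *: r), v >> = 0.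
  move=> Pv; have dv := subspace_dom sP Pv.
  by rewrite opprD addrA ipBl// ipZl// og// ow// mulr0 subr0.
move=> _ [a [p [Pp ->]]]; have dp := subspace_dom sP Pp.
have -> : a *: w + p = a *: r + (a *: w' + p).
  by rewrite /r scalerBr addrA subrK.
have dF := domB df dgc.
rewrite ipDr//; last 2 first.
- exact: domZ.
- by apply: domD => //; exact: domZ.
rewrite [X in _ + X]orth ?addr0; last by case: sP => _ _; apply.
rewrite ipZr// opprD addrA ipBl// ipZl//.
by rewrite cE subrr mulr0.
Qed.

Lemma projection_ge P f g p : subspace P -> dom f -> projection P f g -> P p ->
  << f - g, f - g >> <= << f - p, f - p >>.
Proof.
move=> sP df [Pg og] Pp; have dg := subspace_dom sP Pg; have dp := subspace_dom sP Pp.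
have gp := subspaceB sP Pg Pp.
have -> : f - p = (f - g) + 1 *: (g - p) by rewrite scale1r addrA subrK.
have d1 := domB df dg; have d2 := domB dg dp.
rewrite [leRHS]ip_sqD// (og _ gp).
by rewrite mulr0 addr0 lerDl expr1n mul1r; apply: ip_ge0; exact: domB.
Qed.

(** * Spectral gap and distance to the filtration *)

Section Spectral.
Variables (P : nat -> V -> Prop) (L : V -> V) (mu : nat -> R).
Hypothesis subP : forall n, subspace (P n).
Hypothesis projP : forall n, projectable (P n).
Hypothesis monoP : forall m n u, (m <= n)%N -> P m u -> P n u.
Hypothesis LP : forall n u, P n u -> P n (L u).
Hypothesis Lsym : forall n u v, P n u -> P n v -> << L u, v >> = << u, L v >>.
Hypothesis Ltri : forall n u, P n.+1 u -> P n (L u - mu n.+1 *: u).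
Hypothesis mu_mono : forall m n, (m <= n)%N -> mu m <= mu n.
Hypothesis denseP : forall f, dom f -> forall eps : R, 0 < eps ->
  exists n p, P n p /\ << f - p, f - p >> < eps.

Let domP n u : P n u -> dom u. Proof. exact: subspace_dom (subP n). Qed.

(** Induction on n without eigenvectors. Projecting q on the previous space splits off a residual on
    which the triangular form of L yields exactly [mu n.+1], while symmetry removes the cross terms.
    Once n is at most K, q is orthogonal to itself and both sides are zero. *)
Lemma spectral_gap K n q : P n q -> (forall v, P K v -> << q, v >> = 0) ->
  mu K.+1 * << q, q >> <= << L q, q >>.
Proof.
have low m u : (m <= K)%N -> P m u -> (forall v, P K v -> << u, v >> = 0) ->
    mu K.+1 * << u, u >> <= << L u, u >>.
  move=> mK Pu ou; have u0 : << u, u >> = 0 by rewrite ou//; exact: monoP Pu.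
  rewrite u0 mulr0 ipC ip_null//; first exact: domP Pu.
  exact: domP (LP Pu).
elim: n q => [|n IH] q Pq oq; first exact: low Pq oq.
have [nK|] := leqP n.+1 K; first exact: low Pq oq.
rewrite ltnS => Kn.
have dq := domP Pq.
have [qn [Pqn oqn]] := projP n dq.
have dqn := domP Pqn; have dr := domB dq dqn.
have oqnK v : P K v -> << qn, v >> = 0.
  move=> Pv; have := oqn v (monoP Kn Pv); rewrite ipBl//; last exact: domP Pv.
  by rewrite oq// sub0r => /eqP; rewrite oppr_eq0 => /eqP.
have Pr : P n.+1 (q - qn) by apply: subspaceB => //; exact: monoP Pqn.
have dLq := domP (LP Pq); have dLqn := domP (LP Pqn).
have e1 : << L q, qn >> = << L qn, qn >>.
  rewrite (Lsym Pq (monoP (leqnSn n) Pqn)) [RHS]ipC.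
  by have /eqP := oqn _ (LP Pqn); rewrite ipBl// subr_eq0 => /eqP.
have e2 : << L q, q - qn >> = mu n.+1 * << q - qn, q - qn >>.
  have := oqn _ (Ltri Pq); rewrite ipC ipBl//; last exact: domZ.
  rewrite ipZl// => /eqP; rewrite subr_eq0 => /eqP ->; congr (_ * _).
  by rewrite [RHS]ipBl// -[LHS]subr0; congr (_ - _); rewrite ipC oqn.
have -> : << L q, q >> = << L qn, qn >> + mu n.+1 * << q - qn, q - qn >>.
  by rewrite -e1 -e2 ipBr// addrC subrK.
have -> : << q, q >> = << qn, qn >> + << q - qn, q - qn >>.
  rewrite [X in _ + X]ipBr// (oqn _ Pqn) subr0 ipBl//.
  have /eqP := oqn _ Pqn; rewrite ipBl// subr_eq0 => /eqP <-.
  by rewrite (ipC _ qn) addrC subrK.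
rewrite mulrDr lerD ?IH// ler_wpM2r ?ip_ge0//.
exact: mu_mono.
Qed.

(** In the last identity f may be replaced by fn, as L (fn - fK) stays in [P n], and fK contributes
    nothing, as L fK stays in [P K]. *)
Lemma projection_diff K n f fK fn : dom f -> (K <= n)%N ->
  projection (P K) f fK -> projection (P n) f fn ->
  [/\ P n (fn - fK), forall v, P K v -> << fn - fK, v >> = 0 &
      << f, L (fn - fK) >> = << L (fn - fK), fn - fK >>].
Proof.
move=> df Kn [PK oK] [Pn on].
have dK := domP PK; have dn := domP Pn.
have PnK : P n (fn - fK) by apply: subspaceB => //; exact: monoP PK.
have o v : P K v -> << fn - fK, v >> = 0.
  move=> Pv; have dv := domP Pv.
  have := oK v Pv; have := on v (monoP Kn Pv); rewrite !ipBl// => /eqP.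
  by rewrite subr_eq0 => /eqP ->.
split=> //; have dL := domP (LP PnK).
rewrite ipBr//.
have -> : << L (fn - fK), fK >> = 0.
  by rewrite (Lsym PnK (monoP Kn PK)) o//; exact: LP.
have /eqP := on _ (LP PnK); rewrite ipBl// subr_eq0 => /eqP ->.
by rewrite subr0 ipC.
Qed.

(** L is only controlled on the spaces [P n], so f is replaced by its projections fn; density lets n
    grow, and Pythagoras adds the two errors. *)
Lemma projection_dist_le K f fK M : dom f -> projection (P K) f fK ->
  (forall n fn, (K <= n)%N -> projection (P n) f fn ->
    << fn - fK, fn - fK >> <= M) ->
  << f - fK, f - fK >> <= M.
Proof.
move=> df pK hM; apply/ler_addgt0Pr => e e0.
have [n [p [Pp fp]]] := denseP df e0.
have Pp' : P (maxn n K) p by apply: monoP Pp; exact: leq_maxl.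
have [fn pn] := projP (maxn n K) df.
have Kn : (K <= maxn n K)%N by exact: leq_maxr.
have [PnK _ _] := projection_diff df Kn pK pn.
have le1 := projection_ge (subP _) df pn Pp'.
have [Pn on] := pn.
have dn := domP Pn; have dK := domP (proj1 pK).
have -> : f - fK = (f - fn) + 1 *: (fn - fK) by rewrite scale1r addrA subrK.
have d1 := domB df dn; have d2 := domB dn dK.
rewrite ip_sqD// (on _ PnK).
rewrite mulr0 addr0 expr1n mul1r addrC lerD//; first exact: hM pn.
by apply: le_trans le1 _; exact: ltW.
Qed.

(** The last hypothesis is Cauchy-Schwarz for the energy form in additive shape, with G in the place
    of the energy of f. At q = fn - fK its left side is 2 <L q, q>, so <L q, q> <= G remains, and
    the spectral gap applies. *)
Lemma projection_dist_grad K f fK G : 0 < mu K.+1 -> dom f ->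
  projection (P K) f fK ->
  (forall n q, P n q -> 2 * << f, L q >> <= G + << L q, q >>) ->
  mu K.+1 * << f - fK, f - fK >> <= G.
Proof.
move=> mu0 df pK hG; rewrite mulrC -ler_pdivlMr//.
apply: (projection_dist_le df pK) => n fn Kn pn.
have [PnK oK e] := projection_diff df Kn pK pn.
rewrite ler_pdivlMr// mulrC; apply: le_trans (spectral_gap PnK oK) _.
by have := hG _ _ PnK; rewrite e; lra.
Qed.

(** Here g plays the role of L f. For q = fn - fK, mu |q|^2 <= <L q, q> = <g - gK, q> <= |g - gK|
    |q|. It is the distance of g, not its norm, that appears, so the estimate can be iterated. *)
Lemma projection_dist_adjoint K f g fK gK : 0 < mu K.+1 -> dom f -> dom g ->
  projection (P K) f fK -> projection (P K) g gK ->
  (forall n q, P n q -> << f, L q >> = << g, q >>) ->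
  mu K.+1 ^+ 2 * << f - fK, f - fK >> <= << g - gK, g - gK >>.
Proof.
move=> mu0 df dg pK [PgK ogK] hfg.
have mu20 : 0 < mu K.+1 ^+ 2 by rewrite exprn_gt0.
rewrite mulrC -ler_pdivlMr//; apply: (projection_dist_le df pK) => n fn Kn pn.
have [PnK oK e] := projection_diff df Kn pK pn.
have dq := domP PnK; have dgK := domP PgK.
set q := fn - fK in PnK oK e dq *.
have gap := spectral_gap PnK oK.
have e2 : << L q, q >> = << g - gK, q >>.
  by rewrite -e (hfg _ _ PnK) ipBl// (ipC _ gK) oK// subr0.
have cs := ip_CS (domB dg dgK) dq.
have qq := ip_ge0 dq; have gg := ip_ge0 (domB dg dgK).
rewrite ler_pdivlMr// mulrC; rewrite e2 in gap.
have [q0|q0] := eqVneq (<< q, q >>) 0; first by rewrite q0 mulr0.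
have qp : 0 < << q, q >> by rewrite lt_neqAle eq_sym q0.
rewrite -(ler_pM2r qp) (le_trans _ cs)// -mulrA -expr2 -exprMn.
by rewrite lerXn2r ?nnegrE ?(le_trans _ gap)// mulr_ge0// ltW.
Qed.

End Spectral.

End SemiInnerTheory.

(** * Cutoffs and derivatives *)

Section Bump.
Context {R : realType}.
Implicit Types (t : R) (k : nat).

(** The negative powers of t make the family closed under differentiation, up to linear
    combinations. *)
Definition ebump k t : R := if 0 < t then t ^- k * expR (- t^-1) else 0.

Lemma ebump_pos k t : 0 < t -> ebump k t = t ^- k * expR (- t^-1).
Proof. by rewrite /ebump => ->. Qed.

Lemma ebump_npos k t : t <= 0 -> ebump k t = 0.
Proof. by rewrite /ebump leNgt => /negPf ->. Qed.

Lemma ebump_ge0 k t : 0 <= ebump k t.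
Proof.
rewrite /ebump; case: ifPn => // t0.
by rewrite mulr_ge0 ?expR_ge0// invr_ge0 exprn_ge0// ltW.
Qed.

Lemma ebump_factor k t : ebump k t = ebump k.+1 t * t.
Proof.
rewrite /ebump; case: ifPn => [t0|_]; last by rewrite mul0r.
by rewrite exprS invfM -!mulrA (mulrC (expR _) t) mulrCA mulKf// gt_eqF.
Qed.

(** The term of order k + 1 of the exponential series, one more than the power to be absorbed,
    leaves a factor t; this gives continuity at zero. *)
Lemma ebump_le k t : ebump k t <= k.+1`!%:R * `|t|.
Proof.
rewrite /ebump; case: ifPn => [t0|_]; last by rewrite mulr_ge0.
have := @expR_ge1Dxn R t^-1 k; rewrite invr_ge0 => /(_ (ltW t0)) h.
rewrite expRN gtr0_norm// ler_pdivrMr ?expR_gt0//.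
have f0 : 0 < (k.+1)`!%:R :> R by rewrite ltr0n fact_gt0.
have {}h : t^-1 ^+ k.+1 <= k.+1`!%:R * expR t^-1.
  rewrite mulrC -ler_pdivrMr// (le_trans _ h)// lerDr ler01//.
rewrite -exprVn; apply: le_trans (_ : t * t^-1 ^+ k.+1 <= _).
  by rewrite exprS mulrA divff ?gt_eqF// mul1r.
by rewrite -mulrA mulrCA ler_pM2l.
Qed.

Lemma ebump_cvg0 k : ebump k t @[t --> (0:R)] --> (0:R).
Proof.
apply: (@squeeze_cvgr _ _ _ _ (cst 0) (fun t => k.+1`!%:R * `|t|)).
- by near=> t; rewrite ebump_ge0 ebump_le.
- exact: cvg_cst.
- rewrite -[X in _ --> X](mulr0 (k.+1`!%:R)); apply: cvgMr.
  by rewrite -[X in _ --> X](@normr0 _ R); apply: cvg_norm.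
Unshelve. all: by end_near. Qed.

Lemma is_derive_ebump k t : is_derive t (1:R) (ebump k) (ebump k.+2 t - k%:R * ebump k.+1 t).
Proof.
have [t0|t0|->] := ltgtP t 0.
- rewrite !ebump_npos ?(ltW t0)// mulr0 subrr.
  apply: (@near_eq_is_derive _ _ _ (cst 0)).
  by near=> s; rewrite ebump_npos// ltW//; near: s; exact: lt_nbhsl.
- rewrite !ebump_pos//.
  apply: (@near_eq_is_derive _ _ _ (fun t => t ^- k * expR (- t^-1))).
    by near=> s; rewrite ebump_pos//; near: s; exact: lt_nbhsr.
  have tn : t != 0 by rewrite gt_eqF.
  have dV : is_derive t (1:R) (fun s => s^-1) (- t ^- 2 *: 1).
    exact: is_deriveV.
  have dE : is_derive t (1:R) (expR \o (fun s => - s^-1)) (expR (- t^-1) * (t ^- 2)).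
    apply: is_derive1_comp; apply: is_derive_eq.
    by rewrite scaleNr opprK [_ *: _]mulr1.
  have dX : is_derive t (1:R) ((fun s : R => s^-1) ^+ k)
      ((k%:R * t^-1 ^+ k.-1) *: (- t ^- 2 *: 1)).
    exact: is_deriveX.
  have dM := is_deriveM dX dE.
  have -> : (fun t => t ^- k * expR (- t^-1)) =
      ((fun s : R => s^-1) ^+ k) * (expR \o (fun s => - s^-1)).
    apply/funext => s /=; rewrite -[RHS]/((_ ^+ _) s * expR (- s^-1)).
    by rewrite -exprVn exprfctE.
  apply: (is_derive_eq dM).
  have -> : ((fun s : R => s^-1) ^+ k) t = t ^- k.
    by rewrite -exprVn exprfctE.
  rewrite /= -![_ *: _]/(_ * _) mulr1.
  case: k {dM dX} => [|k] /=; first by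
    rewrite expr0 invr1 !mul0r mulr0 addr0 subr0 mul1r mulrC.
  rewrite exprVn !exprS !invfM expr0 invr1.
  by move: (t ^- k) t^-1 (expR _) => a b c; ring.
rewrite !ebump_npos// mulr0 subrr.
(* By [ebump_factor] the slope at the origin is [ebump k.+1] itself, which is continuous there with
   value 0. *)
apply/is_derive1_caratheodory; exists (ebump k.+1); split.
- by move=> z; rewrite subr0 (ebump_npos k (lexx 0)) subr0; exact: ebump_factor.
- suff: ebump k.+1 t @[t --> (0:R)] --> ebump k.+1 (0:R) by [].
  by rewrite [X in _ --> X]ebump_npos//; exact: ebump_cvg0.
- exact: ebump_npos.
Unshelve. all: by end_near. Qed.

Lemma continuous_ebump k : continuous (ebump k).
Proof.
move=> t; apply: differentiable_continuous; apply/derivable1_diffP.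
by case: (is_derive_ebump k t).
Qed.

End Bump.

(** * Partial derivatives on an explicit class of functions *)

Section Partial.
Context {R : realType}.
Local Notation pt := (point3 R).
Implicit Types (f g : pt -> R) (x v : pt) (i j : 'I_3).

Lemma derive_lineE f x v :
  (fun h : R => h^-1 *: ((f \o shift x) (h *: v) - f x)) =
  (fun h : R => h^-1 *: (((fun t : R => f (t *: v + x)) \o shift 0) (h *: (1 : R)) -
     (fun t : R => f (t *: v + x)) 0)).
Proof.
by apply/funext => h /=; rewrite addr0 scale0r add0r [h *: (1 : R)]mulr1.
Qed.

Lemma is_derive_line f x v (l : R) :
  is_derive (0 : R) (1 : R) (fun t : R => f (t *: v + x)) l <-> is_derive x v f l.
Proof.
split=> -[h <-]; (split; [by move: h; rewrite /derivable -derive_lineE|]);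
by rewrite /derive -derive_lineE.
Qed.

Lemma is_derive_comp3 f (g : R -> R) x v (a b : R) : is_derive x v f a ->
  is_derive (f x) (1 : R) g b -> is_derive x v (g \o f) (b * a).
Proof.
move=> /is_derive_line df dg; apply/is_derive_line.
by apply: (@is_derive1_comp _ g (fun t => f (t *: v + x))); rewrite scale0r add0r.
Qed.

Lemma is_derive_coord3 i j x :
  is_derive x (axis3 R j) (coord3 i) ((i == j)%:R : R).
Proof.
apply/is_derive_line.
have -> : (fun t : R => coord3 i (t *: axis3 R j + x)) =
          (fun t => (i == j)%:R * t + coord3 i x).
  apply/funext => t; rewrite /axis3 -val_eqE.
  case: i => -[|[|[|//]]] hi; case: j => -[|[|[|//]]] hj;
  by rewrite /coord3 /= [_ *: _]mulrC.
have dZ := is_deriveZ ((i == j)%:R : R) (is_derive_id (0 : R) 1).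
have dD := is_deriveD dZ (is_derive_cst (coord3 i x) (0 : R) 1).
by apply: (is_derive_eq dD); rewrite addr0 [_ *: _]mulr1.
Qed.

Lemma is_derive_add3 f g x v (a b : R) : is_derive x v f a -> is_derive x v g b ->
  is_derive x v (fun y => f y + g y) (a + b).
Proof. exact: is_deriveD. Qed.

Lemma is_derive_mul3 f g x v (a b : R) : is_derive x v f a -> is_derive x v g b ->
  is_derive x v (fun y => f y * g y) (a * g x + f x * b).
Proof.
move=> df dg; apply: (is_derive_eq (is_deriveM df dg)).
by rewrite -![_ *: _]/(_ * _) addrC; congr (_ + _); rewrite mulrC.
Qed.

Lemma partial_val f i x (a : R) : is_derive x (axis3 R i) f a -> partial i f x = a.
Proof. by case. Qed.

Lemma is_derive_partial f i x : derivable f x (axis3 R i) ->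
  is_derive x (axis3 R i) f (partial i f x).
Proof. exact: derivableP. Qed.

(** For d > 0 the argument is positive exactly when |x|^2 < 1 - d, which keeps the support at a
    distance from the sphere. *)
Definition bump_shell (d : R) (k : nat) (x : pt) : R :=
  ebump k ((1 - sqnorm x) / d - 1).

(* Closed under partial derivatives; contains the polynomials, and cutoffs which
   vanish near the sphere and converge to 1 in the open ball as d goes to 0. *)
Inductive elementary (d : R) : (pt -> R) -> Prop :=
| elem_cst c : elementary d (cst c)
| elem_coord i : elementary d (coord3 i)
| elem_bump k : elementary d (bump_shell d k)
| elem_add f g : elementary d f -> elementary d g ->
    elementary d (fun x => f x + g x)
| elem_mul f g : elementary d f -> elementary d g ->
    elementary d (fun x => f x * g x).

Lemma is_derive_sqnorm i x :
  is_derive x (axis3 R i) (@sqnorm R) (2 * coord3 i x).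
Proof.
pose s j : pt -> R := fun y => coord3 j y * coord3 j y.
have ds j : is_derive x (axis3 R i) (s j) ((j == i)%:R * 2 * coord3 i x).
  apply: (is_derive_eq (is_derive_mul3 (is_derive_coord3 j i x) (is_derive_coord3 j i x))).
  by case: eqVneq => [->|_] /=; rewrite ?mulr1n ?mulr0n; ring.
have -> : @sqnorm R = \sum_(j < 3) s j.
  by apply/funext => y; rewrite /sqnorm fct_sumE; apply: eq_bigr => j _; rewrite expr2.
apply: (is_derive_eq (is_derive_sum ds)).
rewrite (bigD1 i)//= eqxx mul1r big1 ?addr0// => j /negPf ->.
by rewrite !mul0r.
Qed.

Lemma is_derive_bump_shell d k i x :
  is_derive x (axis3 R i) (bump_shell d k)
    ((bump_shell d k.+2 x - k%:R * bump_shell d k.+1 x) * (- (2 / d) * coord3 i x)).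
Proof.
apply: (@is_derive_comp3 (fun y => (1 - sqnorm y) / d - 1)); last exact: is_derive_ebump.
have h1 := is_derive_add3 (is_derive_cst (1 : R) x (axis3 R i))
   (is_derive_mul3 (is_derive_cst (-1 : R) x (axis3 R i)) (is_derive_sqnorm i x)).
have h2 := is_derive_add3 (is_derive_mul3 h1 (is_derive_cst (d^-1 : R) x (axis3 R i)))
  (is_derive_cst (-1 : R) x (axis3 R i)).
have -> : (fun y => (1 - @sqnorm R y) / d - 1) =
   fun y => (cst 1 y + cst (-1) y * sqnorm y) * cst d^-1 y + cst (-1) y.
  by apply/funext => y /=; rewrite mulN1r.
by apply: (is_derive_eq h2) => /=; ring.
Qed.

Lemma elementary_scale d c f : elementary d f -> elementary d (fun x => c * f x).
Proof. exact: elem_mul (elem_cst d c). Qed.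

Lemma elementary_opp d f : elementary d f -> elementary d (fun x => - f x).
Proof.
move=> /(elementary_scale (-1)); rewrite (_ : (fun x => -1 * f x) = fun x => - f x)//.
by apply/funext => x; rewrite mulN1r.
Qed.

Lemma elementary_sub d f g : elementary d f -> elementary d g ->
  elementary d (fun x => f x - g x).
Proof. by move=> df dg; apply: elem_add => //; exact: elementary_opp. Qed.

Lemma elementary_sum d (I : Type) (s : seq I) (F : I -> pt -> R) :
  (forall a, elementary d (F a)) -> elementary d (fun x => \sum_(a <- s) F a x).
Proof.
move=> dF; elim: s => [|a s IH].
  rewrite (_ : (fun=> _) = cst 0); first exact: elem_cst.
  by apply/funext => x; rewrite big_nil.
rewrite (_ : (fun=> _) = fun x => F a x + \sum_(a <- s) F a x); first exact: elem_add.
by apply/funext => x; rewrite big_cons.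
Qed.

Lemma elementary_sqnorm d : elementary d (@sqnorm R).
Proof.
rewrite /sqnorm; apply: elementary_sum => i.
rewrite (_ : (fun=> _) = fun x => coord3 i x * coord3 i x) ?expr2//.
by apply: elem_mul; exact: elem_coord.
Qed.

Lemma elementary_derive d f i : elementary d f ->
  (forall x, derivable f x (axis3 R i)) /\ elementary d (partial i f).
Proof.
have fin g h : elementary d h -> (forall x, is_derive x (axis3 R i) g (h x)) ->
    (forall x, derivable g x (axis3 R i)) /\ elementary d (partial i g).
  move=> eh dg; split=> [x|]; first by case: (dg x).
  by rewrite (_ : partial i g = h)//; apply/funext => x; exact: partial_val.
elim=> {f} [c|j|k|f g ef [df ef'] eg [dg eg']|f g ef [df ef'] eg [dg eg']].
- exact: (fin _ _ (elem_cst d 0) (fun x => is_derive_cst c x _)).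
- exact: (fin _ _ (elem_cst d (j == i)%:R) (is_derive_coord3 j i)).
- apply: fin _ (is_derive_bump_shell d k i).
  apply: elem_mul; last by apply: elementary_scale; exact: elem_coord.
  apply: elementary_sub; first exact: elem_bump.
  by apply: elementary_scale; exact: elem_bump.
- apply: (fin _ (fun x => partial i f x + partial i g x)); first exact: elem_add.
  by move=> x; apply: is_derive_add3; exact: is_derive_partial.
- apply: (fin _ (fun x => partial i f x * g x + f x * partial i g x)).
    by apply: elem_add; exact: elem_mul.
  by move=> x; apply: is_derive_mul3; exact: is_derive_partial.
Qed.

Lemma elementary_partial d f i : elementary d f -> elementary d (partial i f).
Proof. by move=> /(elementary_derive i)[]. Qed.

Lemma partialD f g i : (forall x, derivable f x (axis3 R i)) ->
  (forall x, derivable g x (axis3 R i)) ->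
  partial i (fun x => f x + g x) = fun x => partial i f x + partial i g x.
Proof.
move=> df dg; apply/funext => x; apply: partial_val.
by apply: is_derive_add3; exact: is_derive_partial.
Qed.

Lemma partialM f g i : (forall x, derivable f x (axis3 R i)) ->
  (forall x, derivable g x (axis3 R i)) ->
  partial i (fun x => f x * g x) = fun x => partial i f x * g x + f x * partial i g x.
Proof.
move=> df dg; apply/funext => x; apply: partial_val.
by apply: is_derive_mul3; exact: is_derive_partial.
Qed.

Lemma elementary_derivable d f i x : elementary d f -> derivable f x (axis3 R i).
Proof. by move=> /(elementary_derive i)[]. Qed.

Lemma partial_cst c i : partial i (cst c : pt -> R) = cst 0.
Proof. by apply/funext => x; apply: partial_val; exact: is_derive_cst. Qed.

Lemma partial_coord3 i j : partial i (coord3 j : pt -> R) = cst (j == i)%:R.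
Proof. by apply/funext => x; apply: partial_val; exact: is_derive_coord3. Qed.

Lemma partial_sqnorm i : partial i (@sqnorm R) = fun x => 2 * coord3 i x.
Proof. by apply/funext => x; apply: partial_val; exact: is_derive_sqnorm. Qed.

Lemma partial_bump_shell d k i : partial i (bump_shell d k) =
  fun x => (bump_shell d k.+2 x - k%:R * bump_shell d k.+1 x) *
           (- (2 / d) * coord3 i x).
Proof. by apply/funext => x; apply: partial_val; exact: is_derive_bump_shell. Qed.

Lemma elem_partialD d f g i : elementary d f -> elementary d g ->
  partial i (fun x => f x + g x) = fun x => partial i f x + partial i g x.
Proof.
by move=> ef eg; apply: partialD => x; apply: elementary_derivable; eassumption.
Qed.

Lemma elem_partialM d f g i : elementary d f -> elementary d g ->
  partial i (fun x => f x * g x) = fun x => partial i f x * g x + f x * partial i g x.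
Proof.
by move=> ef eg; apply: partialM => x; apply: elementary_derivable; eassumption.
Qed.

Lemma elem_partialZ d c f i : elementary d f ->
  partial i (fun x => c * f x) = fun x => c * partial i f x.
Proof.
move=> ef; have := elem_partialM i (elem_cst d c) ef; rewrite partial_cst => ->.
by apply/funext => x /=; rewrite mul0r add0r.
Qed.

Lemma elem_partialB d f g i : elementary d f -> elementary d g ->
  partial i (fun x => f x - g x) = fun x => partial i f x - partial i g x.
Proof.
move=> ef eg; rewrite (elem_partialD i ef (elementary_opp eg)).
apply/funext => x; congr (_ + _); have := elem_partialZ (-1) i eg.
have -> : (fun x => -1 * g x) = fun x => - g x by apply/funext => y; rewrite mulN1r.
by move=> ->; rewrite mulN1r.
Qed.

(** Schwarz's theorem by induction over the class. Only the bump needs a computation: its second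
    derivative is written in a form visibly symmetric in the two indices. *)
Lemma elementary_partialC d f i j : elementary d f ->
  partial i (partial j f) = partial j (partial i f).
Proof.
elim=> {f} [c|l|k|f g ef IHf eg IHg|f g ef IHf eg IHg].
- by rewrite !partial_cst.
- by rewrite !partial_coord3 !partial_cst.
- have h a b : partial a (partial b (bump_shell d k)) = fun x =>
     ((bump_shell d k.+4 x - k.+2%:R * bump_shell d k.+3 x) -
      k%:R * (bump_shell d k.+3 x - k.+1%:R * bump_shell d k.+2 x)) *
     (2 / d) ^+ 2 * (coord3 a x * coord3 b x) -
     (bump_shell d k.+2 x - k%:R * bump_shell d k.+1 x) * (2 / d) * (a == b)%:R.
    have e1 := elem_bump d k.+1; have e2 := elem_bump d k.+2; have ec := elem_coord d b.
    rewrite partial_bump_shell.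
    rewrite (elem_partialM _ (elementary_sub e2 (elementary_scale k%:R e1))
      (elementary_scale _ ec)).
    rewrite (elem_partialB _ e2 (elementary_scale k%:R e1)) !(elem_partialZ _ _ e1).
    rewrite (elem_partialZ _ _ ec) partial_coord3 !partial_bump_shell.
    by apply/funext => x /=; rewrite (eq_sym b a); ring.
  by rewrite !h; apply/funext => x; rewrite eq_sym; ring.
- rewrite (elem_partialD _ ef eg) (elem_partialD i ef eg).
  rewrite (elem_partialD _ (elementary_partial j ef) (elementary_partial j eg)).
  rewrite (elem_partialD _ (elementary_partial i ef) (elementary_partial i eg)).
  by rewrite IHf IHg.
- rewrite (elem_partialM _ ef eg) (elem_partialM i ef eg).
  have fj := elementary_partial j ef; have gj := elementary_partial j eg.
  have fi := elementary_partial i ef; have gi := elementary_partial i eg.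
  rewrite (elem_partialD _ (elem_mul fj eg) (elem_mul ef gj)).
  rewrite (elem_partialD _ (elem_mul fi eg) (elem_mul ef gi)).
  rewrite (elem_partialM _ fj eg) (elem_partialM _ ef gj).
  rewrite (elem_partialM _ fi eg) (elem_partialM _ ef gi).
  by rewrite IHf IHg; apply/funext => x; ring.
Qed.

Lemma continuous_coord3 i : continuous (coord3 i : pt -> R).
Proof.
case: i => -[|[|[|//]]] h x /=.
- apply: (@continuous_comp _ _ _ fst fst); [exact: cvg_fst|exact: cvg_fst].
- apply: (@continuous_comp _ _ _ fst snd); [exact: cvg_fst|exact: cvg_snd].
- exact: cvg_snd.
Qed.

Lemma continuous_sqnorm : continuous (@sqnorm R).
Proof.
have -> : @sqnorm R = fun x => coord3 ord0 x * coord3 ord0 x +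
    (coord3 (lift ord0 ord0) x * coord3 (lift ord0 ord0) x +
     coord3 (lift ord0 (lift ord0 ord0)) x * coord3 (lift ord0 (lift ord0 ord0)) x).
  by apply/funext => x; rewrite /sqnorm !big_ord_recl big_ord0 addr0 !expr2.
move=> x; by apply: cvgD; [|apply: cvgD]; apply: cvgM; exact: continuous_coord3.
Qed.

Lemma elementary_continuous d f : elementary d f -> continuous f.
Proof.
elim=> {f} [c|i|k|f g _ cf _ cg|f g _ cf _ cg].
- by move=> x; exact: cvg_cst.
- exact: continuous_coord3.
- move=> x; apply: (@continuous_comp _ _ _ (fun y => (1 - @sqnorm R y) / d - 1)).
    apply: cvgB; last exact: cvg_cst.
    apply: cvgMl; apply: cvgB; first exact: cvg_cst.
    exact: continuous_sqnorm.
  exact: continuous_ebump.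
- by move=> x; apply: cvgD; [exact: cf|exact: cg].
- by move=> x; apply: cvgM; [exact: cf|exact: cg].
Qed.

Lemma smooth_elementary d f : elementary d f -> smooth f.
Proof.
move=> ef s; have : elementary d (foldr (@partial R) f s).
  by elim: s => //= i s; exact: elementary_partial.
move=> es; split; first exact: elementary_continuous es.
by move=> i x; exact: elementary_derivable es.
Qed.

End Partial.

(** * Measurability, null sets and dominated convergence *)

Section Borel3.
Context {R : realType}.
Local Notation pt :=
  (measurableTypeR R * measurableTypeR R * measurableTypeR R)%type.
Local Notation B := (@ball3 R : set pt).
Local Notation mu := (@mu3 R).
Implicit Types (f g h u v : pt -> R) (x : pt) (M c : R).

(** An open set is the countable union of the cubes with rational centre and radius 1/(n + 1) that
    it contains, and such cubes are measurable for the product sigma-algebra. *)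
Lemma open_measurable3 (O : set (point3 R)) : open O -> measurable (O : set pt).
Proof.
move=> oO.
pose F (q : rat * rat * rat * nat) : set pt :=
  let r := q.2.+1%:R^-1 in
  (ball (ratr q.1.1.1 : R) r `*` ball (ratr q.1.1.2 : R) r) `*` ball (ratr q.1.2 : R) r.
pose G q := if `[< F q `<=` O >] then F q else set0.
have -> : O = \bigcup_q G q.
  apply/seteqP; split=> [x Ox|x [q _]]; last first.
    by rewrite /G; case: asboolP => // h /h.
  have /nbhs_ballP[e /= e0 eO] : nbhs x O by exact: open_nbhs_nbhs.
  have [n ne] : exists n : nat, n.+1%:R^-1 < e / 2.
    have e20 : 0 < e / 2 by rewrite divr_gt0.
    by have /filter_ex[n] := near_infty_natSinv_lt (PosNum e20); exists n.
  set r := n.+1%:R^-1 in ne; have r0 : 0 < r by rewrite invr_gt0.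
  have rx (y : R) : exists q : rat, `|ratr q - y| < r.
    have : y - r < y + r by rewrite ltrD2l gt0_cp.
    by move=> /rat_in_itvoo[q]; rewrite in_itv/= -ltr_distl; exists q.
  have [q1 h1] := rx x.1.1; have [q2 h2] := rx x.1.2; have [q3 h3] := rx x.2.
  exists (q1, q2, q3, n) => //; rewrite /G; case: asboolP => [_|]; first by [].
  case; move=> y [[/= y1 y2] y3]; apply: eO; split; first split.
  - by rewrite /ball/= in y1 *;
    rewrite (le_lt_trans (ler_distD (ratr q1) _ _))// (splitr e) ltrD// (lt_trans _ ne)// distrC.
  - by rewrite /ball/= in y2 *;
    rewrite (le_lt_trans (ler_distD (ratr q2) _ _))// (splitr e) ltrD// (lt_trans _ ne)// distrC.
  - by rewrite /ball/= in y3 *;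
    rewrite (le_lt_trans (ler_distD (ratr q3) _ _))// (splitr e) ltrD// (lt_trans _ ne)// distrC.
apply: countable_bigcupT_measurable => // q; rewrite /G; case: asboolP => // _.
by apply: measurableX; [apply: measurableX|]; exact: measurable_ball.
Qed.

Lemma continuous_measurable3 (f : point3 R -> R) : continuous f ->
  measurable_fun [set: pt] f.
Proof.
move=> cf _; apply: (measurability _ (RGenOInfty.measurableE R)) => //.
move=> /= _ [_ [a ->] <-]; rewrite setTI; apply: open_measurable3.
by apply: open_comp => [x _|]; [exact: cf|rewrite set_itvoy; exact: open_gt].
Qed.

Lemma continuous_bounded_ball (f : point3 R -> R) : continuous f ->
  exists2 M, 0 <= M & forall x, ball3 x -> `|f x| <= M.
Proof.
move=> cf; pose K : set (point3 R) := (`[-1, 1] `*` `[-1, 1]) `*` `[-1, 1].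
have cK : compact K.
  by apply: compact_setX; [apply: compact_setX|]; exact: segment_compact.
have := compact_bounded (continuous_compact (continuous_subspaceT cf) cK).
move=> [M [_ hM]]; exists (`|M| + 1); first by rewrite addr_ge0.
move=> x xB; apply: (hM (`|M| + 1)); first by rewrite ltr_pwDr// ler_norm.
exists x => //; case: x xB => [[x y] z] xB; rewrite /K /= !in_itv/= -!ler_norml.
by have := coord3_ball 0 xB; have := coord3_ball 1 xB; have := coord3_ball 2 xB.
Qed.

Lemma continuous_measurable_ball (f : point3 R -> R) : continuous f ->
  measurable_fun B f.
Proof. by move=> /continuous_measurable3; exact: measurable_funTS. Qed.

Lemma L2_continuous (f : point3 R -> R) : continuous f -> L2 f.
Proof.
move=> cf; have [M _ hM] := continuous_bounded_ball cf.
by apply: L2_bounded hM; exact: continuous_measurable_ball.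
Qed.

Lemma L2_mul_continuous (b f : point3 R -> R) : continuous b -> L2 f ->
  L2 (fun x => b x * f x).
Proof.
move=> cb fL; have [M _ hM] := continuous_bounded_ball cb.
by apply: L2_mulb hM fL; exact: continuous_measurable_ball.
Qed.

Lemma L2_elementary d (f : point3 R -> R) : elementary d f -> L2 f.
Proof. by move=> /elementary_continuous; exact: L2_continuous. Qed.

Lemma L2_mul_elementary d (b f : point3 R -> R) : elementary d b -> L2 f ->
  L2 (fun x => b x * f x).
Proof. by move=> /elementary_continuous; exact: L2_mul_continuous. Qed.

Lemma mu3_null (S : set pt) : measurable S ->
  (forall xy, finite_set [set z : R | S (xy, z)]) -> mu S = 0%E.
Proof.
move=> mS S0.
transitivity (\int[(@lebesgue_measure R \x @lebesgue_measure R)%E]_xy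
  (@lebesgue_measure R (xsection S xy)))%E; first by [].
apply: integral0_eq => xy _.
have -> : xsection S xy = [set z : R | S (xy, z)].
  by apply/seteqP; split=> z; rewrite /xsection /= inE.
by apply: countable_lebesgue_measure0; exact: finite_set_countable.
Qed.

(** A line parallel to the third axis meets the sphere in at most two points. *)
Lemma sphere_null : mu [set x : pt | sqnorm x = 1] = 0%E.
Proof.
have mS : measurable ([set x : pt | sqnorm x = 1] : set pt).
  have -> : [set x : pt | sqnorm x = 1] = [set: pt] `&` (@sqnorm R) @^-1` [set 1].
    by rewrite setTI.
  exact: measurable_sqnorm.
apply: mu3_null mS _ => xy.
pose s := Num.sqrt (1 - (xy.1 ^+ 2 + xy.2 ^+ 2)).
apply: (@sub_finite_set _ _ [set s; - s]); last exact: finite_set2.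
move=> z; rewrite /= /sqnorm !big_ord_recl big_ord0 /coord3/= => h.
have zE : z ^+ 2 = 1 - (xy.1 ^+ 2 + xy.2 ^+ 2) by rewrite -h; ring.
have /eqP : z ^+ 2 = s ^+ 2 by rewrite sqr_sqrtr -?zE ?sqr_ge0.
by rewrite eqf_sqr => /orP[] /eqP ->; [left|right].
Qed.

Lemma plane_null (i : 'I_3) (a : R) : mu [set x : pt | coord3 i x = a] = 0%E.
Proof.
case: i => -[|[|[|//]]] ilt.
- have -> : [set x : pt | coord3 (Ordinal ilt) x = a] = ([set a] `*` setT) `*` setT.
    by apply/seteqP; split=> -[[x y] z] /=; rewrite /coord3/=; tauto.
  rewrite /mu3 product_measure1E//=; last exact: measurableX.
  by rewrite product_measure1E//= lebesgue_measure_set1 !mul0e.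
- have -> : [set x : pt | coord3 (Ordinal ilt) x = a] = (setT `*` [set a]) `*` setT.
    by apply/seteqP; split=> -[[x y] z] /=; rewrite /coord3/=; tauto.
  rewrite /mu3 product_measure1E//=; last exact: measurableX.
  by rewrite product_measure1E//= lebesgue_measure_set1 mule0 mul0e.
- have -> : [set x : pt | coord3 (Ordinal ilt) x = a] = setT `*` [set a].
    by apply/seteqP; split=> -[[x y] z] /=; rewrite /coord3/=; tauto.
  by rewrite /mu3 product_measure1E//= lebesgue_measure_set1 mule0.
Qed.

Lemma L2_dominated (u_ : nat -> pt -> R) h (N : set pt) :
  (forall n, L2 (u_ n)) -> L2 h -> mu.-negligible N ->
  (forall x, ball3 x -> ~ N x -> u_ n x @[n --> \oo] --> (0 : R)) ->
  (forall n x, ball3 x -> `|u_ n x| <= h x) ->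
  L2dot (u_ n) (u_ n) @[n --> \oo] --> (0 : R).
Proof.
move=> uL hL N0 cu le_uh.
have /L2P[mh ih] := hL.
have [| | | | |_ _] := @dominated_convergence _ _ _ mu _ (measurable_ball3)
    (fun n => EFin \o (fun x => u_ n x * u_ n x)) (cst 0%E)
    (EFin \o (fun x => h x ^+ 2)).
- move=> n; apply/measurable_EFinP; apply: measurable_funM; exact: L2_measurable.
- exact: measurable_cst.
- case: N0 => N' [mN' N'0 NN']; exists N'; split => // x /= hx; apply: NN'.
  apply: contrapT => nx; apply: hx => xB.
  apply: cvg_EFin; first by near=> n.
  by rewrite -[X in _ --> X](mulr0 0); apply: cvgM; exact: cu.
- exact: ih.
- apply: aeW => x n xB /=; rewrite lee_fin normrM -expr2.
  rewrite -[leRHS]real_normK ?num_real// lerXn2r ?nnegrE//.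
  by rewrite (le_trans (le_uh n x xB))// ler_norm.
rewrite integral0 => /fine_cvg /=; exact.
Unshelve. all: by end_near. Qed.

End Borel3.

(** * Polynomials and their density in L2 *)

Section Poly3.
Context {R : realType}.
Local Notation pt := (point3 R).
Implicit Types (f g h p q : pt -> R) (x : pt) (c : R) (i j : 'I_3) (k m n : nat).

(** An inductive counterpart of [homogeneous_poly], convenient for products and derivatives;
    [hom_homogeneous] and [homogeneous_hom] identify the two. *)
Inductive hom : nat -> (pt -> R) -> Prop :=
| hom_cst c : hom 0 (cst c)
| hom_coord n i f : hom n f -> hom n.+1 (fun x => coord3 i x * f x)
| hom_add n f g : hom n f -> hom n g -> hom n (fun x => f x + g x).

(** Peeling off the top homogeneous part is the shape in which the triangular action of the operator
    L is visible. *)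
Fixpoint poly n p : Prop := if n is n'.+1 then
  exists h q, [/\ hom n h, poly n' q & p = fun x => h x + q x] else hom 0 p.

Lemma homZ n c f : hom n f -> hom n (fun x => c * f x).
Proof.
elim=> {n f} [a|n i f _ IH|n f g _ IHf _ IHg].
- exact: (hom_cst (c * a)).
- rewrite (_ : (fun=> _) = fun x => coord3 i x * (c * f x)); first exact: hom_coord.
  by apply/funext => x; rewrite mulrCA.
- rewrite (_ : (fun=> _) = fun x => c * f x + c * g x); first exact: hom_add.
  by apply/funext => x; rewrite mulrDr.
Qed.

Lemma hom0 n : hom n (cst 0).
Proof.
elim: n => [|n IH]; first exact: hom_cst.
rewrite (_ : cst 0 = fun x => coord3 0 x * cst 0 x :> R); first exact: hom_coord.
by apply/funext => x /=; rewrite mulr0.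
Qed.

Lemma homM m n f g : hom m f -> hom n g -> hom (m + n) (fun x => f x * g x).
Proof.
move=> hf hg; elim: hf => {m f} [a|m i f _ IH|m f h _ IHf _ IHh].
- exact: homZ.
- rewrite (_ : (fun=> _) = fun x => coord3 i x * (f x * g x)); first exact: hom_coord.
  by apply/funext => x; rewrite mulrA.
- rewrite (_ : (fun=> _) = fun x => f x * g x + h x * g x); first exact: hom_add.
  by apply/funext => x; rewrite mulrDl.
Qed.

Lemma hom_coord1 i : hom 1 (coord3 i).
Proof.
rewrite (_ : coord3 i = fun x => coord3 i x * cst 1 x :> R).
  by apply: hom_coord; exact: hom_cst.
by apply/funext => x /=; rewrite mulr1.
Qed.

Lemma hom_sum n (I : Type) (s : seq I) (F : I -> pt -> R) :
  (forall a, hom n (F a)) -> hom n (fun x => \sum_(a <- s) F a x).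
Proof.
move=> hF; elim: s => [|a s IH].
  rewrite (_ : (fun=> _) = cst 0); first exact: hom0.
  by apply/funext => x; rewrite big_nil.
rewrite (_ : (fun=> _) = fun x => F a x + \sum_(i <- s) F i x); first exact: hom_add.
by apply/funext => x; rewrite big_cons.
Qed.

Lemma hom_sqnorm : hom 2 (@sqnorm R).
Proof.
apply: hom_sum => i; rewrite (_ : (fun=> _) = fun x => coord3 i x * coord3 i x) ?expr2//.
exact: hom_coord (hom_coord1 i).
Qed.

Lemma hom_elementary d n f : hom n f -> elementary d f.
Proof.
elim=> {n f} [c|n i f _ IH|n f g _ IHf _ IHg].
- exact: elem_cst.
- by apply: elem_mul => //; exact: elem_coord.
- exact: elem_add.
Qed.

Lemma hom_poly n f : hom n f -> poly n f.
Proof.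
case: n => // n hf; exists f, (cst 0); split => //=.
  elim: n {hf} => [|n IH] /=; first exact: hom_cst.
  exists (cst 0), (cst 0); split => //; first exact: hom0.
  by apply/funext => x /=; rewrite addr0.
by apply/funext => x /=; rewrite addr0.
Qed.

Lemma polyD n p q : poly n p -> poly n q -> poly n (fun x => p x + q x).
Proof.
elim: n p q => [|n IH] p q /=; first exact: hom_add.
move=> [hp [p' [hhp pp' ->]]] [hq [q' [hhq pq' ->]]].
exists (fun x => hp x + hq x), (fun x => p' x + q' x); split.
- exact: hom_add.
- exact: IH.
- by apply/funext => x; rewrite addrACA.
Qed.

Lemma polyZ n c p : poly n p -> poly n (fun x => c * p x).
Proof.
elim: n p => [|n IH] p /=; first exact: homZ.
move=> [h [q [hh pq ->]]]; exists (fun x => c * h x), (fun x => c * q x).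
by split; [exact: homZ|exact: IH|apply/funext => x; rewrite mulrDr].
Qed.

Lemma polyS n p : poly n p -> poly n.+1 p.
Proof.
move=> pp; exists (cst 0), p; split => //; first exact: hom0.
by apply/funext => x /=; rewrite add0r.
Qed.

Lemma poly_mono m n p : (m <= n)%N -> poly m p -> poly n p.
Proof.
move=> /subnK <- pp; elim: (n - m)%N => // k IH.
by rewrite addSn; exact: polyS.
Qed.

Lemma poly_cst n c : poly n (cst c).
Proof. by apply: (@poly_mono 0) => //; exact: hom_cst. Qed.

Lemma polyB n p q : poly n p -> poly n q -> poly n (fun x => p x - q x).
Proof.
move=> pp /(polyZ (-1)) pq; have := polyD pp pq.
by congr poly; apply/funext => x; rewrite mulN1r.
Qed.

Lemma poly_hom_mul m n h p : hom m h -> poly n p -> poly (m + n) (fun x => h x * p x).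
Proof.
move=> hh; elim: n p => [|n IH] p /=; first by move=> hp; apply: hom_poly; exact: homM.
move=> [g [q [hg pq ->]]].
rewrite (_ : (fun=> _) = fun x => h x * g x + h x * q x).
  apply: (@polyD _ (fun x => h x * g x) (fun x => h x * q x)).
    by apply: hom_poly; exact: homM.
  by apply: poly_mono (IH _ pq); rewrite leq_add2l.
by apply/funext => x; rewrite mulrDr.
Qed.

Lemma polyM m n p q : poly m p -> poly n q -> poly (m + n) (fun x => p x * q x).
Proof.
elim: m p => [|m IH] p; first exact: poly_hom_mul.
move=> [h [p' [hh pp' ->]]] pq.
rewrite (_ : (fun=> _) = fun x => h x * q x + p' x * q x).
  apply: (@polyD _ (fun x => h x * q x) (fun x => p' x * q x)).
    exact: poly_hom_mul.
  by rewrite addSn; apply: polyS; exact: IH.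
by apply/funext => x; rewrite mulrDl.
Qed.

Lemma poly_elementary d n p : poly n p -> elementary d p.
Proof.
elim: n p => [|n IH] p /=; first exact: hom_elementary.
by move=> [h [q [hh pq ->]]]; apply: elem_add; [exact: hom_elementary hh|exact: IH].
Qed.

Lemma L2_poly n p : poly n p -> L2 p.
Proof. by move=> /(poly_elementary 1)/L2_elementary. Qed.

Definition L2_inner : semi_inner (pt -> R) :=
  @SemiInner R (pt -> R) (@L2 R) (@L2dot R) (L2_cst 0) (@L2D R) (@L2Z R)
    (@L2dotC R) (@L2dotDl R) (@L2dotZl R) (fun u _ => L2dot_ge0 u).

Lemma L2dotDr f g h : L2 f -> L2 g -> L2 h ->
  L2dot h (fun x => f x + g x) = L2dot h f + L2dot h g.
Proof. exact: (@ipDr _ _ L2_inner). Qed.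

Lemma L2dotBl f g h : L2 f -> L2 g -> L2 h ->
  L2dot (fun x => f x - g x) h = L2dot f h - L2dot g h.
Proof. exact: (@ipBl _ _ L2_inner). Qed.

Lemma L2dotBr f g h : L2 f -> L2 g -> L2 h ->
  L2dot h (fun x => f x - g x) = L2dot h f - L2dot h g.
Proof. exact: (@ipBr _ _ L2_inner). Qed.

Lemma L2dotZr c f h : L2 f -> L2 h -> L2dot h (fun x => c * f x) = c * L2dot h f.
Proof. by move=> fL hL; apply: (@ipZr _ _ L2_inner). Qed.

Lemma L2dot_CS f g : L2 f -> L2 g -> L2dot f g ^+ 2 <= L2dot f f * L2dot g g.
Proof. exact: (@ip_CS _ _ L2_inner). Qed.

Lemma L2dot_sqD f g : L2 f -> L2 g ->
  L2dot (f \+ g) (f \+ g) <= 2 * L2dot f f + 2 * L2dot g g.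
Proof.
move=> fL gL; have := L2dot_ge0 (fun x => f x - g x).
have gfL := L2B fL gL; have fgL := L2D fL gL.
rewrite L2dotBl// !L2dotBr// L2dotDl// !L2dotDr// (L2dotC g f).
by lra.
Qed.

Lemma L2dot_sq_mulb (b f : pt -> R) (M : R) : L2 (fun x => b x * f x) -> L2 f ->
  (forall x, ball3 x -> `|b x| <= M) ->
  L2dot (fun x => b x * f x) (fun x => b x * f x) <= M ^+ 2 * L2dot f f.
Proof.
move=> bfL fL bM; rewrite -L2dotZl//; apply: le_Rintegral.
- exact: measurable_ball3.
- exact: L2_integrableM.
- by apply: L2_integrableM => //; exact: L2Z.
move=> x xB; rewrite -!expr2 -mulrA -expr2 exprMn ler_wpM2r ?sqr_ge0//.
rewrite -real_normK ?num_real// lerXn2r ?nnegrE ?bM//.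
by rewrite (le_trans (normr_ge0 (b x)))// bM.
Qed.

End Poly3.

(** * Polynomial approximation of a step at one half *)

Section StepApproximation.
Context {R : realType}.
Implicit Types (x y : R) (n : nat).

Lemma bernoulli_ineq x n : -1 <= x -> 1 + n%:R * x <= (1 + x) ^+ n.
Proof.
move=> x1; elim: n => [|n IH]; first by rewrite expr0 mul0r addr0.
have x0 : 0 <= 1 + x by lra.
rewrite exprS; apply: le_trans (ler_wpM2l x0 IH).
rewrite -natr1; have := mulr_ge0 (ler0n R n) (sqr_ge0 x); nra.
Qed.

(* The sequence used in the elementary proof of the Stone-Weierstrass theorem. *)
Definition step_poly n y : R := (1 - y ^+ n) ^+ (2 ^ n).

Lemma step_poly_itv n y : 0 <= y <= 1 -> 0 <= step_poly n y <= 1.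
Proof.
move=> /andP[y0 y1]; have yn : 0 <= y ^+ n <= 1 by rewrite exprn_ge0//= exprn_ile1.
case/andP: yn => yn0 yn1.
by rewrite /step_poly exprn_ge0 ?exprn_ile1//; lra.
Qed.

Lemma step_poly_cvg1 y : 0 <= y -> y < 2^-1 -> step_poly n y @[n --> \oo] --> (1 : R).
Proof.
move=> y0 yh; apply: (@squeeze_cvgr _ _ _ _ (fun n => 1 - (2 * y) ^+ n) (cst 1)).
- near=> n; have /andP[_ q1] : 0 <= step_poly n y <= 1.
    by apply: step_poly_itv; rewrite y0/=; lra.
  rewrite q1 andbT.
  have yn : y ^+ n <= 1 by rewrite exprn_ile1//; lra.
  have := @bernoulli_ineq (- y ^+ n) (2 ^ n); rewrite lerN2 => /(_ yn).
  by rewrite mulrN natrX -exprMn.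
- rewrite -[X in _ --> X]subr0; apply: cvgB; first exact: cvg_cst.
  by apply: cvg_expr; rewrite ger0_norm ?mulr_ge0//; lra.
- exact: cvg_cst.
Unshelve. all: by end_near. Qed.

(** The product of (1 - y^n)^(2^n) and (1 + y^n)^(2^n) is at most 1, and by Bernoulli the second
    factor is at least (2 y)^n, which tends to infinity. *)
Lemma step_poly_cvg0 y : y <= 1 -> 2^-1 < y -> step_poly n y @[n --> \oo] --> (0 : R).
Proof.
move=> y1 yh; have y0 : 0 < y by lra.
apply: (@squeeze_cvgr _ _ _ _ (cst 0) (fun n => (2 * y)^-1 ^+ n)).
- near=> n; have /andP[q0 _] : 0 <= step_poly n y <= 1.
    by apply: step_poly_itv; rewrite (ltW y0).
  rewrite q0 /=.
  have yn : 0 < y ^+ n by rewrite exprn_gt0.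
  have yn1 : y ^+ n <= 1 by rewrite exprn_ile1// ltW.
  have h1 := @bernoulli_ineq (y ^+ n) (2 ^ n) (le_trans (lerN10 R) (ltW yn)).
  have p0 : 0 < (1 + y ^+ n) ^+ (2 ^ n) by rewrite exprn_gt0// addr_gt0.
  have h2 : step_poly n y * (1 + y ^+ n) ^+ (2 ^ n) <= 1.
    by rewrite /step_poly -exprMn exprn_ile1//; nra.
  rewrite exprVn -[leRHS]mul1r ler_pdivlMr ?exprn_gt0 ?mulr_gt0//.
  apply: le_trans h2; apply: (ler_wpM2l q0).
  by apply: le_trans h1; rewrite natrX -exprMn lerDr.
- exact: cvg_cst.
- apply: cvg_expr; rewrite ger0_norm ?invr_ge0 ?mulr_ge0 ?(ltW y0)//.
  by rewrite invf_lt1; lra.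
Unshelve. all: by end_near. Qed.

End StepApproximation.

(** * Density of the polynomials by a generating-class argument *)

Section PolyDense.
Import HBSimple HBNNSimple.
Context {R : realType}.
Local Notation pt :=
  (measurableTypeR R * measurableTypeR R * measurableTypeR R)%type.
Local Notation B := (@ball3 R : set pt).
Implicit Types (f g h u v : pt -> R) (x : pt) (M c e a : R) (i : 'I_3).

Definition poly_limit f := L2 f /\ forall e, 0 < e ->
  exists n p, poly n p /\ L2dot (f \- p) (f \- p) < e.

Lemma poly_limit_closed f : L2 f -> (forall e, 0 < e ->
  exists g, poly_limit g /\ L2dot (f \- g) (f \- g) < e) -> poly_limit f.
Proof.
move=> fL h; split=> // e e0.
have e4 : 0 < e / 4 by rewrite divr_gt0.
have [g [[gL gp] fg]] := h _ e4; have [n [p [pp gp']]] := gp _ e4.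
exists n, p; split => //; have pL := L2_poly pp.
rewrite (_ : f \- p = (f \- g) \+ (g \- p)); last first.
  by apply/funext => x /=; rewrite addrA subrK.
by apply: le_lt_trans (L2dot_sqD (L2B fL gL) (L2B gL pL)) _; lra.
Qed.

Lemma poly_limit_poly n p : poly n p -> poly_limit p.
Proof.
move=> pp; split; first exact: L2_poly pp.
move=> e e0; exists n, p; split => //.
have pL := L2_poly pp; rewrite (_ : p \- p = fun x => 0 * p x).
  by rewrite L2dotZl// ?mul0r//; exact: L2Z.
by apply/funext => x /=; rewrite subrr mul0r.
Qed.

Lemma poly_limit_cvg (u_ : nat -> pt -> R) f : (forall n, poly_limit (u_ n)) ->
  L2 f -> L2dot (f \- u_ n) (f \- u_ n) @[n --> \oo] --> (0 : R) -> poly_limit f.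
Proof.
move=> uP fL cu; apply: poly_limit_closed => // e e0.
have /cvgrPdist_lt /(_ e e0) /filter_ex[n] := cu.
rewrite sub0r normrN ger0_norm; last exact: L2dot_ge0.
by move=> h; exists (u_ n).
Qed.

Lemma poly_limitD f g : poly_limit f -> poly_limit g -> poly_limit (f \+ g).
Proof.
move=> [fL fp] [gL gp]; split; first exact: L2D.
move=> e e0; have e4 : 0 < e / 4 by rewrite divr_gt0.
have [m [p [pp fpe]]] := fp _ e4; have [n [q [pq gqe]]] := gp _ e4.
exists (m + n)%N, (fun x => p x + q x); split.
  by apply: polyD; [exact: poly_mono (leq_addr _ _) pp|exact: poly_mono (leq_addl _ _) pq].
rewrite (_ : _ \- _ = (f \- p) \+ (g \- q)); last first.
  by apply/funext => x /=; rewrite opprD addrACA.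
apply: le_lt_trans (L2dot_sqD (L2B fL (L2_poly pp)) (L2B gL (L2_poly pq))) _.
by lra.
Qed.

(** Two approximations in turn: f by a polynomial p, at the cost of the bound of g, then g by a
    polynomial, at the cost of the bound of p on the ball. *)
Lemma poly_limitM f g M : poly_limit f -> poly_limit g ->
  (forall x, ball3 x -> `|g x| <= M) -> poly_limit (fun x => f x * g x).
Proof.
move=> [fL fp] [gL gp] gM.
have fgL : L2 (fun x => f x * g x).
  rewrite (_ : (fun=> _) = fun x => g x * f x).
    exact: L2_mulb (L2_measurable gL) gM fL.
  by apply/funext => x; rewrite mulrC.
have M0 : 0 <= M ^+ 2 by exact: sqr_ge0.
apply: poly_limit_closed => // e e0.
have eM : 0 < e / (M ^+ 2 + 1) by rewrite divr_gt0// ltr_wpDl.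
have [m [p [pp fpe]]] := fp _ eM; have pL := L2_poly pp.
have cp := elementary_continuous (poly_elementary 1 pp).
have [P P0 pP] := continuous_bounded_ball cp.
have pgL : L2 (fun x => p x * g x) by exact: L2_mul_continuous.
exists (fun x => p x * g x); split; last first.
  rewrite (_ : _ \- _ = fun x => g x * (f \- p) x); last first.
    by apply/funext => x /=; ring.
  apply: le_lt_trans (L2dot_sq_mulb _ (L2B fL pL) gM) _.
    exact: L2_mulb (L2_measurable gL) gM (L2B fL pL).
  have M1 : 0 < M ^+ 2 + 1 by rewrite ltr_wpDl.
  apply: le_lt_trans (_ : (M ^+ 2 + 1) * L2dot (f \- p) (f \- p) < e).
    by rewrite mulrDl mul1r lerDl L2dot_ge0.
  by rewrite mulrC -ltr_pdivlMr.
split=> // d d0.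
have dP : 0 < d / (P ^+ 2 + 1) by rewrite divr_gt0// ltr_wpDl// sqr_ge0.
have [n [q [pq gqe]]] := gp _ dP; have qL := L2_poly pq.
exists (m + n)%N, (fun x => p x * q x); split; first exact: polyM.
rewrite (_ : _ \- _ = fun x => p x * (g \- q) x); last first.
  by apply/funext => x /=; ring.
apply: le_lt_trans (L2dot_sq_mulb _ (L2B gL qL) pP) _.
  exact: L2_mul_continuous cp (L2B gL qL).
have P1 : 0 < P ^+ 2 + 1 by rewrite ltr_wpDl// sqr_ge0.
apply: le_lt_trans (_ : (P ^+ 2 + 1) * L2dot (g \- q) (g \- q) < d).
  by rewrite mulrDl mul1r lerDl L2dot_ge0.
by rewrite mulrC -ltr_pdivlMr.
Qed.

Lemma poly_limitZ c f : poly_limit f -> poly_limit (fun x => c * f x).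
Proof.
move=> fp; rewrite (_ : (fun=> _) = fun x => f x * cst c x).
  apply: (@poly_limitM f (cst c) `|c|) => //; exact: poly_limit_poly (poly_cst 0 c).
by apply/funext => x; rewrite mulrC.
Qed.

Lemma poly_limitB f g : poly_limit f -> poly_limit g -> poly_limit (f \- g).
Proof.
move=> fp gp; rewrite (_ : f \- g = f \+ (fun x => -1 * g x)).
  by apply: poly_limitD => //; exact: poly_limitZ.
by apply/funext => x /=; rewrite mulN1r.
Qed.

Lemma polyX n m p : poly n p -> poly (m * n) (fun x => p x ^+ m).
Proof.
move=> pp; elim: m => [|m IH]; first exact: poly_cst.
rewrite (_ : (fun=> _) = fun x => p x * p x ^+ m) ?mulSn; first exact: polyM.
by apply/funext => x; rewrite exprS.
Qed.

Lemma norm_indic_le1 (A : set pt) x : `|\1_A x : R| <= 1.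
Proof. by rewrite indicE normr_nat lern1 leq_b1. Qed.

Lemma L2_indic (A : set pt) : measurable A -> L2 (\1_A : pt -> R).
Proof.
move=> mA; apply: (@L2_bounded _ _ 1); last by move=> x _; exact: norm_indic_le1.
by apply: measurable_funTS; exact: measurable_indic.
Qed.

Lemma measurable_halfspace i a : measurable ([set x : pt | coord3 i x < a] : set pt).
Proof.
have -> : [set x : pt | coord3 i x < a] = [set: pt] `&` coord3 i @^-1` `]-oo, a[.
  by rewrite setTI; apply/seteqP; split=> x /=; rewrite in_itv.
exact: measurable_coord3.
Qed.

(** The affine function y equals 1/2 on the boundary plane and, as |coord3 i x - a| <= 1 + |a|, maps
    the ball to [0, 1]; the step polynomials of y converge to the indicator off that plane. *)
Lemma poly_limit_halfspace i a : poly_limit \1_[set x : pt | coord3 i x < a].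
Proof.
set A := [set x : pt | _]; have mA : measurable (A : set pt) by exact: measurable_halfspace.
pose y (x : pt) : R := 2^-1 + (2 * (1 + `|a|))^-1 * (coord3 i x + (- a)).
have a0 : 0 < 2 * (1 + `|a|) by rewrite mulr_gt0// ltr_pwDl.
have py : poly 1 y.
  apply: polyD; first exact: poly_cst.
  by apply: polyZ; apply: polyD; [exact/hom_poly/hom_coord1|exact: poly_cst].
pose u n (x : pt) := step_poly n (y x).
have pu n : exists m, poly m (u n).
  exists (2 ^ n * (n * 1))%N; rewrite /u /step_poly.
  apply: (@polyX _ _ (fun x => 1 - y x ^+ n)); apply: polyB; first exact: poly_cst.
  exact: polyX.
have yitv x : ball3 x -> 0 <= y x <= 1.
  move=> xB; have := coord3_ball i xB; rewrite ler_norml => /andP[c1 c2].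
  have := ler_norm a.
  have := ler_norm (- a); rewrite normrN => a1 a2.
  rewrite /y; set D := 2 * _ in a0 *.
  have -> : 2^-1 = D^-1 * (1 + `|a|) by rewrite /D; field; rewrite gt_eqF// ltr_pwDl.
  rewrite -mulrDr mulr_ge0 ?invr_ge0 ?(ltW a0)//=; last by lra.
  by rewrite mulrC ler_pdivrMr// mul1r /D; lra.
have uL n : L2 (u n) by have [m pm] := pu n; exact: L2_poly pm.
apply: (@poly_limit_cvg u) => [n||]; first by have [m pm] := pu n; exact: poly_limit_poly pm.
  exact: L2_indic.
apply: (@L2_dominated _ (fun n => \1_A \- u n) (cst 1) [set x | coord3 i x = a]).
- by move=> n; apply: L2B => //; exact: L2_indic.
- exact: L2_cst.
- apply/negligibleP; last exact: plane_null.
  have -> : [set x : pt | coord3 i x = a] = [set: pt] `&` coord3 i @^-1` [set a].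
    by rewrite setTI.
  exact: measurable_coord3.
- move=> x xB /= /eqP xa; have /andP[y0 y1] := yitv x xB.
  have [xA|xA] := ltP (coord3 i x) a.
    rewrite indicE mem_set// -[X in _ --> X](subrr 1); apply: cvgB; first exact: cvg_cst.
    apply: step_poly_cvg1 => //; rewrite /y gtrDl pmulr_rlt0 ?invr_gt0//; lra.
  rewrite indicE memNset/=; last by apply/negP; rewrite -leNgt.
  rewrite -[X in _ --> X](subrr 0); apply: cvgB; first exact: cvg_cst.
  apply: step_poly_cvg0 => //; rewrite /y ltrDl mulr_gt0 ?invr_gt0//.
  by rewrite subr_gt0 lt_neqAle eq_sym xa.
- move=> n x xB /=; have /andP[u0 u1] := step_poly_itv n (yitv x xB).
  rewrite -/(u n x) in u0 u1; rewrite indicE.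
  by case: (_ \in _); rewrite ler_norml /=; apply/andP; split; lra.
Qed.

Definition poly_limit_sets : set (set pt) :=
  [set A | measurable A /\ poly_limit (\1_A : pt -> R)].

(** Complements are differences from 1 and intersections are products, both kept by limits of
    polynomials; countable unions follow by dominated convergence from finite ones. *)
Lemma poly_limit_sigma_algebra : sigma_algebra setT poly_limit_sets.
Proof.
have hC A : poly_limit_sets A -> poly_limit_sets (~` A).
  move=> [mA lA]; split; first exact: measurableC.
  rewrite (_ : \1_(~` A) = cst 1 \- \1_A :> (pt -> R)).
    by apply: poly_limitB => //; exact: poly_limit_poly (poly_cst 0 1).
  by apply/funext => x /=; rewrite !indicE in_setC; case: (_ \in _); rewrite ?subr0 ?subrr.
have hI A A' : poly_limit_sets A -> poly_limit_sets A' -> poly_limit_sets (A `&` A').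
  move=> [mA lA] [mA' lA']; split; first exact: measurableI.
  rewrite (_ : \1_(A `&` A') = fun x => \1_A x * \1_A' x :> R).
    by apply: (@poly_limitM _ _ 1) => // x _; exact: norm_indic_le1.
  by apply/funext => x; rewrite !indicE in_setI -natrM mulnb.
have hU A A' : poly_limit_sets A -> poly_limit_sets A' -> poly_limit_sets (A `|` A').
  by move=> hA hA'; rewrite -[_ `|` _]setCK setCU; apply: (hC _); apply: hI; exact: (hC _).
have h0 : poly_limit_sets set0.
  split; first exact: measurable0.
  by rewrite indic0; exact: poly_limit_poly (poly_cst 0 0).
split => // [A|A hA]; first by rewrite setTD; exact: hC.
have mU : measurable (\bigcup_k A k) by apply: bigcupT_measurable => k; case: (hA k).
pose U n := \bigcup_(k < n) A k.
have hUn n : poly_limit_sets (U n).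
  elim: n => [|n IH]; first by rewrite /U bigcup_mkord big_ord0.
  by rewrite /U bigcup_mkord big_ord_recr /= -bigcup_mkord; exact: hU.
split => //; apply: (@poly_limit_cvg (fun n => \1_(U n))) => [n||].
- by case: (hUn n).
- exact: L2_indic.
apply: (@L2_dominated _ (fun n => \1_(\bigcup_k A k) \- \1_(U n)) (cst 1) set0).
- by move=> n; apply: L2B; apply: L2_indic => //; case: (hUn n).
- exact: L2_cst.
- exact: negligible_set0.
- move=> x xB _; apply: cvg_near_cst.
  have [[k _ xk]|xU] := pselect ((\bigcup_k A k) x).
    exists k.+1 => // n /= kn; rewrite !indicE !mem_set ?subrr//.
    - by exists k.
    - by exists k.
  apply: nearW => n /=; rewrite !indicE !memNset ?subrr//.
  by move=> [k _ xk]; apply: xU; exists k.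
- move=> n x xB /=; rewrite !indicE.
  by case: (_ \in _); case: (_ \in _); rewrite ?subrr ?subr0 ?sub0r ?normrN ?normr0 ?normr1.
Qed.

(** Half-spaces generate the product sigma-algebra, one coordinate at a time: rays on the line, then
    preimages under the projections. *)
Lemma poly_limit_measurable (A : set pt) : measurable A -> poly_limit (\1_A : pt -> R).
Proof.
have sG := poly_limit_sigma_algebra.
have coordG i (C : set (measurableTypeR R)) : measurable C ->
    poly_limit_sets (coord3 i @^-1` C).
  have := sigma_algebra_image (coord3 i : pt -> R) sG.
  set H := image_set_system _ _ _ => sH.
  move=> mC; have mC' : <<s @RGenInftyO.G R >> C.
    exact: (eq_ind _ (fun F : set (set R) => F C) mC _ (RGenInftyO.measurableE R)).
  suff : <<s @RGenInftyO.G R >> `<=` H.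
    by move=> /(_ C mC'); rewrite /H /image_set_system /= setTI.
  apply: smallest_sub => // _ [a ->].
  rewrite /H /image_set_system /= setTI.
  have -> : coord3 i @^-1` `]-oo, a[ = [set x : pt | coord3 i x < a].
    by apply/seteqP; split=> x /=; rewrite in_itv.
  by split; [exact: measurable_halfspace|exact: poly_limit_halfspace].
have fstG (C : set (measurableTypeR R * measurableTypeR R)) : measurable C ->
    poly_limit_sets (fst @^-1` C).
  have := sigma_algebra_image (fst : pt -> _) sG.
  set H := image_set_system _ _ _ => sH.
  suff : measurable `<=` H by move=> + mC => /(_ C mC); rewrite /H /image_set_system /= setTI.
  apply: smallest_sub => // _ [[D mD <-]|[D mD <-]]; rewrite /H /image_set_system /= !setTI.
  - exact: (coordG 0 D mD).
  - exact: (coordG 1 D mD).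
move=> mA; suff : poly_limit_sets A by case.
move: A mA; apply: smallest_sub => // _ [[D mD <-]|[D mD <-]]; rewrite !setTI.
- exact: fstG.
- exact: (coordG 2 D mD).
Qed.

Lemma poly_limit_ge0 f : L2 f -> (forall x, 0 <= f x) -> poly_limit f.
Proof.
move=> fL f0; have mf := L2_measurable fL.
have mEf : measurable_fun B (EFin \o f) by exact/measurable_EFinP.
pose g n := nnsfun_approx measurable_ball3 mEf n.
have g_le n x : ball3 x -> 0 <= g n x <= f x.
  move=> xB; apply/andP; split; first exact: fun_ge0.
  rewrite -lee_fin /g nnsfun_approxE; apply: le_approx => // y _.
  by rewrite lee_fin f0.
have gP n : poly_limit (g n).
  rewrite (_ : (g n : pt -> R) = fun x =>
      \sum_(r <- finmap.enum_fset (fset_set (range (g n)))) r * \1_(g n @^-1` [set r]) x);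
        last first.
    by apply/funext => x; rewrite fimfunE fsbig_finite.
  elim: (finmap.enum_fset _) => [|r s IH].
    rewrite (_ : (fun=> _) = cst 0); first exact: poly_limit_poly (poly_cst 0 0).
    by apply/funext => x; rewrite big_nil.
  rewrite (_ : (fun=> _) = (fun x => r * \1_(g n @^-1` [set r]) x) \+
     (fun x => \sum_(r <- s) r * \1_(g n @^-1` [set r]) x)).
    apply: poly_limitD => //; apply: poly_limitZ; apply: poly_limit_measurable.
    exact: measurable_sfunP.
  by apply/funext => x; rewrite big_cons.
apply: (@poly_limit_cvg (fun n => g n)) => //.
apply: (@L2_dominated _ (fun n => f \- g n) f set0) => //.
- by move=> n; apply: L2B => //; case: (gP n).
- exact: negligible_set0.
- move=> x xB _; rewrite -[X in _ --> X](subrr (f x)); apply: cvgB; first exact: cvg_cst.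
  have Ef0 y : B y -> (0 <= (EFin \o f) y)%E by rewrite lee_fin.
  exact: fine_cvg (cvg_nnsfun_approx measurable_ball3 mEf Ef0 xB).
- move=> n x xB /=; have /andP[g0 gf] := g_le n x xB.
  by rewrite ger0_norm ?subr_ge0// lerBlDr lerDl.
Qed.

Theorem poly_dense f : L2 f -> poly_limit f.
Proof.
move=> fL; have mf := L2_measurable fL.
pose fp x := (`|f x| + f x) / 2; pose fn x := (`|f x| - f x) / 2.
have nL : L2 (fun x => `|f x|).
  apply/L2P; split; first exact: measurableT_comp.
  have /L2P[_] := fL; apply: eq_integrable => //; first exact: measurable_ball3.
  by move=> x _ /=; rewrite real_normK ?num_real.
have fpL : L2 fp.
  rewrite (_ : fp = fun x => 2^-1 * (`|f x| + f x)); first exact: L2Z (L2D nL fL).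
  by apply/funext => x; rewrite mulrC.
have fnL : L2 fn.
  rewrite (_ : fn = fun x => 2^-1 * (`|f x| - f x)); first exact: L2Z (L2B nL fL).
  by apply/funext => x; rewrite mulrC.
rewrite (_ : f = fp \- fn); last by apply/funext => x; rewrite /fp /fn /=; field.
apply: poly_limitB; apply: poly_limit_ge0 => // x; rewrite divr_ge0//.
- by have := ler_norm (- f x); rewrite normrN; lra.
- by have := ler_norm (f x); lra.
Qed.

End PolyDense.

(** * Harmonic decomposition and the operator L *)

Section HomCalculus.
Context {R : realType}.
Local Notation pt := (point3 R).
Implicit Types (f g h p q : pt -> R) (x : pt) (c : R) (i j : 'I_3) (k m n : nat).

Definition lap f x : R := \sum_(i < 3) partial i (partial i f) x.

Definition eul f x : R := \sum_(i < 3) coord3 i x * partial i f x.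

(* Divergence form of - Lap + (x . grad)^2 + 3 (x . grad); the flux below is
   tangential on the unit sphere. *)
Definition legendre_flux i f x : R := partial i f x - coord3 i x * eul f x.

Definition legendre_op f x : R := - \sum_(i < 3) partial i (legendre_flux i f) x.

Lemma elementary_lap d f : elementary d f -> elementary d (lap f).
Proof. by move=> ef; apply: elementary_sum => i; do 2 apply: elementary_partial. Qed.

Lemma elementary_eul d f : elementary d f -> elementary d (eul f).
Proof.
move=> ef; apply: elementary_sum => i.
by apply: elem_mul; [exact: elem_coord|exact: elementary_partial].
Qed.

Lemma elementary_flux d i f : elementary d f -> elementary d (legendre_flux i f).
Proof.
move=> ef; apply: elementary_sub; first exact: elementary_partial.
by apply: elem_mul; [exact: elem_coord|exact: elementary_eul].
Qed.

Lemma legendre_opE d f : elementary d f ->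
  legendre_op f = fun x => - lap f x + eul (eul f) x + 3 * eul f x.
Proof.
move=> ef; have ee := elementary_eul ef.
apply/funext => x; rewrite /legendre_op.
under eq_bigr => i _.
  rewrite (elem_partialB _ (elementary_partial i ef) (elem_mul (elem_coord d i) ee)).
  rewrite (elem_partialM _ (elem_coord d i) ee) partial_coord3 eqxx /= mul1r.
  over.
rewrite sumrB big_split/= opprB sumr_const card_ord -/(lap f x) -/(eul (eul f) x).
rewrite -mulr_natl; move: (lap f x) (eul (eul f) x) (eul f x) => a b c; ring.
Qed.

(** The normal component carries the factor 1 - |x|^2; this removes the boundary term from every
    later integration by parts. *)
Lemma flux_dot f x : \sum_(i < 3) coord3 i x * legendre_flux i f x =
  (1 - sqnorm x) * eul f x.
Proof.
under eq_bigr do rewrite mulrBr mulrA.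
by rewrite sumrB -mulr_suml mulrBl mul1r; under [in X in _ - X * _]eq_bigr do rewrite -expr2.
Qed.

Lemma lapD d f g : elementary d f -> elementary d g ->
  lap (fun x => f x + g x) = fun x => lap f x + lap g x.
Proof.
move=> ef eg; apply/funext => x; rewrite /lap -big_split; apply: eq_bigr => i _ /=.
rewrite (elem_partialD _ ef eg).
by rewrite (elem_partialD _ (elementary_partial i ef) (elementary_partial i eg)).
Qed.

Lemma eulD d f g : elementary d f -> elementary d g ->
  eul (fun x => f x + g x) = fun x => eul f x + eul g x.
Proof.
move=> ef eg; apply/funext => x; rewrite /eul -big_split; apply: eq_bigr => i _ /=.
by rewrite (elem_partialD _ ef eg) mulrDr.
Qed.

Lemma eulZ d c f : elementary d f -> eul (fun x => c * f x) = fun x => c * eul f x.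
Proof.
move=> ef; apply/funext => x; rewrite /eul mulr_sumr; apply: eq_bigr => i _ /=.
by rewrite (elem_partialZ _ _ ef) mulrCA.
Qed.

Lemma lapZ d c f : elementary d f -> lap (fun x => c * f x) = fun x => c * lap f x.
Proof.
move=> ef; apply/funext => x; rewrite /lap mulr_sumr; apply: eq_bigr => i _ /=.
by rewrite (elem_partialZ _ _ ef) (elem_partialZ _ _ (elementary_partial i ef)).
Qed.

Lemma lapB d f g : elementary d f -> elementary d g ->
  lap (fun x => f x - g x) = fun x => lap f x - lap g x.
Proof.
move=> ef eg.
rewrite (_ : (fun x => f x - g x) = fun x => f x + -1 * g x); last first.
  by apply/funext => x; rewrite mulN1r.
rewrite (lapD ef (elementary_scale (-1) eg)) (lapZ (-1) eg).
by apply/funext => x; rewrite mulN1r.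
Qed.

Lemma legendre_opD d f g : elementary d f -> elementary d g ->
  legendre_op (fun x => f x + g x) = fun x => legendre_op f x + legendre_op g x.
Proof.
move=> ef eg; have e1 := elementary_eul ef; have e2 := elementary_eul eg.
rewrite (legendre_opE ef) (legendre_opE eg) (legendre_opE (elem_add ef eg)).
rewrite (lapD ef eg) (eulD ef eg) (eulD e1 e2).
apply/funext => x; cbv beta.
move: (lap f x) (lap g x) (eul (eul f) x) (eul (eul g) x) (eul f x) (eul g x).
by move=> ? ? ? ? ? ?; ring.
Qed.

Lemma hom_elem n f : hom n f -> elementary 1 f.
Proof. exact: hom_elementary. Qed.

Lemma hom_partial n f i : hom n f ->
  if n is n'.+1 then hom n' (partial i f) else partial i f = cst 0.
Proof.
elim=> {n f} [c|n j f hf IH|n f g hf IHf hg IHg].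
- exact: partial_cst.
- rewrite (elem_partialM _ (elem_coord 1 j) (hom_elem hf)) partial_coord3.
  apply: hom_add; first exact: homZ.
  case: n hf IH => [|n] hf IH; last exact: hom_coord.
  rewrite IH (_ : (fun=> _) = cst 0); first exact: hom0.
  by apply/funext => x /=; rewrite mulr0.
- rewrite (elem_partialD _ (hom_elem hf) (hom_elem hg)).
  case: n hf hg IHf IHg => [|n] _ _ hf hg; last exact: hom_add.
  by rewrite hf hg; apply/funext => x /=; rewrite addr0.
Qed.

Lemma eul_hom n f : hom n f -> eul f = fun x => n%:R * f x.
Proof.
elim=> {n f} [c|n j f hf IH|n f g hf IHf hg IHg].
- by apply/funext => x; rewrite /eul mul0r big1// => i _; rewrite partial_cst mulr0.
- apply/funext => x; rewrite /eul.
  under eq_bigr => i _.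
    rewrite (elem_partialM _ (elem_coord 1 j) (hom_elem hf)) partial_coord3 mulrDr.
    rewrite [X in _ + X]mulrCA; over.
  rewrite big_split/= -mulr_sumr -/(eul f x) IH (bigD1 j)//= eqxx mul1r big1.
    by rewrite addr0 -natr1; ring.
  by move=> i /negPf; rewrite eq_sym => ->; rewrite mul0r mulr0.
- rewrite (eulD (hom_elem hf) (hom_elem hg)) IHf IHg.
  by apply/funext => x; rewrite mulrDr.
Qed.

Lemma hom_lap n f : hom n f ->
  if n is n'.+2 then hom n' (lap f) else lap f = cst 0.
Proof.
move=> hf; case: n hf => [|[|n]] hf.
- apply/funext => x; rewrite /lap big1// => i _.
  by rewrite (hom_partial i hf : partial i f = _) partial_cst.
- apply/funext => x; rewrite /lap big1// => i _.
  by rewrite (hom_partial i (hom_partial i hf : hom 0 _) : partial i (partial i f) = _).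
- apply: hom_sum => i.
  exact: (hom_partial i (hom_partial i hf : hom n.+1 _) : hom n _).
Qed.

Lemma poly_lap n f : hom n.+1 f -> poly n (lap f).
Proof.
case: n => [|n] /hom_lap; first by move=> ->; exact: poly_cst.
by move=> /hom_poly; exact: poly_mono.
Qed.

(** By Euler's identity (x . grad)^2 + 3 x . grad acts as n^2 + 3 n, and the Laplacian only produces
    lower degree: this is the origin of the eigenvalue. *)
Lemma legendre_op_hom n f : hom n f ->
  legendre_op f = fun x => n%:R * (n%:R + 3) * f x - lap f x.
Proof.
move=> hf; rewrite (legendre_opE (hom_elem hf)) (eul_hom hf).
rewrite (eulZ _ (hom_elem hf)) (eul_hom hf).
apply/funext => x; cbv beta; move: (lap f x) (f x) => a b; ring.
Qed.

Lemma poly_legendre_op n f : poly n f -> poly n (legendre_op f).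
Proof.
elim: n f => [|n IH] f.
  move=> hf; rewrite (legendre_op_hom hf) (hom_lap hf : lap f = _).
  by apply: polyB; [exact: homZ|exact: poly_cst].
move=> [h [q [hh pq ->]]]; have eq := poly_elementary 1 pq.
rewrite (legendre_opD (hom_elem hh) eq); apply: polyD; last exact: polyS (IH _ pq).
rewrite (legendre_op_hom hh); apply: polyB; first exact: hom_poly (homZ _ hh).
exact: polyS (poly_lap hh).
Qed.

Lemma legendre_op_tri n f : poly n.+1 f ->
  poly n (fun x => legendre_op f x - n.+1%:R * (n.+1%:R + 3) * f x).
Proof.
move=> [h [q [hh pq ->]]]; have eq := poly_elementary 1 pq.
rewrite (legendre_opD (hom_elem hh) eq) (legendre_op_hom hh).
rewrite (_ : (fun=> _) = fun x => (legendre_op q x - n.+1%:R * (n.+1%:R + 3) * q x) - lap h x).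
  apply: polyB; last exact: poly_lap.
  by apply: polyB; [exact: poly_legendre_op|exact: polyZ].
apply/funext => x; cbv beta.
by move: (lap h x) (legendre_op q x) (h x) (q x) => a b c d; ring.
Qed.

Lemma lap_sqnormM k q : hom k q ->
  lap (fun x => sqnorm x * q x) = fun x => (6 + 4 * k%:R) * q x + sqnorm x * lap q x.
Proof.
move=> hq; have eq := hom_elem hq; have es := elementary_sqnorm (R := R) 1.
have -> : (fun x => (6 + 4 * k%:R) * q x + sqnorm x * lap q x) =
    fun x => 6 * q x + 4 * eul q x + sqnorm x * lap q x.
  rewrite (eul_hom hq); apply/funext => x; cbv beta.
  by move: (sqnorm x) (lap q x) (q x) => a b c; ring.
apply/funext => x; rewrite /lap /eul !mulr_sumr.
have -> : 6 * q x = \sum_(i < 3) 2 * q x by rewrite sumr_const card_ord -mulr_natl; ring.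
rewrite -!big_split; apply: eq_bigr => i _ /=.
have ei := elementary_partial i eq; have ec := elem_coord (R := R) 1 i.
rewrite (elem_partialM _ es eq) partial_sqnorm.
rewrite (elem_partialD _ (elem_mul (elementary_scale 2 ec) eq) (elem_mul es ei)).
rewrite (elem_partialM _ (elementary_scale 2 ec) eq) (elem_partialM _ es ei).
rewrite (elem_partialZ _ _ ec) partial_coord3 partial_sqnorm eqxx /=.
by ring.
Qed.

(* With the ansatz q = (r - |x|^2 q') / a the equation for q' is of the same form,
   in degree k - 2 and with a replaced by a + 4 k - 2. *)
Lemma hom_solve k a r : 0 < a -> hom k r ->
  exists2 q, hom k q & forall x, a * q x + sqnorm x * lap q x = r x.
Proof.
have [m] := ubnP k; elim: m => // m IH in k a r *; rewrite ltnS => km a0 hr.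
have small : lap r = cst 0 -> exists2 q, hom k q &
    forall x, a * q x + sqnorm x * lap q x = r x.
  move=> lr; exists (fun x => a^-1 * r x); first exact: homZ.
  move=> x; rewrite (lapZ _ (hom_elem hr)) lr mulr0 mulr0 addr0.
  by rewrite mulrA divff ?gt_eqF// mul1r.
case: k km hr small => [|[|k]] km hr small; first exact: small (hom_lap hr).
  exact: small (hom_lap hr).
have km' : (k < m)%N by exact: leq_ltn_trans (leqnSn _) km.
have a' : 0 < a + 4 * k%:R + 6 by have := ler0n R k; lra.
have [q' hq' Eq'] := IH k _ (lap r) km' a' (hom_lap hr).
have hs : hom k.+2 (fun x => sqnorm x * q' x) := homM (@hom_sqnorm R) hq'.
exists (fun x => a^-1 * (r x + -1 * (sqnorm x * q' x))).
  by apply: homZ; apply: hom_add => //; exact: homZ.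
move=> x; have er := hom_elem hr; have es := hom_elem hs.
rewrite (lapZ _ (elem_add er (elementary_scale (-1) es))).
rewrite (lapD er (elementary_scale (-1) es)) (lapZ _ es) (lap_sqnormM hq') -Eq'.
by field; rewrite gt_eqF.
Qed.

(** The quotient q has to satisfy Lap (|x|^2 q) = Lap p, which by [lap_sqnormM] is the equation of
    [hom_solve] with a equal to 6 plus four times the degree of q. *)
Lemma harmonic_split n p : hom n p -> exists h q,
  [/\ hom n h, Defs.harmonic h,
      if n is n'.+2 then hom n' q else q = cst 0 &
      p = fun x => h x + sqnorm x * q x].
Proof.
case: n => [|[|n]] hp.
- exists p, (cst 0); split => // [x|].
    by rewrite -/(lap p x) (hom_lap hp : lap p = cst 0).
  by apply/funext => x /=; rewrite mulr0 addr0.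
- exists p, (cst 0); split => // [x|].
    by rewrite -/(lap p x) (hom_lap hp : lap p = cst 0).
  by apply/funext => x /=; rewrite mulr0 addr0.
have a0 : 0 < 6 + 4 * n%:R :> R by have := ler0n R n; lra.
have [q hq Eq] := hom_solve a0 (hom_lap hp).
have hs : hom n.+2 (fun x => sqnorm x * q x) := homM (@hom_sqnorm R) hq.
exists (fun x => p x - sqnorm x * q x), q; split => //.
- rewrite (_ : (fun=> _) = fun x => p x + -1 * (sqnorm x * q x)).
    by apply: hom_add => //; exact: homZ.
  by apply/funext => x; rewrite mulN1r.
- move=> x; rewrite -/(lap _ x) (lapB (hom_elem hp) (hom_elem hs)) (lap_sqnormM hq).
  by rewrite -Eq subrr.
- by apply/funext => x; rewrite subrK.
Qed.

Lemma homogeneous_sum n (I : Type) (s : seq I) (P : pred I) (F : I -> pt -> R) :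
  (forall a, P a -> homogeneous_poly n (F a)) ->
  homogeneous_poly n (fun x => \sum_(a <- s | P a) F a x).
Proof.
move=> hF; elim: s => [|b s [c IH]].
  exists (fun=> 0) => x; rewrite big_nil big1// => a _; exact: mul0r.
have [Pb|Pb] := boolP (P b); last first.
  by exists c => x; rewrite big_cons (negPf Pb) IH.
have [c' hc'] := hF _ Pb; exists (fun a => c' a + c a) => x.
rewrite big_cons Pb IH hc' -big_split; apply: eq_bigr => a _.
by rewrite /= mulrDl.
Qed.

Lemma homogeneous_monomial (e : 'I_3 -> nat) c :
  homogeneous_poly (\sum_(i < 3) e i) (fun x => c * \prod_(i < 3) coord3 i x ^+ e i).
Proof.
set n := (\sum_(i < 3) e i)%N.
have en i : (e i < n.+1)%N by rewrite ltnS /n (bigD1 i)//= leq_addr.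
pose a0 : {ffun 'I_3 -> 'I_n.+1} := [ffun i => Ordinal (en i)].
exists (fun a => if a == a0 then c else 0) => x.
rewrite (bigD1 a0)/=; last first.
  by apply/eqP; apply: eq_bigr => i _; rewrite ffunE.
rewrite eqxx [X in _ = _ + X]big1 ?addr0; last first.
  by move=> a /andP[_ /negPf ->]; rewrite mul0r.
by congr (_ * _); apply: eq_bigr => i _; rewrite ffunE.
Qed.

Lemma hom_homogeneous n f : hom n f -> homogeneous_poly n f.
Proof.
elim=> {n f} [c|n i f _ [c Ef]|n f g _ [c Ef] _ [c' Eg]].
- have := homogeneous_monomial (fun=> 0%N) c; rewrite big1//; congr homogeneous_poly.
  by apply/funext => x; rewrite big1 ?mulr1// => i _; rewrite expr0.
- rewrite (_ : (fun=> _) = fun x =>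
     \sum_(a : {ffun 'I_3 -> 'I_n.+1} | (\sum_(i < 3) a i == n)%N)
       c a * \prod_(j < 3) coord3 j x ^+ (a j + (j == i))); last first.
    apply/funext => x; rewrite Ef mulr_sumr; apply: eq_bigr => a _.
    rewrite mulrCA; congr (_ * _).
    under [RHS]eq_bigr do rewrite exprD.
    rewrite big_split mulrC; congr (_ * _).
    rewrite (bigD1 i)//= eqxx expr1 big1 ?mulr1// => j /negPf ->.
    by rewrite expr0.
  apply: homogeneous_sum => a /eqP an.
  have := homogeneous_monomial (fun j => (a j + (j == i))%N) (c a).
  by rewrite big_split/= an (bigD1 i)//= eqxx big1 ?addn0 ?addn1// => j /negPf ->.
- exists (fun a => c a + c' a) => x; rewrite Ef Eg -big_split.
  by apply: eq_bigr => a _; rewrite /= mulrDl.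
Qed.

Lemma hom_monomial (e : 'I_3 -> nat) :
  hom (\sum_(i < 3) e i) (fun x => \prod_(i < 3) coord3 i x ^+ e i).
Proof.
have hX i m : hom m (fun x => coord3 i x ^+ m).
  elim: m => [|m IH]; first exact: hom_cst.
  by under eq_fun do rewrite exprS; exact: hom_coord.
rewrite big_ord_recl big_ord_recl big_ord_recl big_ord0 addn0.
under eq_fun do rewrite big_ord_recl big_ord_recl big_ord_recl big_ord0 mulr1.
by do 2 (apply: homM => //).
Qed.

Lemma homogeneous_hom n f : homogeneous_poly n f -> hom n f.
Proof.
move=> [c Ef]; rewrite (_ : f = fun x =>
    \sum_(a : {ffun 'I_3 -> 'I_n.+1}) (if (\sum_(i < 3) a i == n)%N then c a else 0) *
      (if (\sum_(i < 3) a i == n)%N then \prod_(i < 3) coord3 i x ^+ a i else 0)).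
  apply: hom_sum => a; apply: homZ; case: eqP => [an|_]; last exact: hom0.
  by have := hom_monomial (fun i => a i : nat); rewrite an.
apply/funext => x; rewrite Ef big_mkcond; apply: eq_bigr => a _.
by case: ifP => //; rewrite mul0r.
Qed.

Lemma subspace_poly n : subspace (L2_inner (R := R)) (poly n).
Proof.
split; [by move=> u; exact: L2_poly|exact: poly_cst|].
by move=> c u v pu pv; apply: polyD => //; exact: polyZ.
Qed.

(** Gram-Schmidt over the finite list of monomials. Exponents whose sum is not m are kept in the
    list but contribute the zero function. *)
Lemma projectable_poly n : projectable (L2_inner (R := R)) (poly n).
Proof.
pose adjoins (P : (pt -> R) -> Prop) s := foldr (fun w Q => adjoin Q w) P s.
pose mono m (a : {ffun 'I_3 -> 'I_m.+1}) : pt -> R :=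
  fun x => (\sum_(i < 3) a i == m)%N%:R * \prod_(i < 3) coord3 i x ^+ a i.
have hmono m a : hom m (mono m a).
  rewrite /mono; case: eqP => [am|_].
    by apply: homZ; have := hom_monomial (fun i => a i : nat); rewrite am.
  rewrite (_ : (fun=> _) = cst 0); first exact: hom0.
  by apply/funext => x; rewrite mul0r.
pose ms m := [seq mono m a | a <- index_enum {ffun 'I_3 -> 'I_m.+1}].
have main P m : subspace (L2_inner (R := R)) P -> projectable (L2_inner (R := R)) P ->
    subspace (L2_inner (R := R)) (adjoins P (ms m)) /\
    projectable (L2_inner (R := R)) (adjoins P (ms m)).
  move=> sP pP; rewrite /ms; elim: (index_enum _) => //= a s [IH1 IH2].
  have dm : dom L2_inner (mono m a) by exact: L2_poly (hom_poly (hmono m a)).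
  by split; [exact: subspace_adjoin|exact: projectable_adjoin].
have adj P m h p : hom m h -> P p -> adjoins P (ms m) (fun x => h x + p x).
  move=> /hom_homogeneous[c Eh] Pp.
  rewrite (_ : (fun=> _) = fun x => (\sum_(a <- index_enum _) c a * mono m a x) + p x); last first.
    apply/funext => x; rewrite Eh big_mkcond; congr (_ + _); apply: eq_bigr => a _.
    by rewrite /mono; case: ifP => _; rewrite ?mul1r ?mul0r ?mulr0.
  rewrite /ms; elim: (index_enum _) => [|a s IH] /=.
    by rewrite (_ : (fun=> _) = p)//; apply/funext => x; rewrite big_nil add0r.
  exists (c a), (fun x => (\sum_(b <- s) c b * mono m b x) + p x); split => //.
  by apply/funext => x; rewrite big_cons -addrA.
have adjI P m u : (forall v, P v -> poly m v) -> adjoins P (ms m) u -> poly m u.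
  move=> hP; rewrite /ms; elim: (index_enum _) u => [|a s IH] u /=; first exact: hP.
  move=> [c [p [Pp ->]]]; apply: polyD; last exact: IH.
  exact: hom_poly (homZ c (hmono m a)).
have eqP P Q : (forall u, P u <-> Q u) -> projectable (L2_inner (R := R)) P ->
    projectable (L2_inner (R := R)) Q.
  move=> PQ pP f df; have [g [Pg og]] := pP f df.
  by exists g; split; [exact/PQ|move=> v /PQ; exact: og].
elim: n => [|n IH].
  pose P0 (u : pt -> R) := u = cst 0.
  have s0 : subspace (L2_inner (R := R)) P0.
    split => // [u ->|c u v -> ->]; first exact: L2_cst.
    by rewrite /P0 scaler0 addr0.
  have p0 : projectable (L2_inner (R := R)) P0.
    move=> f df; exists (cst 0); split => // v ->; rewrite ipC.
    exact: (@ip0l _ _ L2_inner _ (domB df (L2_cst 0))).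
  apply: eqP (proj2 (main _ 0 s0 p0)) => u; split.
    by apply: adjI => v ->; exact: poly_cst.
  move=> hu; rewrite (_ : u = fun x => u x + cst 0 x); first exact: adj.
  by apply/funext => x /=; rewrite addr0.
apply: eqP (proj2 (main _ n.+1 (subspace_poly n) IH)) => u; split.
  by apply: adjI => v; exact: polyS.
by move=> [h [q [hh pq ->]]]; exact: adj.
Qed.

End HomCalculus.

(** * Integration by parts *)

Section Fubini3.
Context {R : realType}.
Local Notation pt :=
  (measurableTypeR R * measurableTypeR R * measurableTypeR R)%type.
Local Notation mu := (@mu3 R).
Local Notation leb := (@lebesgue_measure R).

Lemma sigma_finite_leb2 : sigma_finite setT (leb \x leb)%E.
Proof.
have /sigma_finiteP[F [TF ndF Foo]] := sigma_finiteT leb.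
exists (fun n => F n `*` F n).
  rewrite -setXTT TF predeqE => -[x y]; split.
    move=> [/= [n _ Fnx] [k _ Gky]]; exists (maxn n k) => //; split.
    - by move: x Fnx; exact/subsetPset/ndF/leq_maxl.
    - by move: y Gky; exact/subsetPset/ndF/leq_maxr.
  by move=> [n _ []/= ? ?]; split; exists n.
move=> k; have [? ?] := Foo k.
split; first exact: measurableX.
by rewrite product_measure1E// lte_mul_pinfty// ge0_fin_numE.
Qed.

(** A name for planar Lebesgue measure, able to carry the sigma-finiteness that Fubini asks of a
    factor. *)
Definition leb2 : set (measurableTypeR R * measurableTypeR R) -> \bar R := (leb \x leb)%E.

HB.instance Definition _ := Measure.on leb2.
HB.instance Definition _ := Measure_isSigmaFinite.Build _ _ _ leb2 sigma_finite_leb2.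

Lemma integral_mu3_21 (f : pt -> \bar R) : mu.-integrable setT f ->
  (\int[mu]_x f x = \int[leb]_z \int[(leb \x leb)%E]_xy f (xy, z))%E.
Proof. by move=> ig; exact: esym (@integral21_prod_meas1 _ _ _ _ R leb2 leb f ig). Qed.
Lemma integral_mu3_12 (f : pt -> \bar R) : mu.-integrable setT f ->
  (\int[mu]_x f x = \int[(leb \x leb)%E]_xy \int[leb]_z f (xy, z))%E.
Proof. by move=> ig; exact: esym (@integral12_prod_meas1 _ _ _ _ R leb2 leb f ig). Qed.
Lemma integral_leb2_21 (f : measurableTypeR R * measurableTypeR R -> \bar R) :
  (leb \x leb)%E.-integrable setT f ->
  (\int[(leb \x leb)%E]_x f x = \int[leb]_y \int[leb]_x f (x, y))%E.
Proof. by move=> ig; exact: esym (@integral21_prod_meas1 _ _ _ _ R leb leb f ig). Qed.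
Lemma integral_leb2_12 (f : measurableTypeR R * measurableTypeR R -> \bar R) :
  (leb \x leb)%E.-integrable setT f ->
  (\int[(leb \x leb)%E]_x f x = \int[leb]_x \int[leb]_y f (x, y))%E.
Proof. by move=> ig; exact: esym (@integral12_prod_meas1 _ _ _ _ R leb leb f ig). Qed.
End Fubini3.

(** * Integration by parts for functions vanishing off the open ball *)

Section IntegrationByParts.
Context {R : realType}.
Local Notation pt :=
  (measurableTypeR R * measurableTypeR R * measurableTypeR R)%type.
Local Notation B := (@ball3 R : set pt).
Local Notation mu := (@mu3 R).
Local Notation leb := (@lebesgue_measure R).
Implicit Types (f g : point3 R -> R) (x v : point3 R) (i : 'I_3) (s t : R).

Lemma is_derive_along f x v t l : is_derive (t *: v + x) v f l ->
  is_derive t (1 : R) (fun s => f (s *: v + x)) l.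
Proof.
have E : (fun h : R => h^-1 *: ((f \o shift (t *: v + x)) (h *: v) - f (t *: v + x))) =
  (fun h : R => h^-1 *: (((fun s : R => f (s *: v + x)) \o shift t) (h *: (1 : R)) -
     (fun s : R => f (s *: v + x)) t)).
  by apply/funext => h /=; rewrite [h *: (1 : R)]mulr1 scalerDl addrA.
move=> [df <-]; split; first by rewrite /derivable -E.
by rewrite /derive -E.
Qed.

Lemma partial_zero_outside f i x : (forall y, 1 <= sqnorm y -> f y = 0) ->
  1 < sqnorm x -> partial i f x = 0.
Proof.
move=> f0 x1; apply: partial_val.
apply: (@near_eq_is_derive _ _ _ (cst 0)).
have oS : open ((@sqnorm R) @^-1` [set y | 1 < y] : set (point3 R)).
  by apply: open_comp => [y _|]; [exact: continuous_sqnorm|exact: open_gt].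
have := open_nbhs_nbhs (conj oS x1); apply: filterS => y /= y1.
by rewrite f0// ltW.
Qed.

Lemma sqnorm_ge_coord3 i x : coord3 i x ^+ 2 <= sqnorm x.
Proof.
by rewrite /sqnorm (bigD1 i)//= lerDl; apply: sumr_ge0 => j _; exact: sqr_ge0.
Qed.

Lemma continuous_line x v : continuous (fun t : R => t *: v + x).
Proof.
by move=> t; apply: cvgD; [apply: cvgZl; exact: cvg_id|exact: cvg_cst].
Qed.

(** Since the base point has i-th coordinate 0, the parameter t is that coordinate, so the line is
    outside the open ball for |t| >= 1 and the fundamental theorem on [-1, 1] gives 0. *)
Lemma integral_line_partial f i x : continuous (partial i f) ->
  (forall y, derivable f y (axis3 R i)) -> (forall y, 1 <= sqnorm y -> f y = 0) ->
  coord3 i x = 0 ->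
  (\int[leb]_t (partial i f (t *: axis3 R i + x))%:E = 0)%E.
Proof.
move=> cf' df f0 xi0.
pose F (t : R) := f (t *: axis3 R i + x); pose F' (t : R) := partial i f (t *: axis3 R i + x).
have dF t : is_derive t (1 : R) F (F' t).
  by apply: is_derive_along; exact: is_derive_partial.
have ci t : coord3 i (t *: axis3 R i + x) = t.
  move: xi0; rewrite /axis3; case: (i) => -[|[|[|//]]] hi; rewrite /coord3/= => xi0;
  by rewrite xi0 addr0 [_ *: _]mulr1.
have sq t : t ^+ 2 <= sqnorm (t *: axis3 R i + x).
  by rewrite -{1}(ci t); exact: sqnorm_ge_coord3.
have F'0 t : t \notin `[-1, 1] -> F' t = 0.
  rewrite in_itv/= -ler_norml -ltNge => t1; apply: partial_zero_outside => //.
  apply: lt_le_trans (sq t); rewrite -real_normK ?num_real//.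
  by rewrite -(expr1n R 2) ltrXn2r ?nnegrE.
have F0 t : 1 <= `|t| -> F t = 0.
  move=> t1; apply: f0; apply: le_trans (sq t); rewrite -real_normK ?num_real//.
  by rewrite -(expr1n R 2) lerXn2r ?nnegrE.
have cF : continuous F.
  move=> t; apply: differentiable_continuous; apply/derivable1_diffP.
  by case: (dF t).
have cF' : continuous F'.
  by move=> t; apply: continuous_comp; [exact: continuous_line|exact: cf'].
have := @continuous_FTC2 R F' F (-1) 1.
rewrite !F0 ?normrN ?normr1// => ftc.
transitivity (\int[leb]_(t in `[(-1)%R, 1%R]) (F' t)%:E)%E.
  rewrite [RHS]integral_mkcond; apply: eq_integral => t _.
  rewrite /patch; case: ifPn => // /negP tn.
  by rewrite -/(F' t) F'0//; apply/negP => h; apply: tn; rewrite inE.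
have n11 : (-1 : R) < 1 by lra.
rewrite (ftc n11) ?subee//.
- exact: continuous_subspaceT.
- split => [t _||]; first by case: (dF t).
  + by apply: cvg_at_right_filter; exact: cF.
  + by apply: cvg_at_left_filter; exact: cF.
- by move=> t _; rewrite derive1E; case: (dF t).
Qed.

Lemma integral_partial f i : continuous (partial i f) ->
  (forall y, derivable f y (axis3 R i)) -> (forall y, 1 <= sqnorm y -> f y = 0) ->
  (\int[mu]_x (partial i f x)%:E = 0)%E.
Proof.
move=> cf' df f0; set g := partial i f.
have mg : measurable_fun [set: pt] g by exact: continuous_measurable3.
have [M M0 gM] := continuous_bounded_ball cf'.
have g0 x : ~ ball3 x -> g x = 0.
  by move=> xB; apply: partial_zero_outside => //; rewrite ltNge; apply/negP => /ball3E.
have ig : mu.-integrable setT (EFin \o g).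
  have -> : EFin \o g = (EFin \o g) \_ B.
    apply/funext => x; rewrite /patch; case: ifPn => // /negP xB /=.
    by rewrite g0// => h; apply: xB; rewrite inE.
  apply/(integrable_mkcond (mu := mu) _ measurable_ball3).1.
  apply: measurable_bounded_integrable => //.
  - exact: measurable_ball3.
  - exact: mu3_ball_fin.
  - exact: measurable_funTS.
  - exists M; split; first exact: num_real.
    by move=> y My x xB /=; rewrite (le_trans (gM x xB))// ltW.
(* The second use of Fubini is made on each slice; boundedness and compact support give
   integrability for every z, not only for almost every one. *)
have igz (z : measurableTypeR R) : (leb \x leb)%E.-integrable setT (fun xy => (g (xy, z))%:E).
  pose K : set (measurableTypeR R * measurableTypeR R) := `[-1, 1] `*` `[-1, 1].
  have mK : measurable K by exact: measurableX.
  have -> : (fun xy => (g (xy, z))%:E) = (EFin \o (fun xy => g (xy, z))) \_ K.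
    apply/funext => xy; rewrite /patch; case: ifPn => // /negP xK /=.
    rewrite g0// => h; apply: xK; rewrite inE /K /= !in_itv /= -!ler_norml.
    by have := coord3_ball 0 h; have := coord3_ball 1 h.
  apply/(integrable_mkcond (mu := (leb \x leb)%E) _ mK).1.
  apply: measurable_bounded_integrable => //.
  - rewrite [ltLHS]product_measure1E//= lebesgue_measure_itv/= lte_fin.
    by case: ifP => _; rewrite -?EFinD -?EFinM ltry.
  - apply: measurable_funTS; apply: (measurableT_comp mg).
    exact: pair2_measurable.
  - exists M; split; first exact: num_real.
    move=> y My xy _ /=; have [xB|xB] := pselect (ball3 ((xy, z) : point3 R)).
      by rewrite (le_trans (gM _ xB))// ltW.
    by rewrite g0// normr0 (le_trans M0)// ltW.
have line := integral_line_partial cf' df f0.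
rewrite {}/g in mg gM g0 ig igz *.
(* The order of integration is chosen so that direction i is innermost. *)
case: i cf' df mg gM g0 ig igz line => -[|[|[|//]]] hi cf' df mg gM g0 ig igz line.
- apply: (eq_trans (integral_mu3_21 ig)).
  apply: integral0_eq => z _.
  apply: (eq_trans (integral_leb2_21 (igz z))).
  apply: integral0_eq => b _.
  apply: (eq_trans _ (line ((0, b), z) erefl)); apply: eq_integral => a _.
  congr (partial _ _ _)%:E; rewrite /axis3 /=; congr (_, _, _) => /=;
  by rewrite ?[_ *: 1]mulr1 ?[_ *: 0]mulr0 ?addr0 ?add0r.
- apply: (eq_trans (integral_mu3_21 ig)).
  apply: integral0_eq => z _.
  apply: (eq_trans (integral_leb2_12 (igz z))).
  apply: integral0_eq => a _.
  apply: (eq_trans _ (line ((a, 0), z) erefl)); apply: eq_integral => b _.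
  congr (partial _ _ _)%:E; rewrite /axis3 /=; congr (_, _, _) => /=;
  by rewrite ?[_ *: 1]mulr1 ?[_ *: 0]mulr0 ?addr0 ?add0r.
- apply: (eq_trans (integral_mu3_12 ig)).
  apply: integral0_eq => -[a b] _.
  apply: (eq_trans _ (line ((a, b), 0) erefl)); apply: eq_integral => z _.
  congr (partial _ _ _)%:E; rewrite /axis3 /=; congr (_, _, _) => /=;
  by rewrite ?[_ *: 1]mulr1 ?[_ *: 0]mulr0 ?addr0 ?add0r.
Qed.

Lemma ibp_ball f g i : continuous f -> continuous (partial i f) ->
  (forall y, derivable f y (axis3 R i)) ->
  continuous g -> continuous (partial i g) ->
  (forall y, derivable g y (axis3 R i)) ->
  (forall y, 1 <= sqnorm y -> g y = 0) ->
  L2dot f (partial i g) = - L2dot (partial i f) g.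
Proof.
move=> cf cf' df cg cg' dg g0.
pose h x := f x * g x.
have hE : partial i h = fun x => partial i f x * g x + f x * partial i g x := partialM df dg.
have ch' : continuous (partial i h).
  by rewrite hE => x; apply: cvgD; apply: cvgM; [exact: cf'|exact: cg|exact: cf|exact: cg'].
have dh y : derivable h y (axis3 R i).
  by have [] := is_derive_mul3 (is_derive_partial (df y)) (is_derive_partial (dg y)).
have h0 y : 1 <= sqnorm y -> h y = 0 by move=> /g0 gy; rewrite /h gy mulr0.
have int0 : \int[mu]_(x in B) partial i h x = 0.
  rewrite /Rintegral (_ : (\int[mu]_(x in B) (partial i h x)%:E)%E = 0%E)//.
  rewrite -(integral_partial ch' dh h0) [LHS]integral_mkcond.
  apply: eq_integral => x _; rewrite /patch; case: ifPn => // /negP xB.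
  rewrite (@partial_zero_outside h)// ltNge; apply/negP => /ball3E xB'.
  by apply: xB; rewrite inE.
have fL := L2_continuous cf; have f'L := L2_continuous cf'.
have gL := L2_continuous cg; have g'L := L2_continuous cg'.
apply/eqP; rewrite -addr_eq0 addrC; apply/eqP; rewrite -int0 hE.
by rewrite -(RintegralD measurable_ball3 (L2_integrableM f'L gL) (L2_integrableM fL g'L)).
Qed.

End IntegrationByParts.

(** * Test functions supported away from the sphere *)

Section CutoffFunctions.
Context {R : realType}.
Local Notation pt := (point3 R).
Implicit Types (f g h e phi : pt -> R) (x : pt) (c d : R) (i j : 'I_3) (k m n : nat).

(** An ideal in [elementary d] that is stable under partial derivatives: each summand keeps a bump
    factor, hence for d > 0 vanishes where |x|^2 >= 1 - d. *)
Inductive cutoff d : (pt -> R) -> Prop :=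
| cut_gen k e : elementary d e -> cutoff d (fun x => bump_shell d k x * e x)
| cut_add f g : cutoff d f -> cutoff d g -> cutoff d (fun x => f x + g x).

Lemma cutoff_elementary d phi : cutoff d phi -> elementary d phi.
Proof.
elim=> [k e ee|f g _ ef _ eg]; last exact: elem_add.
by apply: elem_mul => //; exact: elem_bump.
Qed.

Lemma cutoff_mul d b phi : elementary d b -> cutoff d phi ->
  cutoff d (fun x => b x * phi x).
Proof.
move=> eb; elim=> [k e ee|f g _ cf _ cg].
- rewrite (_ : (fun=> _) = fun x => bump_shell d k x * (b x * e x)).
    by apply: cut_gen; exact: elem_mul.
  by apply/funext => x; rewrite mulrCA.
- rewrite (_ : (fun=> _) = fun x => b x * f x + b x * g x); first exact: cut_add.
  by apply/funext => x; rewrite mulrDr.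
Qed.

Lemma cutoff_partial d i phi : cutoff d phi -> cutoff d (partial i phi).
Proof.
elim=> [k e ee|f g cf df cg dg].
- rewrite (elem_partialM _ (elem_bump d k) ee) partial_bump_shell.
  apply: cut_add; last by apply: cut_gen; exact: elementary_partial.
  pose w x := - (2 / d) * coord3 i x * e x.
  have ew : elementary d w.
    by apply: elem_mul => //; apply: elementary_scale; exact: elem_coord.
  rewrite (_ : (fun=> _) = fun x => bump_shell d k.+2 x * w x +
     bump_shell d k.+1 x * (- k%:R * w x)).
    by apply: cut_add; apply: cut_gen => //; exact: elementary_scale.
  by apply/funext => x; rewrite /w; ring.
- rewrite (elem_partialD _ (cutoff_elementary cf) (cutoff_elementary cg)).
  exact: cut_add.
Qed.

Lemma cutoff_support d phi x : 0 < d -> cutoff d phi -> 1 - d <= sqnorm x ->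
  phi x = 0.
Proof.
move=> d0 cphi xd; elim: cphi => [k e _|f g _ -> _ ->]; last by rewrite addr0.
by rewrite /bump_shell ebump_npos ?mul0r// subr_le0 ler_pdivrMr// mul1r lerBlDr addrC -lerBlDr.
Qed.

Lemma test_function_cutoff d phi : 0 < d -> cutoff d phi -> test_function phi.
Proof.
move=> d0 cphi.
pose S : set pt := [set x | sqnorm x <= 1 - d].
have cS : closed S.
  rewrite (_ : S = (@sqnorm R) @^-1` [set y | y <= 1 - d])//.
  by apply: closed_comp => [y _|]; [exact: continuous_sqnorm|exact: closed_le].
have sub : support3 phi `<=` S.
  rewrite ((closure_id S).1 cS); apply: closure_subset => x /=; apply: contraNP => /negP.
  by rewrite /S /= -ltNge => /ltW h; rewrite (cutoff_support d0 cphi h).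
have subB : support3 phi `<=` @open_ball3 R.
  by move=> x /sub xS; apply/open_ball3E; apply: le_lt_trans xS _; rewrite ltrBlDr ltrDl.
split=> //; first exact: smooth_elementary (cutoff_elementary cphi).
pose K : set pt := (`[-1, 1] `*` `[-1, 1]) `*` `[-1, 1].
have cK : compact K.
  by apply: compact_setX; [apply: compact_setX|]; exact: segment_compact.
apply: subclosed_compact cK _; first exact: closed_closure.
move=> -[[a b] c] /subB /open_ball3E /ltW /ball3E xB.
rewrite /K /= !in_itv/= -!ler_norml.
by have := coord3_ball 0 xB; have := coord3_ball 1 xB; have := coord3_ball 2 xB.
Qed.

Lemma test_function_outside phi x : test_function phi -> 1 <= sqnorm x -> phi x = 0.
Proof.
move=> [_ _ sub] x1; apply: contrapT => /eqP px.
have /sub/open_ball3E : support3 phi x by apply: subset_closure.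
by rewrite ltNge x1.
Qed.

Lemma test_function_continuous phi : test_function phi -> continuous phi.
Proof. by move=> [sm _ _]; have [] := sm [::]. Qed.

Lemma test_function_derivable phi i x : test_function phi ->
  derivable phi x (axis3 R i).
Proof. by move=> [sm _ _]; have [_] := sm [::]; apply. Qed.

Lemma smooth_partial f i : smooth f -> smooth (partial i f).
Proof. by move=> sf s; have := sf (rcons s i); rewrite -cats1 foldr_cat. Qed.

Lemma test_function_partial_continuous phi i : test_function phi ->
  continuous (partial i phi).
Proof. by move=> [/(smooth_partial i) sm _ _]; have [] := sm [::]. Qed.

Lemma L2_test phi : test_function phi -> L2 phi.
Proof. by move=> /test_function_continuous; exact: L2_continuous. Qed.

Lemma ibp_test d f phi i : elementary d f -> test_function phi ->
  L2dot f (partial i phi) = - L2dot (partial i f) phi.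
Proof.
move=> ef tp; apply: ibp_ball.
- exact: elementary_continuous ef.
- exact: elementary_continuous (elementary_partial i ef).
- by move=> y; exact: elementary_derivable ef.
- exact: test_function_continuous.
- exact: test_function_partial_continuous.
- by move=> y; exact: test_function_derivable.
- by move=> y; exact: test_function_outside.
Qed.

Lemma test_functionB phi psi : test_function phi -> test_function psi ->
  test_function (phi \- psi).
Proof.
move=> [sp cp up] [sq cq uq].
have E s : foldr (@partial R) (phi \- psi) s =
    foldr (@partial R) phi s \- foldr (@partial R) psi s.
  elim: s => //= i s ->; apply/funext => x; apply: partial_val.
  have [_ dp] := sp s; have [_ dq] := sq s.
  exact: (is_deriveB (is_derive_partial (dp i x)) (is_derive_partial (dq i x))).
have sub : support3 (phi \- psi) `<=` support3 phi `|` support3 psi.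
  rewrite /support3 -closureU; apply: closure_subset => x /=; apply: contraNP.
  by move=> /not_orP[/negP/negPn/eqP -> /negP/negPn/eqP ->]; rewrite subrr.
split.
- move=> s; rewrite E; have [c1 d1] := sp s; have [c2 d2] := sq s; split.
    by move=> x; apply: cvgB; [exact: c1|exact: c2].
  by move=> i x; apply: derivableB; [exact: d1|exact: d2].
- apply: subclosed_compact (compactU cp cq) sub; exact: closed_closure.
- by move=> x /sub[/up|/uq].
Qed.

End CutoffFunctions.

(** * Convergence of the cutoffs as the shell shrinks *)

Section CutoffLimits.
Context {R : realType}.
Local Notation pt := (point3 R).
Implicit Types (f g h u v q phi : pt -> R) (x : pt) (c d t : R) (i j : 'I_3) (k m n : nat).

Lemma ebump_expR k t : 0 < t -> ebump k t <= k`!%:R /\ ebump k t <= t ^- k.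
Proof.
move=> t0; rewrite ebump_pos//; split; last first.
  rewrite ler_piMr ?invr_ge0 ?exprn_ge0 ?(ltW t0)//.
  by rewrite expR_le1 oppr_le0 invr_ge0 ltW.
rewrite expRN ler_pdivrMr ?expR_gt0// -exprVn; case: k => [|k].
  by rewrite expr0 mul1r -expR0 ler_expR invr_ge0 ltW.
have := @expR_ge1Dxn R t^-1 k; rewrite invr_ge0 => /(_ (ltW t0)) h.
rewrite mulrC -ler_pdivrMr ?ltr0n ?fact_gt0// (le_trans _ h)// lerDr.
by rewrite ler01.
Qed.

(** At t = [shell_arg n x] the factor t + 1 is (1 - |x|^2) / [shell n]: this is the singular part of
    the gradient of a cutoff once multiplied by 1 - |x|^2. It is bounded by 1! + 2! = 3 and tends to
    0 inside the ball. *)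
Definition cutoff_err t : R := (t + 1) * ebump 2 t.

Lemma cutoff_errE t : cutoff_err t = ebump 1 t + ebump 2 t.
Proof. by rewrite /cutoff_err mulrDl mul1r mulrC -ebump_factor. Qed.

Lemma cutoff_err_ge0 t : 0 <= cutoff_err t.
Proof. by rewrite cutoff_errE addr_ge0 ?ebump_ge0. Qed.

Lemma cutoff_err_le3 t : cutoff_err t <= 3.
Proof.
rewrite cutoff_errE; have [t0|t0] := ltP 0 t; last by rewrite !ebump_npos// addr0.
have [h1 _] := ebump_expR 1 t0; have [h2 _] := ebump_expR 2 t0.
by rewrite (natrD _ 1 2) lerD.
Qed.

Lemma cutoff_err_small t : 0 < t -> cutoff_err t <= t^-1 + t^-1 * t^-1.
Proof.
move=> t0; rewrite cutoff_errE.
have [_ h1] := ebump_expR 1 t0; have [_ h2] := ebump_expR 2 t0.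
by rewrite lerD// -invfM -expr2.
Qed.

Definition shell n : R := n.+1%:R^-1.

Lemma shell_gt0 n : 0 < shell n. Proof. by rewrite invr_gt0. Qed.

Definition shell_arg n x : R := (1 - sqnorm x) / shell n - 1.

Lemma shell_argV_cvg x : sqnorm x < 1 -> (shell_arg n x)^-1 @[n --> \oo] --> (0 : R).
Proof.
move=> x1; have r0 : 0 < 1 - sqnorm x by rewrite subr_gt0.
apply/gtr0_cvgV0; last first.
  rewrite /shell_arg; under eq_fun do rewrite /shell invrK.
  apply/cvgryPge => A; near=> n.
  rewrite lerBrDr mulrC -ler_pdivrMr//.
  have : (A + 1) / (1 - sqnorm x) <= n%:R.
    by near: n; exact: nbhs_infty_ger.
  by move=> /le_trans; apply; rewrite ler_nat.
near=> n; rewrite /shell_arg subr_gt0 /shell invrK mulrC -ltr_pdivrMr// mul1r.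
have : (1 - sqnorm x)^-1 <= n%:R by near: n; exact: nbhs_infty_ger.
by move=> /le_lt_trans; apply; rewrite ltr_nat.
Unshelve. all: by end_near. Qed.

Lemma shell_arg_pos x : sqnorm x < 1 -> \forall n \near \oo, 0 < shell_arg n x.
Proof.
move=> x1; have r0 : 0 < 1 - sqnorm x by rewrite subr_gt0.
near=> n; rewrite /shell_arg subr_gt0 /shell invrK mulrC -ltr_pdivrMr// mul1r.
have : (1 - sqnorm x)^-1 <= n%:R by near: n; exact: nbhs_infty_ger.
by move=> /le_lt_trans; apply; rewrite ltr_nat.
Unshelve. all: by end_near. Qed.

Lemma bump_shell_itv d x : 0 <= bump_shell d 0 x <= 1.
Proof.
rewrite /bump_shell ebump_ge0/=; set t := _ - 1.
have [t0|t0] := ltP 0 t; last by rewrite ebump_npos.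
by have [] := ebump_expR 0 t0.
Qed.

Lemma bump_shell_cvg x : sqnorm x < 1 ->
  bump_shell (shell n) 0 x @[n --> \oo] --> (1 : R).
Proof.
move=> x1; apply: (@squeeze_cvgr _ _ _ _ (fun n => 1 - (shell_arg n x)^-1) (cst 1)).
- have := shell_arg_pos x1; apply: filterS => n t0.
  have /andP[_ ->] := bump_shell_itv (shell n) x; rewrite andbT.
  rewrite /bump_shell -/(shell_arg n x) ebump_pos// expr0 invr1 mul1r.
  exact: expR_ge1Dx.
- rewrite -[X in _ --> X]subr0; apply: cvgB; first exact: cvg_cst.
  exact: shell_argV_cvg.
- exact: cvg_cst.
Qed.

Lemma cutoff_err_cvg x : sqnorm x < 1 ->
  cutoff_err (shell_arg n x) @[n --> \oo] --> (0 : R).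
Proof.
move=> x1; apply: (@squeeze_cvgr _ _ _ _ (cst 0)
    (fun n => (shell_arg n x)^-1 + (shell_arg n x)^-1 * (shell_arg n x)^-1)).
- have := shell_arg_pos x1; apply: filterS => n t0.
  by rewrite cutoff_err_ge0/= cutoff_err_small.
- exact: cvg_cst.
- rewrite -[X in _ --> X]addr0 -[X in _ --> _ + X](mulr0 0).
  by apply: cvgD; [|apply: cvgM]; exact: shell_argV_cvg.
Qed.

Lemma L2dot_congr f g f' g' : (forall x, ball3 x -> f x * g x = f' x * g' x) ->
  L2dot f g = L2dot f' g'.
Proof. by move=> h; apply: eq_Rintegral => x /set_mem; exact: h. Qed.

Lemma sphere_negligible : (@mu3 R).-negligible [set x | sqnorm x = 1].
Proof.
apply/negligibleP; last exact: sphere_null.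
rewrite -[X in measurable X]setTI.
exact: (measurable_sqnorm measurableT (measurable_set1 (1 : R))).
Qed.

Lemma ball3_lt1 x : ball3 x -> ~ [set x | sqnorm x = 1] x -> sqnorm x < 1.
Proof. by move=> /ball3E x1 /= /eqP x1'; rewrite lt_neqAle x1'. Qed.

Lemma L2dot_cvgl (u_ : nat -> pt -> R) u v : (forall n, L2 (u_ n)) -> L2 u -> L2 v ->
  L2dot (u_ n \- u) (u_ n \- u) @[n --> \oo] --> (0 : R) ->
  L2dot (u_ n) v @[n --> \oo] --> L2dot u v.
Proof.
move=> uL u0L vL cu; apply/cvgrPdist_lt => e e0.
pose K := L2dot v v + 1; have K0 : 0 < K by rewrite ltr_wpDl// L2dot_ge0.
have e2 : 0 < e ^+ 2 / K by rewrite divr_gt0// exprn_gt0.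
have /cvgrPdist_lt /(_ _ e2) := cu; apply: filterS => n.
rewrite sub0r normrN ger0_norm ?L2dot_ge0// ltr_pdivlMr// => h.
rewrite distrC -L2dotBl// -ltr_sqr ?nnegrE ?(ltW e0)// real_normK ?num_real//.
apply: le_lt_trans h; apply: le_trans (L2dot_CS (L2B (uL n) u0L) vL) _.
by rewrite ler_wpM2l ?L2dot_ge0// lerDl.
Qed.

Lemma bump_shell_mul_cvg u v : L2 u -> L2 v ->
  L2dot (fun x => bump_shell (shell n) 0 x * u x) v @[n --> \oo] --> L2dot u v.
Proof.
move=> uL vL; have L n : L2 (fun x => bump_shell (shell n) 0 x * u x).
  exact: L2_mul_elementary (elem_bump (shell n) 0) uL.
apply: L2dot_cvgl => //.
have nL : L2 (fun x => `|u x|).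
  apply/L2P; split; first exact: measurableT_comp (L2_measurable uL).
  have /L2P[_] := uL; apply: eq_integrable; first exact: measurable_ball3.
  by move=> x _ /=; rewrite real_normK ?num_real.
apply: (L2_dominated _ nL sphere_negligible) => [n|x xB xS|n x xB] /=.
- exact: L2B.
- rewrite -[X in _ --> X](subrr (1 * u x)); apply: cvgB; last by rewrite mul1r; exact: cvg_cst.
  by apply: cvgMl; apply: bump_shell_cvg; exact: ball3_lt1.
- have /andP[b0 b1] := bump_shell_itv (shell n) x.
  rewrite -[X in _ - X]mul1r -mulrBl normrM ler_piMl//.
  by rewrite ler_norml; apply/andP; split; lra.
Qed.

Lemma cutoff_err_mul_cvg u v : L2 u -> L2 v ->
  L2dot (fun x => cutoff_err (shell_arg n x) * u x) v @[n --> \oo] --> (0 : R).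
Proof.
move=> uL vL.
have ce n : continuous (fun x => cutoff_err (shell_arg n x)).
  have e1 := elementary_continuous (elem_bump (R := R) (shell n) 1).
  have e2 := elementary_continuous (elem_bump (R := R) (shell n) 2).
  rewrite (_ : (fun=> _) = fun x => bump_shell (shell n) 1 x + bump_shell (shell n) 2 x).
    by move=> x; apply: cvgD; [exact: e1|exact: e2].
  by apply/funext => x; rewrite cutoff_errE.
have L n : L2 (fun x => cutoff_err (shell_arg n x) * u x) by exact: L2_mul_continuous.
have <- : L2dot (cst 0) v = 0 by exact: (@ip0l _ _ L2_inner).
apply: L2dot_cvgl => //; first exact: L2_cst.
have nL : L2 (fun x => 3 * `|u x|).
  apply: L2Z; apply/L2P; split; first exact: measurableT_comp (L2_measurable uL).
  have /L2P[_] := uL; apply: eq_integrable; first exact: measurable_ball3.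
  by move=> x _ /=; rewrite real_normK ?num_real.
apply: (L2_dominated _ nL sphere_negligible) => [n|x xB xS|n x xB] /=.
- by apply: L2B => //; exact: L2_cst.
- rewrite -[X in _ --> X](subrr 0); apply: cvgB; last exact: cvg_cst.
  rewrite -[X in _ --> X](mul0r (u x)).
  by apply: cvgMl; apply: cutoff_err_cvg; exact: ball3_lt1.
- rewrite subr0 normrM ler_wpM2r// ger0_norm ?cutoff_err_ge0//.
  exact: cutoff_err_le3.
Qed.

Lemma cvg_sum3 (u : 'I_3 -> nat -> R) (l : 'I_3 -> R) :
  (forall i, u i n @[n --> \oo] --> l i) ->
  (\sum_(i < 3) u i n) @[n --> \oo] --> \sum_(i < 3) l i.
Proof.
move=> ul.
have -> : (fun n => \sum_(i < 3) u i n) = fun n => u ord0 n +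
    (u (lift ord0 ord0) n + u (lift ord0 (lift ord0 ord0)) n).
  by apply/funext => n; rewrite !big_ord_recl big_ord0 addr0.
have -> : \sum_(i < 3) l i = l ord0 + (l (lift ord0 ord0) + l (lift ord0 (lift ord0 ord0))).
  by rewrite !big_ord_recl big_ord0 addr0.
by apply: cvgD; [|apply: cvgD]; exact: ul.
Qed.

Lemma L2dot_sum_int (f g : 'I_3 -> pt -> R) : (forall i, L2 (f i)) ->
  (forall i, L2 (g i)) ->
  \sum_(i < 3) L2dot (f i) (g i) =
  \int[@mu3 R]_(x in @ball3 R) \sum_(i < 3) f i x * g i x.
Proof.
move=> fL gL; have I i := L2_integrableM (fL i) (gL i).
rewrite !big_ord_recl big_ord0 addr0.
rewrite -(RintegralD measurable_ball3 (I _) (I _)).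
have I2 := integrableD measurable_ball3 (I (lift ord0 ord0)) (I (lift ord0 (lift ord0 ord0))).
rewrite -(RintegralD measurable_ball3 (I _) I2).
by apply: eq_Rintegral => x _; rewrite !big_ord_recl big_ord0 addr0.
Qed.

Lemma L2_sum (f : 'I_3 -> pt -> R) : (forall i, L2 (f i)) ->
  L2 (fun x => \sum_(i < 3) f i x).
Proof.
move=> fL; rewrite (_ : (fun=> _) = f ord0 \+ (f (lift ord0 ord0) \+ f (lift ord0 (lift ord0 ord0)))).
  by apply: L2D => //; exact: L2D.
by apply/funext => x; rewrite !big_ord_recl big_ord0 addr0.
Qed.

Lemma L2dot_suml (f : 'I_3 -> pt -> R) v : (forall i, L2 (f i)) -> L2 v ->
  \sum_(i < 3) L2dot (f i) v = L2dot (fun x => \sum_(i < 3) f i x) v.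
Proof.
move=> fL vL; rewrite (@L2dot_sum_int f (fun=> v))//.
by apply: eq_Rintegral => x _; rewrite mulr_suml.
Qed.

End CutoffLimits.

(** * Distance to the polynomials *)

Section WeakPartial.
Context {R : realType}.
Local Notation pt := (point3 R).
Implicit Types (f g h u v q b phi : pt -> R) (x : pt) (c d t : R) (i j : 'I_3) (k m n K : nat).

(* Testing against the explicit cutoffs is enough: they determine g in L2, because
   polynomials are dense and their cutoffs converge to them. *)
Definition weak_partial i f g : Prop := [/\ L2 f, L2 g &
  forall d phi, 0 < d -> cutoff d phi ->
    L2dot f (partial i phi) = - L2dot g phi].

Lemma L2_cutoff d phi : cutoff d phi -> L2 phi.
Proof. by move=> /cutoff_elementary/L2_elementary. Qed.

Lemma weak_partialD i f g f' g' : weak_partial i f g -> weak_partial i f' g' ->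
  weak_partial i (fun x => f x + f' x) (fun x => g x + g' x).
Proof.
move=> [fL gL h] [fL' gL' h']; split; [exact: L2D|exact: L2D|].
move=> d phi d0 cphi; have pL := L2_cutoff cphi; have ppL := L2_cutoff (cutoff_partial i cphi).
rewrite (L2dotDl fL fL' ppL) (L2dotDl gL gL' pL) (h d)// (h' d)//.
by rewrite opprD.
Qed.

Lemma weak_partialM i f g b : (forall d, elementary d b) -> weak_partial i f g ->
  weak_partial i (fun x => b x * f x) (fun x => b x * g x + partial i b x * f x).
Proof.
move=> eb [fL gL h].
have bfL := L2_mul_elementary (eb 1) fL; have bgL := L2_mul_elementary (eb 1) gL.
have b'fL := L2_mul_elementary (elementary_partial i (eb 1)) fL.
split; [by []|exact: L2D|].
move=> d phi d0 cphi; have pL := L2_cutoff cphi.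
have ep := cutoff_elementary cphi; have ei := elementary_partial i ep.
have c1 := cutoff_mul (eb d) cphi.
have c2 := cutoff_mul (elementary_partial i (eb d)) cphi.
rewrite (L2dotDl bgL b'fL pL) !L2dotM opprD -(h d _ d0 c1).
rewrite (elem_partialM _ (eb d) ep).
rewrite (L2dotDr (L2_cutoff c2) (L2_elementary (elem_mul (eb d) ei)) fL).
by rewrite addrAC subrr add0r.
Qed.

Lemma elementary_all_poly n p : poly n p -> forall d, elementary d p.
Proof. by move=> pp d; exact: poly_elementary pp. Qed.

Lemma weak_partialZ i c f g : weak_partial i f g ->
  weak_partial i (fun x => c * f x) (fun x => c * g x).
Proof.
move=> fg; have := @weak_partialM i f g (cst c) (fun d => elem_cst d c) fg.
by rewrite partial_cst; congr weak_partial; apply/funext => x /=; rewrite mul0r addr0.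
Qed.

Lemma weak_partial_elementary i p : (forall d, elementary d p) ->
  weak_partial i p (partial i p).
Proof.
move=> ep; split.
- exact: L2_elementary (ep 1).
- exact: L2_elementary (elementary_partial i (ep 1)).
- move=> d phi d0 cphi; apply: ibp_test (ep 1) _.
  exact: test_function_cutoff cphi.
Qed.

(* No boundary term: testing against the cutoff of q leaves an extra term in which
   the singular factor produced by the gradient of the cutoff, of size 1 / shell n,
   is compensated by the factor 1 - |x|^2. *)
Lemma weak_divergence (F G : 'I_3 -> pt -> R) h q : (forall i, weak_partial i (F i) (G i)) ->
  L2 h -> (forall x, ball3 x ->
    \sum_(i < 3) coord3 i x * F i x = (1 - sqnorm x) * h x) ->
  (forall d, elementary d q) ->
  \sum_(i < 3) L2dot (F i) (partial i q) = - \sum_(i < 3) L2dot (G i) q.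
Proof.
move=> wFG hL xF eq.
have FL i : L2 (F i) by case: (wFG i). have GL i : L2 (G i) by case: (wFG i).
have qL := L2_elementary (eq 1); have q'L i := L2_elementary (elementary_partial i (eq 1)).
pose e n x := bump_shell (shell n) 0 x.
(* Where the derivative falls on the cutoff, it gives [coord3 i] times this w, the same for all i,
   so that summing over i brings out x . F and with it the factor 1 - |x|^2. *)
pose w n x := -2 / shell n * bump_shell (shell n) 2 x * q x.
have wE n : elementary (shell n) (w n).
  by apply: elem_mul (eq _); apply: elementary_scale; exact: elem_bump.
have id n : (\sum_(i < 3) L2dot (fun x => e n x * F i x) (partial i q)) +
    L2dot (fun x => cutoff_err (shell_arg n x) * h x) (fun x => -2 * q x) =
    - \sum_(i < 3) L2dot (fun x => e n x * G i x) q.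
  have E i : L2dot (fun x => e n x * F i x) (partial i q) +
      L2dot (fun x => coord3 i x * F i x) (w n) = - L2dot (fun x => e n x * G i x) q.
    have [_ _] := wFG i; have ce := cut_gen 0 (eq (shell n)).
    move=> /(_ _ _ (shell_gt0 n) ce); rewrite !L2dotM => <-.
    rewrite (elem_partialM _ (elem_bump _ _) (eq _)) partial_bump_shell.
    rewrite -L2dotDr//; last 2 first.
    - exact: L2_mul_elementary (elem_bump _ _) (q'L i).
    - exact: L2_mul_elementary (elem_coord 1 i) (L2_elementary (wE n)).
    apply: L2dot_congr => x _; congr (_ * _); rewrite /e /w addrC; congr (_ + _).
    by rewrite mulr0n mul0r subr0 mulNr; ring.
  rewrite -sumrN -(eq_bigr _ (fun i _ => E i)) big_split/=; congr (_ + _).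
  rewrite L2dot_suml; last 2 first.
  - by move=> i; exact: L2_mul_elementary (elem_coord 1 i) (FL i).
  - exact: L2_elementary (wE n).
  apply: L2dot_congr => x xB; rewrite (xF x xB) /w /cutoff_err subrK /bump_shell.
  by rewrite -/(shell_arg n x); ring.
have cL : (\sum_(i < 3) L2dot (fun x => e n x * F i x) (partial i q)) +
    L2dot (fun x => cutoff_err (shell_arg n x) * h x) (fun x => -2 * q x)
    @[n --> \oo] --> (\sum_(i < 3) L2dot (F i) (partial i q)) + 0.
  apply: cvgD; last exact: cutoff_err_mul_cvg hL (L2Z (-2) qL).
  apply: (@cvg_sum3 _ (fun i n => L2dot (fun x => e n x * F i x) (partial i q))).
  by move=> i; exact: bump_shell_mul_cvg.
have cR : - \sum_(i < 3) L2dot (fun x => e n x * G i x) q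
    @[n --> \oo] --> - \sum_(i < 3) L2dot (G i) q.
  apply: cvgN; apply: (@cvg_sum3 _ (fun i n => L2dot (fun x => e n x * G i x) q)).
  by move=> i; exact: bump_shell_mul_cvg.
rewrite addr0 in cL; apply: cvg_unique cL _ => //.
by rewrite (funext id).
Qed.

Lemma elementary_all_flux i q : (forall d, elementary d q) ->
  forall d, elementary d (legendre_flux i q).
Proof. by move=> eq d; exact: elementary_flux. Qed.

(** The divergence identity for the field f times the flux of q, tested with the constant 1. Since
    the flux is tangential, nothing is asked of f at the sphere. *)
Lemma legendre_weak f (g : 'I_3 -> pt -> R) q : (forall i, weak_partial i f (g i)) ->
  (forall d, elementary d q) ->
  L2dot f (legendre_op q) = \sum_(i < 3) L2dot (g i) (legendre_flux i q).
Proof.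
move=> wfg eq; have fL : L2 f by case: (wfg ord0).
have gL i : L2 (g i) by case: (wfg i).
pose V i := legendre_flux i q; have eV i := elementary_all_flux i eq.
have V'L i := L2_elementary (elementary_partial i (eV i 1)).
have wV i : weak_partial i (fun x => V i x * f x)
    (fun x => V i x * g i x + partial i (V i) x * f x).
  by apply: weak_partialM; [exact: eV|exact: wfg].
have eL : L2 (fun x => eul q x * f x) := L2_mul_elementary (elementary_eul (eq 1)) fL.
have xV x : ball3 x -> \sum_(i < 3) coord3 i x * (V i x * f x) =
    (1 - sqnorm x) * (eul q x * f x).
  move=> _; under eq_bigr do rewrite mulrA.
  by rewrite -mulr_suml flux_dot mulrA.
have id := weak_divergence wV eL xV (fun d => elem_cst d 1).
have {}id : \sum_(i < 3) L2dot (V i) (g i) + \sum_(i < 3) L2dot (partial i (V i)) f = 0.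
  apply/eqP; rewrite -oppr_eq0 -big_split/=; apply/eqP.
  transitivity (\sum_(i < 3) L2dot (fun x => V i x * f x) (partial i (cst 1))); last first.
    apply: big1 => i _; rewrite partial_cst L2dotC; apply: (@ip0l _ _ L2_inner).
    exact: L2_mul_elementary (eV i 1) fL.
  rewrite id; congr (- _); apply: eq_bigr => i _.
  rewrite (L2dotDl (L2_mul_elementary (eV i 1) (gL i))
    (L2_mul_elementary (elementary_partial i (eV i 1)) fL) (L2_cst 1)).
  by congr (_ + _); apply: L2dot_congr => x _ /=; rewrite mulr1.
rewrite (_ : legendre_op q = fun x => -1 * \sum_(i < 3) partial i (V i) x); last first.
  by apply/funext => x; rewrite mulN1r.
have sL := L2_sum V'L.
rewrite L2dotC (L2dotZl _ sL fL) -L2dot_suml// mulN1r; apply/eqP.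
rewrite eq_sym -subr_eq0 opprK; apply/eqP; rewrite -[RHS]id; congr (_ + _).
by apply: eq_bigr => i _; rewrite L2dotC.
Qed.

(** The matrix I - x x^T applied to g: the counterpart of [legendre_flux] for a weak gradient. *)
Definition tangential (g : 'I_3 -> pt -> R) i x : R :=
  g i x - coord3 i x * \sum_(k < 3) coord3 k x * g k x.

Lemma tangential_sym (x a b : 'I_3 -> R) :
  \sum_(i < 3) a i * (b i - x i * \sum_(k < 3) x k * b k) =
  \sum_(i < 3) (a i - x i * \sum_(k < 3) x k * a k) * b i.
Proof.
under eq_bigr do rewrite mulrBr mulrA.
under [RHS]eq_bigr do rewrite mulrBl mulrAC.
rewrite !sumrB -!mulr_suml; congr (_ - _); rewrite mulrC; congr (_ * _).
by apply: eq_bigr => i _; rewrite mulrC.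
Qed.

Lemma L2_tangential (g : 'I_3 -> pt -> R) i : (forall i, L2 (g i)) -> L2 (tangential g i).
Proof.
move=> gL; apply: L2B => //; apply: L2_mul_elementary (elem_coord 1 i) _.
by apply: L2_sum => k; exact: L2_mul_elementary (elem_coord 1 k) (gL k).
Qed.

(** By symmetry I - x x^T moves from grad q to g; the resulting field is tangential too, so a second
    integration by parts is free of boundary terms. The outcome identifies minus the sum of the G i
    as L f. *)
Lemma legendre_weak2 f (g G : 'I_3 -> pt -> R) q :
  (forall i, weak_partial i f (g i)) ->
  (forall i, weak_partial i (tangential g i) (G i)) -> (forall d, elementary d q) ->
  L2dot f (legendre_op q) = L2dot (fun x => - \sum_(i < 3) G i x) q.
Proof.
move=> wfg wG eq; have gL i : L2 (g i) by case: (wfg i).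
have GL i : L2 (G i) by case: (wG i).
have qL := L2_elementary (eq 1); have q'L i := L2_elementary (elementary_partial i (eq 1)).
rewrite (legendre_weak wfg eq).
transitivity (\sum_(i < 3) L2dot (tangential g i) (partial i q)).
  rewrite !L2dot_sum_int//; last 2 first.
  - by move=> i; exact: L2_tangential.
  - by move=> i; exact: L2_elementary (elementary_flux i (eq 1)).
  apply: eq_Rintegral => x _.
  exact: (tangential_sym (fun i => coord3 i x) (g^~ x) (fun i => partial i q x)).
rewrite (@weak_divergence _ G (fun x => \sum_(k < 3) coord3 k x * g k x))//.
- rewrite (_ : (fun x => - _) = fun x => -1 * \sum_(i < 3) G i x); last first.
    by apply/funext => x; rewrite mulN1r.
  by rewrite L2dotZl ?mulN1r -?L2dot_suml//; exact: L2_sum.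
- by apply: L2_sum => k; exact: L2_mul_elementary (elem_coord 1 k) (gL k).
- move=> x _; rewrite /tangential; under eq_bigr do rewrite mulrBr mulrA.
  rewrite sumrB -mulr_suml mulrBl mul1r.
  by under [in X in _ - X * _]eq_bigr do rewrite -expr2.
Qed.

Lemma legendre_op_sym m n p q : poly m p -> poly n q ->
  L2dot (legendre_op p) q = L2dot p (legendre_op q).
Proof.
move=> pp pq; have ep := elementary_all_poly pp; have eq := elementary_all_poly pq.
rewrite L2dotC (legendre_weak (fun i => weak_partial_elementary i eq) ep).
rewrite (legendre_weak (fun i => weak_partial_elementary i ep) eq).
have pL i := L2_elementary (elementary_partial i (ep 1)).
have qL i := L2_elementary (elementary_partial i (eq 1)).
have PL i := L2_elementary (elementary_flux i (ep 1)).
have QL i := L2_elementary (elementary_flux i (eq 1)).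
have E1 := @L2dot_sum_int _ (fun i => partial i q) (fun i => legendre_flux i p) qL PL.
have E2 := @L2dot_sum_int _ (fun i => partial i p) (fun i => legendre_flux i q) pL QL.
apply: (eq_trans E1); apply: (eq_trans _ (esym E2)).
apply: eq_Rintegral => x _.
have := tangential_sym (fun i => coord3 i x) (fun i => partial i q x) (fun i => partial i p x).
by move=> E; rewrite [LHS]E; apply: eq_bigr => i _; rewrite mulrC.
Qed.

Lemma dot3_CS (x u : 'I_3 -> R) :
  (\sum_(i < 3) x i * u i) ^+ 2 <= (\sum_(i < 3) x i ^+ 2) * (\sum_(i < 3) u i ^+ 2).
Proof.
rewrite !big_ord_recl !big_ord0 !addr0.
move: (x _) (x _) (x _) (u _) (u _) (u _) => a b c p q r.
rewrite -subr_ge0 (_ : _ - _ = (a * q - b * p) ^+ 2 + (a * r - c * p) ^+ 2 +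
  (b * r - c * q) ^+ 2); last by ring.
by rewrite !addr_ge0 ?sqr_ge0.
Qed.

(** In the unit ball M = I - x x^T satisfies 0 <= M <= I: positivity at a - b gives 2 a . M b <= a .
    M a + b . M b, and then a . M a <= a . a. *)
Lemma tangential_ge (x a b : 'I_3 -> R) : \sum_(i < 3) x i ^+ 2 <= 1 ->
  2 * \sum_(i < 3) a i * (b i - x i * \sum_(k < 3) x k * b k) <=
  \sum_(i < 3) a i * a i + \sum_(i < 3) b i * (b i - x i * \sum_(k < 3) x k * b k).
Proof.
move=> x1.
have E (u v : 'I_3 -> R) : \sum_(i < 3) u i * (v i - x i * \sum_(k < 3) x k * v k) =
    \sum_(i < 3) u i * v i - (\sum_(i < 3) x i * u i) * (\sum_(k < 3) x k * v k).
  under eq_bigr do rewrite mulrBr mulrA.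
  by rewrite sumrB -mulr_suml; congr (_ - _ * _); apply: eq_bigr => i _; rewrite mulrC.
rewrite !E; have := dot3_CS x (fun i => a i - b i).
have -> : \sum_(i < 3) x i * (a i - b i) =
    \sum_(i < 3) x i * a i - \sum_(i < 3) x i * b i.
  by rewrite -sumrB; apply: eq_bigr => i _; rewrite mulrBr.
have -> : \sum_(i < 3) (a i - b i) ^+ 2 =
    \sum_(i < 3) a i * a i + \sum_(i < 3) b i * b i - 2 * \sum_(i < 3) a i * b i.
  by rewrite mulr_sumr -big_split -sumrB; apply: eq_bigr => i _ /=; ring.
have S0 : 0 <= \sum_(i < 3) (a i - b i) ^+ 2 by apply: sumr_ge0 => i _; exact: sqr_ge0.
move: S0; have -> : \sum_(i < 3) (a i - b i) ^+ 2 =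
    \sum_(i < 3) a i * a i + \sum_(i < 3) b i * b i - 2 * \sum_(i < 3) a i * b i.
  by rewrite mulr_sumr -big_split -sumrB; apply: eq_bigr => i _ /=; ring.
move: (\sum_(i < 3) x i ^+ 2) x1 (\sum_(i < 3) a i * a i) (\sum_(i < 3) b i * b i)
  (\sum_(i < 3) a i * b i) (\sum_(i < 3) x i * a i) (\sum_(i < 3) x i * b i).
move=> X X1 A B C p q S0 h.
have h2 : (p - q) ^+ 2 <= A + B - 2 * C.
  by apply: le_trans h _; rewrite ler_piMl.
by have := sqr_ge0 p; lra.
Qed.

Definition legendre_eig n : R := n%:R * (n%:R + 3).

Lemma legendre_eig_mono m n : (m <= n)%N -> legendre_eig m <= legendre_eig n.
Proof.
by move=> mn; rewrite /legendre_eig ler_pM ?addr_ge0 ?lerD2r ?ler_nat.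
Qed.

Lemma legendre_eigS_gt0 K : 0 < legendre_eig K.+1.
Proof. by rewrite /legendre_eig mulr_gt0// addr_gt0. Qed.

(** Integrating [tangential_ge] with a = g and b = grad q gives the hypothesis of
    [projection_dist_grad]. *)
Lemma poly_dist_grad K f fK (g : 'I_3 -> pt -> R) :
  (forall i, weak_partial i f (g i)) -> projection L2_inner (poly K) f fK ->
  legendre_eig K.+1 * L2dot (f \- fK) (f \- fK) <= \sum_(i < 3) L2dot (g i) (g i).
Proof.
move=> wfg pK; have fL : L2 f by case: (wfg ord0).
have gL i : L2 (g i) by case: (wfg i).
apply: (@projection_dist_grad _ _ L2_inner (@poly R) (@legendre_op R) legendre_eig
  (@subspace_poly R) (@projectable_poly R) (@poly_mono R) (@poly_legendre_op R)
  (fun n u v pu pv => legendre_op_sym pu pv) (@legendre_op_tri R) legendre_eig_mono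
  (fun f df eps e0 => (poly_dense df).2 eps e0) K f fK _ (legendre_eigS_gt0 K) fL pK).
move=> n q pq; have eq := elementary_all_poly pq.
have qL i := L2_elementary (elementary_partial i (eq 1)).
have QL i := L2_elementary (elementary_flux i (eq 1)).
have wq := fun i => weak_partial_elementary i eq.
change (2 * L2dot f (legendre_op q) <=
  \sum_(i < 3) L2dot (g i) (g i) + L2dot (legendre_op q) q).
rewrite (L2dotC (legendre_op q)) (legendre_weak wfg eq) (legendre_weak wq eq).
rewrite (L2dot_sum_int gL QL) (L2dot_sum_int gL gL) (L2dot_sum_int qL QL).
have I (a b : 'I_3 -> pt -> R) : (forall i, L2 (a i)) -> (forall i, L2 (b i)) ->
    (@mu3 R).-integrable (@ball3 R) (EFin \o (fun x => \sum_(i < 3) a i x * b i x)).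
  move=> aL bL; have J i := L2_integrableM (aL i) (bL i).
  have := integrableD measurable_ball3 (J ord0) (integrableD measurable_ball3
    (J (lift ord0 ord0)) (J (lift ord0 (lift ord0 ord0)))).
  apply: eq_integrable; first exact: measurable_ball3.
  by move=> x _ /=; rewrite !big_ord_recl big_ord0 addr0.
rewrite -(RintegralZl _ measurable_ball3 (I _ _ gL QL)).
rewrite -(RintegralD measurable_ball3 (I _ _ gL gL) (I _ _ qL QL)).
apply: le_Rintegral.
- exact: measurable_ball3.
- by have := integrableZl measurable_ball3 2 (I _ _ gL QL).
- by have := integrableD measurable_ball3 (I _ _ gL gL) (I _ _ qL QL).
- move=> x /ball3E x1.
  exact: (tangential_ge (g^~ x) (fun i => partial i q x) x1).
Qed.

Lemma poly_dist_adjoint K f h fK hK (g G : 'I_3 -> pt -> R) :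
  (forall i, weak_partial i f (g i)) ->
  (forall i, weak_partial i (tangential g i) (G i)) ->
  h = (fun x => - \sum_(i < 3) G i x) ->
  projection L2_inner (poly K) f fK -> projection L2_inner (poly K) h hK ->
  legendre_eig K.+1 ^+ 2 * L2dot (f \- fK) (f \- fK) <= L2dot (h \- hK) (h \- hK).
Proof.
move=> wfg wG hE pf ph; have fL : L2 f by case: (wfg ord0).
have hL : L2 h by rewrite hE; apply: L2N; apply: L2_sum => i; case: (wG i).
apply: (@projection_dist_adjoint _ _ L2_inner (@poly R) (@legendre_op R) legendre_eig
  (@subspace_poly R) (@projectable_poly R) (@poly_mono R) (@poly_legendre_op R)
  (fun n u v pu pv => legendre_op_sym pu pv) (@legendre_op_tri R) legendre_eig_mono
  (fun f df eps e0 => (poly_dense df).2 eps e0) K f h fK hK (legendre_eigS_gt0 K) fL hL pf ph).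
move=> n q pq; rewrite hE.
exact: (legendre_weak2 wfg wG (elementary_all_poly pq)).
Qed.

End WeakPartial.

(** * Approximation rate under bounds on weak derivatives *)

Section SobolevBound.
Context {R : realType}.
Local Notation pt := (point3 R).
Implicit Types (f g h u v q b phi : pt -> R) (x : pt) (c d C : R) (i : 'I_3) (j k m n K : nat).

(** One constant C bounds the function and its iterated weak derivatives, so constants can be
    followed through sums and products by coordinates without expanding Sobolev norms. *)
Fixpoint sob_bound j f C : Prop :=
  [/\ L2 f, L2dot f f <= C ^+ 2 &
  if j is j'.+1 then
    forall i, exists g, weak_partial i f g /\ sob_bound j' g C
  else True].

Lemma sob_bound_L2 j f C : sob_bound j f C -> L2 f.
Proof. by case: j => [|j] []. Qed.

Lemma sob_bound_le j f C C' : 0 <= C -> C <= C' -> sob_bound j f C -> sob_bound j f C'.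
Proof.
move=> C0 CC'; have CC2 : C ^+ 2 <= C' ^+ 2 by rewrite lerXn2r ?nnegrE// (le_trans C0).
elim: j f => [|j IH] f /= [fL fC h]; split=> //; try exact: le_trans CC2.
by move=> i; have [g [wg bg]] := h i; exists g; split => //; exact: IH.
Qed.

Lemma sob_boundS j f C : sob_bound j.+1 f C -> sob_bound j f C.
Proof.
elim: j f => [|j IH] f [fL fC h]; split=> // i.
by have [g [wg bg]] := h i; exists g; split => //; exact: IH.
Qed.

Lemma sob_boundD j f g C : sob_bound j f C -> sob_bound j g C ->
  sob_bound j (fun x => f x + g x) (2 * C).
Proof.
have dotD u v : L2 u -> L2 v -> L2dot u u <= C ^+ 2 -> L2dot v v <= C ^+ 2 ->
    L2dot (fun x => u x + v x) (fun x => u x + v x) <= (2 * C) ^+ 2.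
  move=> uL vL uC vC; apply: le_trans (L2dot_sqD uL vL) _.
  by rewrite exprMn; lra.
elim: j f g => [|j IH] f g [fL fC hf] [gL gC hg]; split => //; try exact: L2D; try exact: dotD.
move=> i; have [f' [wf bf]] := hf i; have [g' [wg bg]] := hg i.
by exists (fun x => f' x + g' x); split; [exact: weak_partialD|exact: IH].
Qed.

Lemma sob_boundZ j c f C : `|c| <= 1 -> sob_bound j f C -> sob_bound j (fun x => c * f x) C.
Proof.
move=> c1; have dotZ u : L2 u -> L2dot u u <= C ^+ 2 ->
    L2dot (fun x => c * u x) (fun x => c * u x) <= C ^+ 2.
  move=> uL; apply: le_trans; rewrite L2dotZl ?L2dotZr//; last exact: L2Z.
  rewrite mulrA -expr2 ler_piMl ?L2dot_ge0// -real_normK ?num_real//.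
  by rewrite exprn_ile1.
elim: j f => [|j IH] f [fL fC h]; split => //; try exact: L2Z; try exact: dotZ.
move=> i; have [g [wg bg]] := h i; exists (fun x => c * g x).
by split; [exact: weak_partialZ|exact: IH].
Qed.

(** The product rule yields two terms at each of the j orders, hence the factor 2^j. *)
Lemma sob_bound_coord j i f C : 0 <= C -> sob_bound j f C ->
  sob_bound j (fun x => coord3 i x * f x) (2 ^+ j * C).
Proof.
move=> C0; have dotX u : L2 u -> L2dot u u <= C ^+ 2 ->
    L2dot (fun x => coord3 i x * u x) (fun x => coord3 i x * u x) <= C ^+ 2.
  move=> uL; apply: le_trans.
  rewrite -[leRHS]mul1r -(expr1n R 2); apply: L2dot_sq_mulb => //.
    exact: L2_mul_elementary (elem_coord 1 i) uL.
  by move=> x; exact: coord3_ball.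
have CC k : C ^+ 2 <= (2 ^+ k * C) ^+ 2.
  have h1 : 1 <= 2 ^+ k :> R by rewrite exprn_ege1// ler1n.
  rewrite lerXn2r ?nnegrE// ?mulr_ge0 ?exprn_ge0//.
  by rewrite ler_peMl.
elim: j f => [|j IH] f [fL fC h].
  rewrite expr0 mul1r; split => //; first exact: L2_mul_elementary (elem_coord 1 i) fL.
  exact: dotX.
split.
- exact: L2_mul_elementary (elem_coord 1 i) fL.
- exact: le_trans (dotX _ fL fC) (CC _).
move=> k; have [g [wg bg]] := h k.
exists (fun x => coord3 i x * g x + partial k (coord3 i) x * f x); split.
  by apply: weak_partialM => // d; exact: elem_coord.
rewrite exprS -mulrA; apply: sob_boundD; first exact: IH.
rewrite partial_coord3; apply: (@sob_bound_le _ _ C) => //.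
  by rewrite ler_peMl// exprn_ege1// ler1n.
apply: sob_boundZ; first by rewrite normr_nat lern1 leq_b1.
exact: sob_boundS.
Qed.

Lemma sob_bound_sum j (F : 'I_3 -> pt -> R) C : 0 <= C -> (forall i, sob_bound j (F i) C) ->
  sob_bound j (fun x => \sum_(i < 3) F i x) (4 * C).
Proof.
move=> C0 hF.
rewrite (_ : (fun=> _) = fun x =>
  F ord0 x + (F (lift ord0 ord0) x + F (lift ord0 (lift ord0 ord0)) x)).
  rewrite (_ : 4 * C = 2 * (2 * C)); last by ring.
  apply: sob_boundD; last exact: sob_boundD.
  by apply: sob_bound_le (hF _) => //; lra.
by apply/funext => x; rewrite !big_ord_recl big_ord0 addr0.
Qed.

Lemma sob_bound_legendre j : exists2 c : R, 0 <= c & forall f C, 0 <= C ->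
  sob_bound j.+2 f C -> exists (g G : 'I_3 -> pt -> R),
  [/\ forall i, weak_partial i f (g i),
      forall i, weak_partial i (tangential g i) (G i) &
      sob_bound j (fun x => - \sum_(i < 3) G i x) (c * C)].
Proof.
pose A : R := 2 ^+ j.+1; have A1 : 1 <= A by rewrite exprn_ege1// ler1n.
have A0 : 0 <= A by rewrite (le_trans ler01).
(* Each A is one multiplication by a coordinate at order j + 1, each 4 a sum over three indices (two
   doublings), and the 2 the sum defining [tangential]. *)
exists (4 * (2 * (4 * (A * A)))); first by rewrite !mulr_ge0.
move=> f C C0 [fL fC /choice[g gP]].
have wg i : weak_partial i f (g i) by case: (gP i).
have AC : 0 <= A * C by rewrite mulr_ge0.
have AAC : C <= 4 * (A * (A * C)).
  have h1 : C <= A * C by rewrite ler_peMl.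
  have h2 : A * C <= A * (A * C) by rewrite ler_peMl.
  by lra.
have tb i : sob_bound j.+1 (tangential g i) (2 * (4 * (A * (A * C)))).
  rewrite (_ : tangential g i = fun x => g i x +
     -1 * (coord3 i x * \sum_(k < 3) coord3 k x * g k x)); last first.
    by apply/funext => x; rewrite mulN1r.
  apply: sob_boundD; first by apply: sob_bound_le AAC _ => //; case: (gP i).
  apply: sob_boundZ; first by rewrite normrN1.
  rewrite mulrCA; apply: sob_bound_coord; first by rewrite mulr_ge0.
  by apply: sob_bound_sum => // k; apply: sob_bound_coord => //; case: (gP k).
have /choice[G GP] : forall i, exists h, weak_partial i (tangential g i) h /\
    sob_bound j h (2 * (4 * (A * (A * C)))) by move=> i; have [_ _] := tb i; apply.
exists g, G; split => //; first by move=> i; case: (GP i).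
rewrite (_ : (fun x => - _) = fun x => -1 * \sum_(i < 3) G i x); last first.
  by apply/funext => x; rewrite mulN1r.
apply: sob_boundZ; first by rewrite normrN1.
rewrite (_ : _ * C = 4 * (2 * (4 * (A * (A * C))))); last by ring.
by apply: sob_bound_sum; [rewrite !mulr_ge0|move=> i; case: (GP i)].
Qed.

(** Induction in steps of two: replacing f by L f costs two derivatives and gains the square of the
    eigenvalue in the squared distance. Order 0 is minimality against 0, order 1 the gradient
    estimate, where 3 counts the partial derivatives. *)
Theorem sob_bound_dist j : exists2 c : R, 0 <= c & forall K f fK C, 0 <= C ->
  sob_bound j f C -> projection L2_inner (poly K) f fK ->
  legendre_eig K.+1 ^+ j * L2dot (f \- fK) (f \- fK) <= c * C ^+ 2.
Proof.
have [m] := ubnP j; elim: m => // m IH in j *; rewrite ltnS.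
case: j => [|[|j]] jm.
- exists 1 => // K f fK C C0 [fL fC _] pK; rewrite expr0 !mul1r.
  apply: le_trans fC; have := projection_ge (subspace_poly K) fL pK (poly_cst K 0).
  by rewrite (_ : f - cst 0 = f)//; apply/funext => x /=; rewrite [LHS]subr0.
- exists 3 => // K f fK C C0 [fL fC /choice[g gP]] pK; rewrite expr1.
  apply: le_trans (poly_dist_grad (fun i => proj1 (gP i)) pK) _.
  apply: le_trans (_ : \sum_(i < 3) C ^+ 2 <= _).
    by apply: ler_sum => i _; case: (gP i) => _ [].
  by rewrite sumr_const card_ord mulr_natl.
have [c c0 hc] := IH j (leq_ltn_trans (leqnSn _) jm).
have [c' c'0 hc'] := sob_bound_legendre j.
exists (c * c' ^+ 2); first by rewrite mulr_ge0// exprn_ge0.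
move=> K f fK C C0 bf pK.
have [g [G [wg wG bh]]] := hc' f C C0 bf.
have [hK pH] := projectable_poly K (sob_bound_L2 bh).
have := poly_dist_adjoint wg wG erefl pK pH.
have l0 := @legendre_eigS_gt0 R K.
rewrite -(ler_pM2l (exprn_gt0 j l0)) mulrA -exprD addn2 => /le_trans; apply.
have c'C : 0 <= c' * C by rewrite mulr_ge0.
apply: le_trans (hc K _ hK _ c'C bh pH) _.
by rewrite exprMn mulrA.
Qed.

End SobolevBound.

(** * Sobolev spaces *)

Section SobolevLink.
Context {R : realType}.
Local Notation pt := (point3 R).
Implicit Types (f g h u v w p q phi psi : pt -> R) (x : pt) (c d e C : R) (i k : 'I_3)
  (a : 'I_3 -> nat) (j m n : nat).

Definition mzero : 'I_3 -> nat := fun=> 0%N.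
Definition munit i : 'I_3 -> nat := fun k => (k == i) : nat.

Lemma DmultiE a f : Dmulti a f = iter (a ord0) (partial ord0)
  (iter (a (lift ord0 ord0)) (partial (lift ord0 ord0))
    (iter (a (lift ord0 (lift ord0 ord0))) (partial (lift ord0 (lift ord0 ord0))) f)).
Proof.
rewrite /Dmulti (_ : enum 'I_3 = [:: ord0; lift ord0 ord0; lift ord0 (lift ord0 ord0)])//.
by apply: (inj_map val_inj); rewrite val_enum_ord.
Qed.

Lemma Dmulti_mzero f : Dmulti mzero f = f.
Proof. by rewrite DmultiE. Qed.

Lemma Dmulti_munit i f : Dmulti (munit i) f = partial i f.
Proof.
rewrite DmultiE /munit.
case: i => -[|[|[|//]]] hi /=; congr partial; exact: val_inj.
Qed.

Lemma smooth_iter n i f : smooth f -> smooth (iter n (partial i) f).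
Proof. by move=> sf; elim: n => [|n IH]; [exact: sf|exact: smooth_partial IH]. Qed.

Lemma smooth_Dmulti a f : smooth f -> smooth (Dmulti a f).
Proof. by move=> sf; rewrite DmultiE; do 3 apply: smooth_iter. Qed.

Lemma L2_Dmulti a phi : test_function phi -> L2 (Dmulti a phi).
Proof.
move=> [/(smooth_Dmulti a) sD _ _]; apply: L2_continuous.
by have [] := sD [::].
Qed.

Lemma partial_iter d n i k f : elementary d f ->
  partial i (iter n (partial k) f) = iter n (partial k) (partial i f).
Proof.
move=> ef; elim: n => //= n <-; apply: (@elementary_partialC _ d).
by elim: n => //= n; exact: elementary_partial.
Qed.

Lemma elementary_iter d n k f : elementary d f -> elementary d (iter n (partial k) f).
Proof. by move=> ef; elim: n => //= n; exact: elementary_partial. Qed.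

Lemma Dmulti_partial d a i f : elementary d f ->
  Dmulti a (partial i f) = Dmulti (fun k => (a k + munit i k)%N) f.
Proof.
move=> ef; rewrite !DmultiE /munit.
have e2 n k : elementary d (iter n (partial k) f) by exact: elementary_iter.
have e3 n k n' k' : elementary d (iter n (partial k) (iter n' (partial k') f)).
  by apply: elementary_iter; exact: elementary_iter.
case: i => -[|[|[|//]]] hi /=; rewrite ?addn0 ?addn1 !iterS.
- rewrite (_ : Ordinal hi = ord0); last exact: val_inj.
  by rewrite (partial_iter _ _ _ (e3 _ _ _ _)) (partial_iter _ _ _ (e2 _ _)) (partial_iter _ _ _ ef).
- rewrite (_ : Ordinal hi = lift ord0 ord0); last exact: val_inj.
  by rewrite (partial_iter _ _ _ (e2 _ _)) (partial_iter _ _ _ ef).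
- rewrite (_ : Ordinal hi = lift ord0 (lift ord0 ord0)); last exact: val_inj.
  by rewrite (partial_iter _ _ _ ef).
Qed.

(** The cutoffs of a polynomial converge to it, so g is orthogonal to all polynomials and null by
    density. Uniqueness of weak derivatives rests on this. *)
Lemma cutoff_null g : L2 g -> (forall d phi, 0 < d -> cutoff d phi -> L2dot g phi = 0) ->
  L2dot g g = 0.
Proof.
move=> gL g0.
have gp n p : poly n p -> L2dot g p = 0.
  move=> pp; have pL := L2_poly pp.
  have lim := bump_shell_mul_cvg pL gL.
  rewrite L2dotC; apply: cvg_unique lim _ => //.
  rewrite (_ : (fun n => _) = cst 0); first exact: cvg_cst.
  apply/funext => k /=; rewrite L2dotC; apply: (g0 _ _ (shell_gt0 k)).
  exact: cut_gen (poly_elementary _ pp).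
apply/eqP; rewrite eq_le L2dot_ge0 andbT; apply/ler_addgt0Pr => e e0; rewrite add0r.
have [n [p [pp gpe]]] := (poly_dense gL).2 _ e0; have pL := L2_poly pp.
have := L2dot_CS gL (L2B gL pL).
rewrite (L2dotBr gL pL gL) (gp _ _ pp) subr0 expr2.
have [->|gg0] := eqVneq (L2dot g g) 0; first by move=> _; exact: ltW.
have ggp : 0 < L2dot g g by rewrite lt_neqAle eq_sym gg0 L2dot_ge0.
by rewrite ler_pM2l// => /le_trans; apply; exact: ltW.
Qed.

Lemma L2dot_null_eq f g h : L2 f -> L2 g -> L2 h -> L2dot (f \- g) (f \- g) = 0 ->
  L2dot f h = L2dot g h.
Proof. exact: (@ip_null_eq _ _ L2_inner). Qed.

Lemma is_wderiv_uniq a u g h : is_wderiv a u g -> is_wderiv a u h ->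
  L2dot (g \- h) (g \- h) = 0.
Proof.
move=> [gL hg] [hL hh]; apply: cutoff_null; first exact: L2B.
move=> d phi d0 cphi; have tphi := test_function_cutoff d0 cphi.
rewrite (L2dotBl gL hL (L2_test tphi)).
have := hg _ tphi; rewrite hh// => /(mulfI _) ->; first exact: subrr.
by rewrite signr_eq0.
Qed.

Lemma wderivP a u : (exists g, is_wderiv a u g) -> is_wderiv a u (wderiv a u).
Proof. by move=> ex; exact: xgetPex. Qed.

Lemma L2_wderiv a u : L2 (wderiv a u).
Proof.
have [ex|nex] := pselect (exists g, is_wderiv a u g); first by case: (wderivP ex).
rewrite /wderiv xgetPN; first exact: L2_cst.
by move=> g hg; apply: nex; exists g.
Qed.

(** [wderiv] is an arbitrary representative; it is handled through its pairings, which are common to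
    all representatives. *)
Lemma wderiv_dotl a u g h : is_wderiv a u g -> L2 h ->
  L2dot (wderiv a u) h = L2dot g h.
Proof.
move=> ug hL; apply: L2dot_null_eq => //; first exact: L2_wderiv.
  by case: ug.
exact: is_wderiv_uniq (wderivP (ex_intro _ g ug)) ug.
Qed.

Lemma wderiv_dot a u g : is_wderiv a u g ->
  L2dot (wderiv a u) (wderiv a u) = L2dot g g.
Proof.
move=> ug; have gL : L2 g by case: ug.
by rewrite (wderiv_dotl ug (L2_wderiv a u)) L2dotC (wderiv_dotl ug gL).
Qed.

Lemma is_wderivB a u v g h : L2 u -> L2 v -> is_wderiv a u g -> is_wderiv a v h ->
  is_wderiv a (u \- v) (g \- h).
Proof.
move=> uL vL [gL hg] [hL hh]; split; first exact: L2B.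
move=> phi tphi; rewrite (L2dotBl uL vL (L2_Dmulti a tphi)).
by rewrite (L2dotBl gL hL (L2_test tphi)) hg// hh// mulrBr.
Qed.

Lemma is_wderiv_eq a u v g : (forall x, ball3 x -> u x = v x) -> is_wderiv a u g ->
  is_wderiv a v g.
Proof.
move=> uv [gL hg]; split => // phi tphi; rewrite -hg//.
by apply: L2dot_congr => x xB; rewrite uv.
Qed.

Lemma is_wderiv0 u : L2 u -> is_wderiv mzero u u.
Proof.
move=> uL; split => // phi _; rewrite Dmulti_mzero big1 ?expr0 ?mul1r//.
Qed.

Lemma sum_munit i : (\sum_(k < 3) munit i k)%N = 1%N.
Proof.
rewrite (bigD1 i)//= /munit eqxx big1// => k /negPf ->//.
Qed.

Lemma is_wderiv_ibp i u g : L2 g -> (forall phi, test_function phi ->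
    L2dot u (partial i phi) = - L2dot g phi) -> is_wderiv (munit i) u g.
Proof.
move=> gL h; split => // phi tphi.
by rewrite sum_munit expr1 mulN1r Dmulti_munit h.
Qed.

Lemma is_wderiv_elementary d i p : elementary d p -> is_wderiv (munit i) p (partial i p).
Proof.
move=> ep; apply: is_wderiv_ibp; first exact: L2_elementary (elementary_partial i ep).
by move=> phi tphi; exact: ibp_test ep tphi.
Qed.

Lemma is_wderiv_test i phi : test_function phi -> is_wderiv (munit i) phi (partial i phi).
Proof.
move=> tp; apply: is_wderiv_ibp.
  by apply: L2_continuous; exact: test_function_partial_continuous.
move=> psi tq; apply: ibp_ball.
- exact: test_function_continuous.
- exact: test_function_partial_continuous.
- by move=> y; exact: test_function_derivable.
- exact: test_function_continuous.
- exact: test_function_partial_continuous.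
- by move=> y; exact: test_function_derivable.
- by move=> y; exact: test_function_outside.
Qed.

Lemma L2norm_sq f : L2 f -> L2norm f ^+ 2 = L2dot f f.
Proof. by move=> fL; rewrite L2normE// sqr_sqrtr// L2dot_ge0. Qed.

Lemma Hnorm_sq m u : Hnorm m u ^+ 2 =
  \sum_(a : {ffun 'I_3 -> 'I_m.+1} | (\sum_(i < 3) a i <= m)%N)
    L2dot (wderiv (fun i => a i) u) (wderiv (fun i => a i) u).
Proof.
rewrite /Hnorm sqr_sqrtr; last by apply: sumr_ge0 => a _; exact: sqr_ge0.
by apply: eq_bigr => a _; rewrite L2norm_sq//; exact: L2_wderiv.
Qed.

Lemma Hnorm_ge0 m u : 0 <= Hnorm m u.
Proof. exact: sqrtr_ge0. Qed.

Lemma Hnorm_ge m a u : (\sum_(i < 3) a i <= m)%N ->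
  L2dot (wderiv a u) (wderiv a u) <= Hnorm m u ^+ 2.
Proof.
move=> am; rewrite Hnorm_sq.
have ai i : (a i < m.+1)%N by rewrite ltnS (leq_trans _ am)// (bigD1 i)//= leq_addr.
pose b : {ffun 'I_3 -> 'I_m.+1} := [ffun i => Ordinal (ai i)].
have bE : (fun i => b i : nat) = a by apply/funext => i; rewrite ffunE.
rewrite (bigD1 b) /=; last by under eq_bigr do rewrite ffunE.
rewrite bE lerDl; apply: sumr_ge0 => c _; exact: L2dot_ge0.
Qed.

Lemma multi_le1 a : (\sum_(i < 3) a i <= 1)%N -> a = mzero \/ exists i, a = munit i.
Proof.
move=> a1; have [/forallP a0|] := boolP [forall i, a i == 0%N].
  by left; apply/funext => i; exact/eqP.
rewrite negb_forall => /existsP[i ai]; right; exists i; apply/funext => k.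
move: a1; rewrite (bigD1 i)//= => a1; have ai1 : a i = 1%N.
  by apply/eqP; rewrite eqn_leq lt0n ai andbT (leq_trans _ a1)// leq_addr.
rewrite /munit; case: eqVneq => [->//|ki].
move: a1; rewrite ai1 (bigD1 k)//= add1n ltnS leqn0 addn_eq0.
by move=> /andP[/eqP -> _].
Qed.

Lemma Hnorm1_le u C : 0 <= C -> L2dot (wderiv mzero u) (wderiv mzero u) <= C ->
  (forall i, L2dot (wpartial i u) (wpartial i u) <= C) ->
  Hnorm 1 u ^+ 2 <= 8 * C.
Proof.
move=> C0 u0 u1; rewrite Hnorm_sq.
(* The factor 8 counts all 2^3 index functions, instead of the four of order at most 1. *)
apply: le_trans (_ : \sum_(a : {ffun 'I_3 -> 'I_2}) C <= _).
  rewrite [leRHS](bigID (fun a : {ffun 'I_3 -> 'I_2} => (\sum_(i < 3) a i <= 1)%N))/=.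
  rewrite -[leLHS]addr0 lerD//; last by apply: sumr_ge0.
  apply: ler_sum => a /multi_le1[->//|[i ->]]; exact: u1.
by rewrite sumr_const card_ffun !card_ord mulr_natl.
Qed.

Lemma weak_partial_wderiv m u a i : sobolev m u -> (\sum_(k < 3) a k < m)%N ->
  weak_partial i (wderiv a u) (wderiv (fun k => (a k + munit i k)%N) u).
Proof.
move=> [uL hu] am; set b := fun k => _.
have sb : (\sum_(k < 3) b k)%N = (\sum_(k < 3) a k).+1.
  by rewrite big_split/= sum_munit addn1.
split; [exact: L2_wderiv|exact: L2_wderiv|] => d phi d0 cphi.
have tphi := test_function_cutoff d0 cphi.
have tphi' := test_function_cutoff d0 (cutoff_partial i cphi).
have [_ ha] := wderivP (hu a (ltnW am)).
have bm : (\sum_(k < 3) b k <= m)%N by rewrite sb.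
have [_ hb] := wderivP (hu b bm).
have := hb _ tphi; rewrite -(Dmulti_partial a i (cutoff_elementary cphi)) ha// sb exprS.
rewrite mulN1r mulNr -mulrN => /mulfI; apply.
by rewrite signr_eq0.
Qed.

Lemma sobolev_sob_bound m u : sobolev m u -> forall j a, (\sum_(i < 3) a i + j <= m)%N ->
  sob_bound j (wderiv a u) (Hnorm m u).
Proof.
move=> su; elim=> [|j IH] a; rewrite ?addn0 => am.
  by split => //; [exact: L2_wderiv|exact: Hnorm_ge].
have am' : (\sum_(i < 3) a i < m)%N by apply: leq_trans am; rewrite -addn1 leq_add2l.
split; [exact: L2_wderiv|exact: Hnorm_ge (ltnW am')|] => i.
exists (wderiv (fun k => (a k + munit i k)%N) u).
split; first exact: weak_partial_wderiv su am'.
by apply: IH; rewrite big_split/= sum_munit addn1 addSn -addnS.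
Qed.

Lemma aformE u v : aform u v = \sum_(i < 3) L2dot (wpartial i u) (wpartial i v).
Proof. by rewrite L2dot_sum_int// => i; exact: L2_wderiv. Qed.

Lemma sobolev1_is_wpartial u i : sobolev 1 u -> is_wderiv (munit i) u (wpartial i u).
Proof. by move=> [uL hu]; apply: wderivP; apply: hu; rewrite sum_munit. Qed.

Lemma sobolevL2 m u : sobolev m u -> L2 u.
Proof. by case. Qed.

Lemma sobolev1I u (g : 'I_3 -> pt -> R) : L2 u -> (forall i, is_wderiv (munit i) u (g i)) ->
  sobolev 1 u.
Proof.
move=> uL ug; split => // a /multi_le1[->|[i ->]].
  by exists u; exact: is_wderiv0.
by exists (g i).
Qed.

Lemma sobolev1B u v : sobolev 1 u -> sobolev 1 v -> sobolev 1 (u \- v).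
Proof.
move=> su sv; have uL := sobolevL2 su; have vL := sobolevL2 sv.
apply: (@sobolev1I _ (fun i => wpartial i u \- wpartial i v)); first exact: L2B.
by move=> i; apply: is_wderivB => //; exact: sobolev1_is_wpartial.
Qed.

Lemma wpartialB_dotl u v i h : sobolev 1 u -> sobolev 1 v -> L2 h ->
  L2dot (wpartial i (u \- v)) h = L2dot (wpartial i u) h - L2dot (wpartial i v) h.
Proof.
move=> su sv hL; have uL := sobolevL2 su; have vL := sobolevL2 sv.
have wB := is_wderivB uL vL (sobolev1_is_wpartial i su) (sobolev1_is_wpartial i sv).
by rewrite (wderiv_dotl wB hL) (L2dotBl (L2_wderiv _ _) (L2_wderiv _ _) hL).
Qed.

Lemma sobolev1_test phi : test_function phi -> sobolev 1 phi.
Proof.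
move=> tp; apply: sobolev1I (L2_test tp) _ => i; exact: is_wderiv_test.
Qed.

Lemma sobolev0_1P u : sobolev0 1 u <-> sobolev 1 u /\ forall e, 0 < e ->
  exists phi, [/\ test_function phi, L2dot (u \- phi) (u \- phi) <= e &
    forall i, L2dot (wpartial i u \- partial i phi) (wpartial i u \- partial i phi) <= e].
Proof.
have dots phi i : sobolev 1 u -> test_function phi ->
    L2dot (wpartial i (u \- phi)) (wpartial i (u \- phi)) =
    L2dot (wpartial i u \- partial i phi) (wpartial i u \- partial i phi).
  move=> su tp; apply: wderiv_dot.
  apply: is_wderivB; [exact: sobolevL2 su|exact: L2_test| |exact: is_wderiv_test].
  exact: sobolev1_is_wpartial.
have dot0 phi : sobolev 1 u -> test_function phi ->
    L2dot (wderiv mzero (u \- phi)) (wderiv mzero (u \- phi)) = L2dot (u \- phi) (u \- phi).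
  move=> su tp; apply: wderiv_dot; apply: is_wderiv0.
  exact: L2B (sobolevL2 su) (L2_test tp).
split=> -[su hu]; split=> // e e0.
  have se0 : 0 < Num.sqrt e by rewrite sqrtr_gt0.
  have [phi tp hphi] := hu _ se0; exists phi.
  have he : Hnorm 1 (u \- phi) ^+ 2 <= e.
    rewrite -[leRHS](sqr_sqrtr (ltW e0)) lerXn2r ?nnegrE ?Hnorm_ge0 ?sqrtr_ge0//.
    exact: ltW.
  split => //.
    by rewrite -dot0//; apply: le_trans he; apply: Hnorm_ge; rewrite big1.
  by move=> i; rewrite -dots//; apply: le_trans he; apply: Hnorm_ge; rewrite sum_munit.
(* After the factor 8 of [Hnorm1_le] this leaves e^2 / 2, strictly below e^2. *)
have e2 : 0 < e ^+ 2 / 16 by rewrite divr_gt0// exprn_gt0.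
have [phi [tp h0 h1]] := hu _ e2; exists phi => //.
rewrite -ltr_sqr ?nnegrE ?Hnorm_ge0 ?(ltW e0)//.
apply: le_lt_trans (_ : 8 * (e ^+ 2 / 16) < _).
  apply: Hnorm1_le; [exact: ltW|by rewrite dot0|by move=> i; rewrite dots].
by have := exprn_gt0 2 e0; lra.
Qed.

Lemma sobolev0_1B u v : sobolev0 1 u -> sobolev0 1 v -> sobolev0 1 (u \- v).
Proof.
move=> /sobolev0_1P[su hu] /sobolev0_1P[sv hv]; apply/sobolev0_1P.
split; first exact: sobolev1B.
move=> e e0; have e4 : 0 < e / 4 by rewrite divr_gt0.
have [phi [tp p0 p1]] := hu _ e4; have [psi [tq q0 q1]] := hv _ e4.
have uL := sobolevL2 su; have vL := sobolevL2 sv.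
exists (phi \- psi); split; first exact: test_functionB.
  rewrite (_ : _ \- _ = (u \- phi) \+ (fun x => -1 * (v \- psi) x)); last first.
    by apply/funext => x /=; ring.
  have aL := L2B uL (L2_test tp); have bL := L2B vL (L2_test tq).
  apply: le_trans (L2dot_sqD aL (L2Z (-1) bL)) _.
  rewrite (L2dotZl _ bL (L2Z (-1) bL)) (L2dotZr _ bL bL) mulN1r mulN1r opprK.
  by move: (L2dot _ _) (L2dot _ _) p0 q0 => A B hA hB; clear -hA hB; lra.
move=> i; pose F := wpartial i u \- partial i phi; pose G := wpartial i v \- partial i psi.
have tpL : L2 (partial i phi) by apply: L2_continuous; exact: test_function_partial_continuous.
have tqL : L2 (partial i psi) by apply: L2_continuous; exact: test_function_partial_continuous.
have FL : L2 F := L2B (L2_wderiv _ _) tpL. have GL : L2 G := L2B (L2_wderiv _ _) tqL.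
have tpq := test_functionB tp tq.
have tpqL : L2 (partial i (phi \- psi)) by apply: L2_continuous;
  exact: test_function_partial_continuous.
have pE : partial i (phi \- psi) = partial i phi \- partial i psi.
  apply/funext => x; apply: partial_val.
  have dp := is_derive_partial (@test_function_derivable _ _ i x tp).
  have dq := is_derive_partial (@test_function_derivable _ _ i x tq).
  exact: is_deriveB dp dq.
have wB := is_wderivB uL vL (sobolev1_is_wpartial i su) (sobolev1_is_wpartial i sv).
have wu : is_wderiv (munit i) ((u \- v) \- (phi \- psi))
    ((wpartial i u \- wpartial i v) \- partial i (phi \- psi)).
  by apply: is_wderivB => //; [exact: L2B|exact: L2_test|exact: is_wderiv_test].
have wu' : is_wderiv (munit i) ((u \- v) \- (phi \- psi))
    (wpartial i (u \- v) \- partial i (phi \- psi)).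
  apply: is_wderivB; [exact: L2B|exact: L2_test| |exact: is_wderiv_test].
  exact: sobolev1_is_wpartial (sobolev1B su sv).
rewrite -(wderiv_dot wu') (wderiv_dot wu) pE.
rewrite (_ : _ \- _ = F \+ (fun x => -1 * G x)); last first.
  by apply/funext => x; rewrite /F /G /=; ring.
apply: le_trans (L2dot_sqD FL (L2Z (-1) GL)) _.
rewrite (L2dotZl _ GL (L2Z (-1) GL)) (L2dotZr _ GL GL) mulN1r mulN1r opprK.
have hF : L2dot F F <= e / 4 := p1 i; have hG : L2dot G G <= e / 4 := q1 i.
by move: (L2dot F F) (L2dot G G) hF hG => A B hA hB; clear -hA hB; lra.
Qed.

(** Cauchy-Schwarz with |g| replaced by |g|^2 + 1, which avoids a square root. *)
Lemma abs_dot_le f g e : L2 f -> L2 g -> 0 <= e -> L2dot f f <= e ^+ 2 ->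
  `|L2dot f g| <= e * (L2dot g g + 1).
Proof.
move=> fL gL e0 fe; have g0 := L2dot_ge0 g.
have h : L2dot f g ^+ 2 <= (e * (L2dot g g + 1)) ^+ 2.
  apply: le_trans (L2dot_CS fL gL) _; rewrite exprMn.
  by apply: ler_pM => //; [exact: L2dot_ge0|nra].
rewrite -ler_sqr ?nnegrE ?mulr_ge0 ?addr_ge0//.
by rewrite real_normK ?num_real.
Qed.

(** Both sides are continuous in w for the H^1 norm, and for a test function in place of w the
    identity is an ordinary integration by parts. *)
Lemma sobolev0_ibp w p : sobolev0 1 w -> (forall d, elementary d p) ->
  \sum_(i < 3) L2dot (wpartial i w) (partial i p) = - L2dot w (lap p).
Proof.
move=> /sobolev0_1P[sw hw] ep.
have wL := sobolevL2 sw; have lL := L2_elementary (elementary_lap (ep 1)).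
have pL i := L2_elementary (elementary_partial i (ep 1)).
apply/eqP; rewrite -addr_eq0 -normr_eq0 eq_le normr_ge0 andbT.
set D := \sum_(i < 3) _ + _.
pose K := (\sum_(i < 3) (L2dot (partial i p) (partial i p) + 1)) + (L2dot (lap p) (lap p) + 1).
have K0 : 0 < K.
  by rewrite ltr_wpDl ?sumr_ge0// => [i _|]; rewrite ?addr_ge0 ?L2dot_ge0// ltr_wpDl// L2dot_ge0.
apply/ler_addgt0Pr => e e0; rewrite add0r.
have eK : 0 < e / K by rewrite divr_gt0.
have [phi [tp h0 h1]] := hw _ (exprn_gt0 2 eK).
have tpL i : L2 (partial i phi) by apply: L2_continuous; exact: test_function_partial_continuous.
have phi0 : \sum_(i < 3) L2dot (partial i phi) (partial i p) + L2dot phi (lap p) = 0.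
  rewrite (L2dotC phi) -(@L2dot_suml _ (fun i => partial i (partial i p))); last 2 first.
  - by move=> i; exact: L2_elementary (elementary_partial i (elementary_partial i (ep 1))).
  - exact: L2_test.
  rewrite -big_split big1// => i _ /=; rewrite L2dotC.
  by rewrite (ibp_test i (elementary_partial i (ep 1)) tp) addNr.
have -> : D = \sum_(i < 3) L2dot (wpartial i w \- partial i phi) (partial i p) +
    L2dot (w \- phi) (lap p).
  rewrite (L2dotBl wL (L2_test tp) lL).
  under eq_bigr do rewrite (L2dotBl (L2_wderiv _ _) (tpL _) (pL _)).
  by rewrite sumrB /D; move: phi0; lra.
have -> : e = e / K * K by rewrite divfK// gt_eqF.
apply: le_trans (ler_normD _ _) _; rewrite mulrDr lerD//; last first.
  by apply: abs_dot_le => //; [exact: L2B (L2_test tp)|exact: ltW].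
apply: le_trans (ler_norm_sum _ _ _) _; rewrite mulr_sumr; apply: ler_sum => i _.
by apply: abs_dot_le => //; [exact: L2B (L2_wderiv _ _) (tpL _)|exact: ltW].
Qed.

Lemma partial_subC d g i c : elementary d g ->
  partial i (fun x => g x - c) = partial i g.
Proof.
move=> eg; apply/funext => x.
have := congr1 (@^~ x) (elem_partialB i eg (elem_cst d c)) => /= E.
by rewrite [LHS]E; rewrite -/(cst c) partial_cst subr0.
Qed.

Lemma partial_rho i : partial i (fun x => 1 - @sqnorm R x) = fun x => -2 * coord3 i x.
Proof.
apply/funext => x.
have := congr1 (@^~ x) (elem_partialB i (elem_cst 1 1) (elementary_sqnorm 1)) => /= E.
by rewrite [LHS]E -/(cst 1) partial_cst partial_sqnorm /=; ring.
Qed.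

(** An explicit factor 1 - |x|^2 is enough to build approximating test functions by hand; this is
    what places V_N in H_0^1. *)
Lemma sobolev0_vanishing v q : (forall d, elementary d q) ->
  (forall x, ball3 x -> v x = (1 - sqnorm x) * q x) -> sobolev0 1 v.
Proof.
move=> eq vE; pose p x := (1 - sqnorm x) * q x.
have e1 d : elementary d (fun x => 1 - sqnorm x).
  by apply: elementary_sub; [exact: elem_cst|exact: elementary_sqnorm].
have ep d : elementary d p by exact: elem_mul.
have pE i : partial i p = fun x => -2 * coord3 i x * q x + (1 - sqnorm x) * partial i q x.
  by rewrite (elem_partialM i (e1 1) (eq 1)) partial_rho.
have vL : L2 v by apply: L2_eq (L2_elementary (ep 1)) => x /vE.
have wv i : is_wderiv (munit i) v (partial i p).
  by apply: is_wderiv_eq (is_wderiv_elementary i (ep 1)) => x /vE.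
have sv : sobolev 1 v by exact: sobolev1I wv.
(* Subtracting [shell n] makes the second factor equal to [shell n] times the argument t of the
   bump. The gradient of the cutoff then only produces t * [ebump 2 t] = [ebump 1 t], which is
   bounded and tends to 0 inside. *)
pose phi n x := bump_shell (shell n) 0 x * ((1 - sqnorm x - shell n) * q x).
have cphi n : cutoff (shell n) (phi n).
  apply: cut_gen; apply: elem_mul => //; apply: elementary_sub => //; exact: elem_cst.
have tphi n := test_function_cutoff (shell_gt0 n) (cphi n).
have phiE n i : partial i (phi n) = fun x =>
    -2 * coord3 i x * q x * (bump_shell (shell n) 1 x + bump_shell (shell n) 0 x) +
    (1 - sqnorm x - shell n) * bump_shell (shell n) 0 x * partial i q x.
  have es := elementary_sub (e1 (shell n)) (elem_cst (shell n) (shell n)).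
  rewrite (elem_partialM i (elem_bump _ 0) (elem_mul es (eq _))) (elem_partialM i es (eq _)).
  rewrite (partial_subC _ _ (e1 (shell n))) partial_rho.
  rewrite partial_bump_shell; apply/funext => x /=.
  have s0 : shell n != 0 :> R by rewrite gt_eqF// shell_gt0.
  have -> : bump_shell (shell n) 1 x =
      bump_shell (shell n) 2 x * ((1 - sqnorm x) / shell n - 1).
    by rewrite /bump_shell; exact: ebump_factor.
  move: (bump_shell (shell n) 2 x) (bump_shell (shell n) 0 x) => b2 b0.
  move: (q x) (partial i q x) (coord3 i x) (sqnorm x) (shell n : R) s0 => Q Q' X S s s0.
  by field.
have [Mq Mq0 qM] := continuous_bounded_ball (elementary_continuous (eq 1)).
have shell_le1 n : shell n <= 1 :> R by rewrite /shell invf_le1// ler1n.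
have shell0 : shell n @[n --> \oo] --> (0 : R).
  exact: cvg_harmonic.
have rho_itv x : ball3 x -> 0 <= 1 - sqnorm x <= 1.
  by move=> /ball3E x1; have := sqnorm_ge0 x; move=> x0; apply/andP; split; lra.
have c0 : L2dot (v \- phi n) (v \- phi n) @[n --> \oo] --> (0 : R).
  apply: (L2_dominated _ (L2_cst (3 * Mq)) sphere_negligible) => [n|x xB xS|n x xB] /=.
  - by apply: L2B vL (L2_test (tphi n)).
  - rewrite (vE x xB).
    rewrite -[X in _ --> X](subrr (1 * ((1 - sqnorm x - 0) * q x))).
    apply: cvgB; first by rewrite mul1r subr0; exact: cvg_cst.
    apply: cvgM; first by apply: bump_shell_cvg; exact: ball3_lt1.
    by apply: cvgMl; apply: cvgB => //; exact: cvg_cst.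
  - have /andP[b0 b1] := bump_shell_itv (shell n) x; have /andP[r0 r1] := rho_itv x xB.
    rewrite (vE x xB) /phi mulrA -mulrBl normrM ler_pM//; last exact: qM.
    have s0 := shell_gt0 (R := R) n; have s1 := shell_le1 n.
    rewrite ler_norml; apply/andP; split; nra.
have c1 i : L2dot (partial i p \- partial i (phi n)) (partial i p \- partial i (phi n))
    @[n --> \oo] --> (0 : R).
  have [Mp Mp0 pM] := continuous_bounded_ball (elementary_continuous (elementary_partial i (eq 1))).
  apply: (L2_dominated _ (L2_cst (6 * Mq + 3 * Mp)) sphere_negligible) => [n|x xB xS|n x xB] /=.
  - apply: L2B (L2_elementary (elementary_partial i (ep 1))) _.
    by apply: L2_continuous; exact: test_function_partial_continuous (tphi n).
  - have x1 := ball3_lt1 xB xS; rewrite pE.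
    rewrite (_ : (fun n => _) = fun n =>
      (-2 * coord3 i x * q x + (1 - sqnorm x) * partial i q x) -
      (-2 * coord3 i x * q x * (bump_shell (shell n) 1 x + bump_shell (shell n) 0 x) +
      (1 - sqnorm x - shell n) * bump_shell (shell n) 0 x * partial i q x)); last first.
      by apply/funext => n; rewrite phiE.
    rewrite -[X in _ --> X](subrr (-2 * coord3 i x * q x * (0 + 1) +
      (1 - sqnorm x - 0) * 1 * partial i q x)).
    apply: cvgB; first by rewrite add0r subr0 !mulr1; exact: cvg_cst.
    apply: cvgD; [apply: cvgMr; apply: cvgD|apply: cvgMl; apply: cvgM].
    + apply: (@squeeze_cvgr _ _ _ _ (cst 0) (fun n => cutoff_err (shell_arg n x))).
      * apply: nearW => n; rewrite cutoff_errE ebump_ge0/= lerDl.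
        exact: ebump_ge0.
      * exact: cvg_cst.
      * exact: cutoff_err_cvg.
    + exact: bump_shell_cvg.
    + by apply: cvgB => //; exact: cvg_cst.
    + exact: bump_shell_cvg.
  - rewrite pE phiE.
    have /andP[b0 b1] := bump_shell_itv (shell n) x; have /andP[r0 r1] := rho_itv x xB.
    have c0' : 0 <= bump_shell (shell n) 1 x <= 1.
      rewrite /bump_shell ebump_ge0/=; set t := _ - 1.
      have [t0|t0] := ltP 0 t; last by rewrite ebump_npos.
      by have [] := ebump_expR 1 t0.
    have /andP[c00 c01] := c0'.
    have X1 := coord3_ball i xB; have Q1 := qM x xB; have P1 := pM x xB.
    have s0 := shell_gt0 (R := R) n; have s1 := shell_le1 n.
    move: X1 Q1 P1 b0 b1 r0 r1 c00 c01 s0 s1 Mq0 Mp0 {c0'}.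
    move: (bump_shell (shell n) 1 x) (bump_shell (shell n) 0 x) => b b'.
    move: (1 - sqnorm x) (q x) (partial i q x) (coord3 i x) (shell n : R).
    move=> r Q Q' X s X1 Q1 P1 b0 b1 r0 r1 c00 c01 s0 s1 Mq0 Mp0.
    rewrite (_ : _ - _ = (-2 * X * (1 - b - b')) * Q + (r - (r - s) * b') * Q'); last by ring.
    apply: le_trans (ler_normD _ _) _; rewrite !normrM lerD//.
    + apply: ler_pM => //; rewrite ?mulr_ge0//.
      rewrite normrN (ger0_norm (ler0n R 2)).
      have h1 : `|1 - b - b'| <= 3 by rewrite ler_norml; apply/andP; split; lra.
      have := normr_ge0 X; have := normr_ge0 (1 - b - b'); nra.
    + apply: ler_pM => //.
      by rewrite ler_norml; apply/andP; split; nra.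
apply/sobolev0_1P; split => // e e0.
have n0 : \forall n \near \oo, L2dot (v \- phi n) (v \- phi n) <= e.
  have /cvgrPdist_lt /(_ _ e0) := c0; apply: filterS => n.
  by rewrite sub0r normrN => /ltW; apply: le_trans; exact: ler_norm.
pose S n := \sum_(i < 3) L2dot (partial i p \- partial i (phi n)) (partial i p \- partial i (phi n)).
have cS : S n @[n --> \oo] --> (0 : R).
  by have := cvg_sum3 c1; rewrite [X in _ --> X]big1.
have n3 : \forall n \near \oo, S n <= e.
  have /cvgrPdist_lt /(_ _ e0) := cS; apply: filterS => n.
  by rewrite sub0r normrN => /ltW; apply: le_trans; exact: ler_norm.
have [n [h0 hS]] := filter_ex (filterI n0 n3).
have h1 i : L2dot (partial i p \- partial i (phi n)) (partial i p \- partial i (phi n)) <= e.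
  apply: le_trans hS; rewrite /S (bigD1 i)//= lerDl.
  by apply: sumr_ge0 => k _; exact: L2dot_ge0.
exists (phi n); split => // i.
have tL : L2 (partial i (phi n)).
  by apply: L2_continuous; exact: test_function_partial_continuous (tphi n).
have wd1 := is_wderivB vL (L2_test (tphi n)) (sobolev1_is_wpartial i sv) (is_wderiv_test i (tphi n)).
have wd2 := is_wderivB vL (L2_test (tphi n)) (wv i) (is_wderiv_test i (tphi n)).
by rewrite -(wderiv_dot wd1) (wderiv_dot wd2).
Qed.

End SobolevLink.

(** * The spectral space *)

Section Jacobi.
Context {R : realType}.
Variable beta : R.
Hypothesis beta0 : 0 <= beta.
Local Notation leb := (@lebesgue_measure R).
Local Notation D := (`]-1, 1[%classic : set (measurableTypeR R)).
Implicit Types (p q r : {poly R}) (t c : R) (k n : nat).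

Definition jacobi_weight t : R := (1 - t) `^ 0 * (1 + t) `^ beta.

Definition jacobi_ip p q : R :=
  \int[leb]_(t in D) (p.[t] * q.[t] * (1 - t) `^ 0 * (1 + t) `^ beta).

Lemma measurable_jacobi_weight : measurable_fun setT jacobi_weight.
Proof.
apply: measurable_funM.
  apply: (measurableT_comp (measurable_powR _)); exact: measurable_funB.
apply: (measurableT_comp (measurable_powR _)); exact: measurable_funD.
Qed.

Lemma jacobi_weight_bound t : D t -> 0 < jacobi_weight t <= 2 `^ beta.
Proof.
rewrite /= in_itv/= => /andP[t1 t2]; have h0 : 0 < 1 + t by lra.
rewrite /jacobi_weight powRr0 mul1r powR_gt0//=.
by apply: ge0_ler_powR => //; rewrite ?nnegrE; lra.
Qed.

Lemma horner_bound p : exists M, forall t, D t -> `|p.[t]| <= M.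
Proof.
have cp : {within `[-1, 1], continuous (horner p)}.
  by apply: continuous_subspaceT => t; exact: continuous_horner.
have := compact_bounded (continuous_compact cp (@segment_compact R (-1) 1)).
move=> [M [_ hM]]; exists (`|M| + 1) => t tD; apply: (hM (`|M| + 1)).
  by rewrite ltr_pwDr// ler_norm.
exists t => //; move: tD; rewrite /= !in_itv/= => /andP[/ltW -> /ltW ->//].
Qed.

Lemma measure_D : leb D = 2%:E.
Proof.
have := lebesgue_measure_itv (R := R) `]-1, 1[; rewrite /= lte_fin.
rewrite (_ : (-1 < 1)%R); last by lra.
by move=> E; apply: (eq_trans E); rewrite -EFinB opprK.
Qed.

Lemma finite_roots r : r != 0 -> finite_set [set t | root r t].
Proof.
have [n] := ubnP (size r); elim: n r => // n IH r sr r0.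
have [[a ra]|nr] := pselect (exists a, root r a); last first.
  by rewrite (_ : [set t | root r t] = set0)// -subset0 => t rt; apply: nr; exists t.
have [q rE] := factor_theorem _ _ ra.
have q0 : q != 0 by apply: contra_neq r0 => q0; rewrite rE q0 mul0r.
have sq : (size q < n)%N by move: sr; rewrite rE size_Mmonic ?monicXsubC// size_XsubC addn2.
apply: (@sub_finite_set _ _ ([set t | root q t] `|` [set a])) => [t /=|].
  by rewrite rE rootM root_XsubC => /orP[->|/eqP]; [left|right].
by rewrite finite_setU; split; [exact: IH|exact: finite_set1].
Qed.

Lemma jacobi_integrable p : leb.-integrable D (EFin \o (fun t => p.[t] * jacobi_weight t)).
Proof.
apply: measurable_bounded_integrable => //.
- by apply: (eq_ind_r (fun z => (z < +oo)%E) _ measure_D); rewrite ltry.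
- apply: measurable_funM; apply: measurable_funTS.
    by apply: continuous_measurable_fun => t; exact: continuous_horner.
  exact: measurable_jacobi_weight.
- have [M hM] := horner_bound p.
  exists (M * 2 `^ beta); split; first exact: num_real.
  move=> y My t tD /=; rewrite (le_trans _ (ltW My))// normrM.
  have /andP[w0 w1] := jacobi_weight_bound tD.
  by rewrite ler_pM// ?hM// gtr0_norm.
Qed.

Lemma jacobi_ipE p q : jacobi_ip p q = \int[leb]_(t in D) ((p * q).[t] * jacobi_weight t).
Proof. by apply: eq_Rintegral => t _; rewrite hornerM /jacobi_weight mulrA. Qed.

Lemma jacobi_ipC p q : jacobi_ip p q = jacobi_ip q p.
Proof. by rewrite !jacobi_ipE mulrC. Qed.

Lemma jacobi_ipDl p q r : jacobi_ip (p + q) r = jacobi_ip p r + jacobi_ip q r.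
Proof.
have mD : measurable D by [].
rewrite !jacobi_ipE mulrDl -(RintegralD mD (jacobi_integrable _) (jacobi_integrable _)).
by apply: eq_Rintegral => t _; rewrite hornerD mulrDl.
Qed.

Lemma jacobi_ipZl c p q : jacobi_ip (c *: p) q = c * jacobi_ip p q.
Proof.
have mD : measurable D by [].
have := RintegralZl c mD (jacobi_integrable (p * q)); rewrite !jacobi_ipE -scalerAl => <-.
apply: eq_Rintegral => t _; rewrite hornerZ -mulrA; reflexivity.
Qed.

Lemma jacobi_ip_ge0 p : 0 <= jacobi_ip p p.
Proof.
rewrite jacobi_ipE; apply: Rintegral_ge0 => t tD; have /andP[w0 _] := jacobi_weight_bound tD.
by rewrite hornerM -expr2 mulr_ge0 ?sqr_ge0// ltW.
Qed.

Definition jacobi_inner : semi_inner {poly R} :=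
  @SemiInner R {poly R} (fun=> True) jacobi_ip I (fun _ _ _ _ => I) (fun _ _ _ => I)
    jacobi_ipC (fun u v w _ _ _ => jacobi_ipDl u v w) (fun c u v _ _ => jacobi_ipZl c u v)
    (fun u _ => jacobi_ip_ge0 u).

Definition psize k p : Prop := (size p <= k)%N.

Lemma subspace_psize k : subspace jacobi_inner (psize k).
Proof.
split => //; first by rewrite /psize size_poly0.
move=> c u v su sv; rewrite /psize (leq_trans (size_polyD _ _))// geq_max sv andbT.
exact: leq_trans (size_scale_leq _ _) su.
Qed.

Lemma projectable_psize k : projectable jacobi_inner (psize k).
Proof.
elim: k => [|k IH] f _.
  exists 0; split; first by rewrite /psize size_poly0.
  move=> v; rewrite /psize leqn0 size_poly_eq0 => /eqP ->.
  by rewrite ipC; exact: (@ip0l _ _ jacobi_inner).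
have [g [Pg og]] := projectable_adjoin (H := jacobi_inner) (w := 'X^k) I (subspace_psize k) IH (f := f) I.
exists g; split.
  case: Pg => c [p [sp ->]]; rewrite /psize (leq_trans (size_polyD _ _))// geq_max.
  by rewrite (leq_trans (size_scale_leq _ _)) ?size_polyXn//= (leq_trans sp).
move=> v sv; apply: og; exists v`_k, (v - v`_k *: 'X^k); split; last by rewrite addrC subrK.
apply/leq_sizeP => j kj; rewrite coefB coefZ coefXn.
have [->|jk] := eqVneq j k; first by rewrite mulr1 subrr.
rewrite mulr0 subr0; apply: (leq_sizeP _ _ sv).
by rewrite ltn_neqAle eq_sym jk.
Qed.

(** On the open interval the integrand is positive off the roots of r, a finite set unless r = 0. *)
Lemma jacobi_definite r : \int[leb]_(t in D) (((1 - 'X) * r * r).[t] * jacobi_weight t) = 0 ->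
  r = 0.
Proof.
move=> int0; apply/eqP; apply: contrapT => /negP r0.
pose F t := ((1 - 'X) * r * r).[t] * jacobi_weight t.
have iF : leb.-integrable D (EFin \o F) by exact: jacobi_integrable.
have mD : measurable D by [].
have FE t : F t = (1 - t) * r.[t] ^+ 2 * jacobi_weight t.
  by rewrite /F !hornerM hornerD hornerN hornerC hornerX expr2 (mulrA (1 - t)).
have F0 t : D t -> 0 <= F t.
  move=> tD; have /andP[w0 _] := jacobi_weight_bound tD.
  have t1 : 0 <= 1 - t by move: tD; rewrite /= in_itv/= => /andP[_]; lra.
  by rewrite FE; exact: mulr_ge0 (mulr_ge0 t1 (sqr_ge0 _)) (ltW w0).
have i0 : (\int[leb]_(t in D) `|(EFin \o F) t| = 0)%E.
  rewrite -[RHS]/(0%:E) -int0 /Rintegral fineK; last exact: integrable_fin_num iF.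
  by apply: eq_integral => t /set_mem tD /=; rewrite ger0_norm ?F0.
have := (ae_eq_integral_abs leb mD (measurable_int _ iF)).1 i0.
move=> [N [mN N0 hN]].
have sub : D `<=` N `|` [set t | root r t].
  move=> t tD; have [rt|rt] := boolP (root r t); first by right.
  left; apply: hN => /= /(_ tD) /= [] /eqP; apply/negP; rewrite FE gt_eqF//.
  have /andP[w0 _] := jacobi_weight_bound tD; apply: mulr_gt0 => //.
  have t1 : 0 < 1 - t by move: tD; rewrite /= in_itv/= => /andP[_]; lra.
  by apply: mulr_gt0 => //; rewrite exprn_even_gt0//= -rootE.
have root0 : leb [set t | root r t] = 0%E.
  by apply: countable_lebesgue_measure0; exact: finite_set_countable (finite_roots r0).
have mroot : measurable ([set t | root r t] : set (measurableTypeR R)).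
  apply: countable_measurable; last exact: finite_set_countable (finite_roots r0).
  by move=> t; exact: measurable_set1.
have : (leb D <= leb (N `|` [set t | root r t]))%E.
  by apply: le_measure; rewrite ?inE//; exact: measurableU.
have := measureU2 leb mN mroot => le1 le2; have := le_trans le2 le1.
have -> : leb D = 2%:E := measure_D.
have -> : (leb N + leb [set t | root r t] = 0)%E by rewrite [leb N]N0 [X in (_ + X)%E]root0 adde0.
by rewrite lee_fin leNgt ltr0n.
Qed.

(** [jacobi] is a choice with default 0, so a witness is required: 'X^k minus its projection on
    lower degrees. It can be normalised at 1, because a factorisation ('X - 1) r and orthogonality
    to r would give the vanishing integral of [jacobi_definite]. *)
Lemma jacobi_exists k : exists p, is_jacobi 0 beta k p.
Proof.
have [g [sg og]] := @projectable_psize k 'X^k I.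
pose p := 'X^k - g.
have sp : size p = k.+1 by rewrite /p size_polyDl ?size_polyXn// size_polyN ltnS.
have op q : psize k q -> jacobi_ip p q = 0 by move=> sq; exact: og.
have p1 : p.[1] != 0.
  apply/negP => /factor_theorem[r pr].
  have sr : (size r <= k)%N.
    have r0 : r != 0 by apply/negP => /eqP r0; move: sp; rewrite pr r0 mul0r size_poly0.
    by move: sp; rewrite pr size_Mmonic ?monicXsubC// size_XsubC addn2 => -[->].
  have r0 : r = 0.
    apply: jacobi_definite; rewrite -[RHS]oppr0 -(op r sr) jacobi_ipE.
    have := RintegralZl (-1) (_ : measurable D) (jacobi_integrable (p * r)).
    rewrite mulN1r => <- //; apply: eq_Rintegral => t _.
    by rewrite pr !hornerM !(hornerD, hornerN, hornerC, hornerX); ring.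
  by move: sp; rewrite pr r0 mul0r size_poly0.
have b1 : binomial_shift 0 k = 1 :> R.
  by apply: big1 => i _; rewrite add0r divff.
exists (p.[1]^-1 *: p); split.
- by rewrite size_scale ?invr_eq0.
- by move=> q sq; have := jacobi_ipZl p.[1]^-1 p q; rewrite op// mulr0.
- by rewrite hornerZ mulVf.
Qed.

Lemma jacobi_spec k : is_jacobi 0 beta k (jacobi 0 beta k).
Proof. have [p hp] := jacobi_exists k; exact: (xgetPex 0 (ex_intro _ p hp)). Qed.

Lemma size_jacobi k : size (jacobi 0 beta k) = k.+1.
Proof. by case: (jacobi_spec k). Qed.

Lemma jacobi_at1 k : (jacobi 0 beta k).[1] = 1.
Proof.
by case: (jacobi_spec k) => _ _ ->; apply: big1 => i _; rewrite add0r divff.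
Qed.

End Jacobi.

Lemma eqn_sum_delta (R : realType) m i (im : (i < m)%N) (P : pred 'I_m) (F : 'I_m -> R) :
  P (Ordinal im) -> \sum_(k < m | P k) (k == i :> nat)%:R * F k = F (Ordinal im).
Proof.
move=> Pi; rewrite (bigD1 (Ordinal im))//= eqxx mul1r big1 ?addr0// => k /andP[_ ki].
by rewrite (_ : (k == i :> nat) = false) ?mul0r//; exact: negPf ki.
Qed.

(** * V_N and the orthogonality of the error to polynomials *)

Section SpectralSpace.
Context {R : realType}.
Variable Y : forall n : nat, 'I_(n.*2.+1) -> point3 R -> R.
Hypothesis hY : harmonic_basis Y.
Local Notation pt := (point3 R).
Implicit Types (e u v : pt -> R) (x : pt) (c : R) (r : {poly R}) (k n N i : nat).

Lemma enorm_sq x : enorm x ^+ 2 = sqnorm x.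
Proof. by rewrite sqr_sqrtr//; exact: sqnorm_ge0. Qed.

Lemma hom_basis n (l : 'I_(n.*2.+1)) : hom n (Y l).
Proof. by have [h _ _] := hY n; have [hl _] := h l; exact: homogeneous_hom. Qed.

Lemma VN_comb N c u v : VN Y N u -> VN Y N v -> VN Y N (fun x => c * u x + v x).
Proof.
move=> [a ha] [b hb]; exists (fun k n l => c * a k n l + b k n l) => x xB.
rewrite ha// hb// mulr_sumr -big_split/=; apply: eq_bigr => k _.
rewrite mulr_sumr -big_split/=; apply: eq_bigr => n _.
rewrite mulr_sumr -big_split/=; apply: eq_bigr => l _.
by rewrite mulrDl mulrA.
Qed.

Lemma VN_zero N : VN Y N (cst 0).
Proof.
exists (fun _ _ _ => 0) => x _; rewrite big1// => k _; rewrite big1// => n _.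
by rewrite big1// => l _; rewrite mul0r.
Qed.

Lemma VN_ext N u v : (forall x, ball3 x -> u x = v x) -> VN Y N v -> VN Y N u.
Proof. by move=> uv [c hc]; exists c => x xB; rewrite uv// hc. Qed.

Lemma VN_Bm1 N k n (l : 'I_(n.*2.+1)) : (0 < k)%N -> (k.*2 + n <= N)%N -> VN Y N (Bm1 Y k l).
Proof.
move=> k0 kN; have kN' : (k < N.+1)%N by lia.
have nN : (n < N.+1)%N by lia.
exists (fun k' n' l' => (k' == k)%:R * ((n' == n)%:R * (l' == l :> nat)%:R)) => x _.
under eq_bigr => k' _.
  under eq_bigr => n' _.
    under eq_bigr => l' _ do rewrite -!mulrA.
    rewrite -!mulr_sumr; over.
  rewrite -mulr_sumr; over.
rewrite (eqn_sum_delta (im := kN')) ?k0// (eqn_sum_delta (im := nN)) /=; last by lia.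
have := @eqn_sum_delta R _ l (ltn_ord l) xpredT (fun l' => Bm1 Y k l' x) isT => /= ->.
by congr Bm1; apply: val_inj.
Qed.

(** The division is exact, both Jacobi polynomials being 1 at 1. At t = 2 |x|^2 - 1 the divisor is
    -2 (1 - |x|^2), the factor that puts the basis functions in H_0^1. *)
Definition radial_quotient k n : {poly R} :=
  (jacobi 0 (n%:R + 2^-1) k - jacobi 0 (n%:R + 2^-1) k.-1) %/ ('X - 1%:P).

Lemma jacobi_exponent n : 0 <= n%:R + 2^-1 :> R.
Proof. by rewrite addr_ge0// invr_ge0. Qed.

Lemma radial_quotientE k n : jacobi 0 (n%:R + 2^-1) k - jacobi 0 (n%:R + 2^-1) k.-1 =
  radial_quotient k n * ('X - 1%:P).
Proof.
rewrite divpK// dvdp_XsubCl; apply/rootP.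
by rewrite hornerD hornerN !jacobi_at1 ?subrr//; exact: jacobi_exponent.
Qed.

Lemma Bm1E k n (l : 'I_(n.*2.+1)) x : Bm1 Y k l x =
  (jacobi 0 (n%:R + 2^-1) k - jacobi 0 (n%:R + 2^-1) k.-1).[2 * sqnorm x - 1] * Y l x.
Proof. by rewrite /Bm1 /B0 /= enorm_sq hornerD hornerN mulrBl. Qed.

Lemma Bm1_vanishing k n (l : 'I_(n.*2.+1)) x : Bm1 Y k l x =
  (1 - sqnorm x) * (-2 * (radial_quotient k n).[2 * sqnorm x - 1] * Y l x).
Proof.
rewrite Bm1E radial_quotientE hornerM hornerXsubC.
by set a := (radial_quotient k n).[_]; move: a (Y l x) (sqnorm x) => a b s; ring.
Qed.

Lemma elementary_radial d r : elementary d (fun x => r.[2 * sqnorm x - 1]).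
Proof.
elim/poly_ind: r => [|r c IH].
  by rewrite (_ : (fun=> _) = cst 0)//; [exact: elem_cst|apply/funext => x; rewrite horner0].
rewrite (_ : (fun=> _) = fun x => r.[2 * sqnorm x - 1] * (2 * sqnorm x - 1) + cst c x).
  apply: elem_add; last exact: elem_cst.
  apply: elem_mul IH _; apply: (@elementary_sub _ d (fun x => 2 * sqnorm x) (cst 1));
    last exact: elem_cst.
  by apply: elementary_scale; exact: elementary_sqnorm.
by apply/funext => x; rewrite hornerMXaddC.
Qed.

Lemma VN_sobolev0 N v : VN Y N v -> sobolev0 1 v.
Proof.
move=> [c hc].
pose q k n (l : 'I_(n.*2.+1)) x := -2 * (radial_quotient k n).[2 * sqnorm x - 1] * Y l x.
pose Q x := \sum_(k < N.+1) \sum_(n < N.+1) \sum_(l < n.*2.+1)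
  (if ((0 < k) && (2 <= k.*2 + n <= N))%N then c k n l else 0) * q k n l x.
apply: (@sobolev0_vanishing _ _ Q) => [d|x xB].
  apply: elementary_sum => k; apply: elementary_sum => n; apply: elementary_sum => l.
  apply: elementary_scale; apply: elem_mul; last exact: hom_elementary (hom_basis _).
  by apply: elementary_scale; exact: elementary_radial.
rewrite hc// /Q big_mkcond/= mulr_sumr; apply: eq_bigr => k _; case: ifPn => k0 /=; last first.
  by rewrite big1 ?mulr0// => n _; rewrite big1// => l _; rewrite mul0r.
rewrite big_mkcond/= mulr_sumr; apply: eq_bigr => n _; case: ifPn => kn; last first.
  by rewrite big1 ?mulr0// => l _; rewrite mul0r.
rewrite mulr_sumr; apply: eq_bigr => l _.
by rewrite Bm1_vanishing -/(q k n l x) mulrCA.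
Qed.

(** Differences of consecutive Jacobi polynomials vanish at 1 and have each degree 1, ..., k
    exactly. Cancelling leading coefficients reduces r to a constant, which r(1) = 0 makes zero. *)
Lemma VN_radial N k n (l : 'I_(n.*2.+1)) r : (k.*2 + n <= N)%N -> (size r <= k.+1)%N ->
  r.[1] = 0 -> VN Y N (fun x => r.[2 * sqnorm x - 1] * Y l x).
Proof.
elim: k r => [|k IH] r kN sr r1.
  have [a ra] : exists a, r = a%:P by exists r`_0; exact: size1_polyC.
  move: r1; rewrite ra hornerC => ->; apply: (VN_ext _ (VN_zero N)) => x _.
  by rewrite hornerC mul0r.
pose J := @jacobi R 0 (n%:R + 2^-1); have b0 := jacobi_exponent n.
pose w := J k.+1 - J k; have sJ j : size (J j) = j.+1 by exact: size_jacobi.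
have sw : size w = k.+2 by rewrite size_polyDl ?size_polyN ?sJ.
have w0 : w`_k.+1 != 0 by have := lead_coef_eq0 w; rewrite lead_coefE sw/= => ->;
  rewrite -size_poly_eq0 sw.
pose a := r`_k.+1 / w`_k.+1; pose r' := r - a *: w.
have w1 : w.[1] = 0 by rewrite hornerD hornerN !jacobi_at1 ?subrr.
have Vr' : VN Y N (fun x => r'.[2 * sqnorm x - 1] * Y l x).
  apply: IH; first by lia.
    apply/leq_sizeP => j; rewrite leq_eqVlt => /predU1P[<-|kj].
      by rewrite coefB coefZ divfK ?subrr.
    by rewrite coefB coefZ !nth_default ?mulr0 ?subr0// ?sw// (leq_trans sr).
  by rewrite hornerD hornerN hornerZ r1 w1 mulr0 subr0.
apply: (VN_ext _ (VN_comb a (VN_Bm1 (k := k.+1) l isT kN) Vr')) => x _.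
rewrite Bm1E -/J -/w /r' hornerD hornerN hornerZ.
by move: (w.[_]) (r.[_]) (Y l x) => A B C; ring.
Qed.

Lemma VN_power N i n (l : 'I_(n.*2.+1)) : (i.+1.*2 + n <= N)%N ->
  VN Y N (fun x => (sqnorm x ^+ i.+1 - 1) * Y l x).
Proof.
move=> iN; pose h : {poly R} := 2^-1 *: ('X + 1%:P).
have hE t : h.[2 * t - 1] = t by rewrite hornerZ hornerD hornerX hornerC; field.
have sh : (size h <= 2)%N.
  by rewrite (leq_trans (size_scale_leq _ _))// size_XaddC.
apply: (VN_ext _ (VN_radial l iN (r := h ^+ i.+1 - 1%:P) _ _)) => [x _||].
- by rewrite hornerD hornerN hornerC horner_exp hE.
- rewrite (leq_trans (size_polyD _ _))// geq_max size_polyN (leq_trans (size_polyC_leq1 _))// andbT.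
  rewrite (leq_trans (size_poly_exp_leq _ _))// ltnS.
  by rewrite (leq_trans (leq_mul (_ : _ <= 1) (leqnn _)))%N ?mul1n// -ltnS; case: (size h) sh.
- by rewrite hornerD hornerN hornerC horner_exp hornerZ hornerD hornerX hornerC mulVf ?expr1n ?subrr.
Qed.

Lemma hom_power m : hom m.*2 (fun x => sqnorm x ^+ m : R).
Proof.
elim: m => [|m IHm]; first by rewrite (_ : (fun=> _) = cst 1)//; exact: hom_cst.
rewrite (_ : (fun=> _) = fun x => sqnorm x * sqnorm x ^+ m).
  by rewrite doubleS -add2n; apply: homM => //; exact: hom_sqnorm.
by apply/funext => x; rewrite exprS.
Qed.

(** Each further factor |x|^2 adds a positive number to c by [lap_sqnormM]. Positivity allows
    division by c in the orthogonality argument. *)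
Lemma lap_power_harmonic i n h : hom n h -> Defs.harmonic h -> exists2 c, 0 < c &
  lap (fun x => sqnorm x ^+ i.+1 * h x) = fun x => c * (sqnorm x ^+ i * h x).
Proof.
move=> hh hh0; elim: i => [|i [c c0 IH]].
  exists (6 + 4 * n%:R); first by rewrite ltr_pwDl ?mulr_ge0.
  rewrite (_ : (fun=> _) = fun x => sqnorm x * h x); last by apply/funext => x; rewrite expr1.
  rewrite (lap_sqnormM hh); apply/funext => x; rewrite -[lap h x]/(\sum_(i < 3) _) hh0 expr0.
  by rewrite mulr0 addr0 mul1r.
have hq := homM (hom_power i.+1) hh.
exists (6 + 4 * (i.+1.*2 + n)%:R + c); first by rewrite addr_gt0// ltr_pwDl ?mulr_ge0.
rewrite (_ : (fun=> _) = fun x => sqnorm x * (sqnorm x ^+ i.+1 * h x)); last first.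
  by apply/funext => x; rewrite [in LHS]exprS mulrA.
rewrite (lap_sqnormM hq) IH; apply/funext => x.
by rewrite !exprS; move: (h x) (sqnorm x ^+ i) (sqnorm x) => A B C; ring.
Qed.

Lemma L2dot_comb0 (I : Type) (t : seq I) (c : I -> R) (F : I -> pt -> R) e : L2 e ->
  (forall a, L2 (F a)) -> (forall a, L2dot e (F a) = 0) ->
  L2dot e (fun x => \sum_(a <- t) c a * F a x) = 0.
Proof.
move=> eL FL F0.
suff [] : L2 (fun x => \sum_(a <- t) c a * F a x) /\
  L2dot e (fun x => \sum_(a <- t) c a * F a x) = 0 by [].
elim: t => [|a t [IHL IH]].
  rewrite (_ : (fun=> _) = cst 0); last by apply/funext => x; rewrite big_nil.
  by split; [exact: L2_cst|rewrite L2dotC; exact: (@ip0l _ _ L2_inner)].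
rewrite (_ : (fun=> _) = fun x => c a * F a x + \sum_(b <- t) c b * F b x); last first.
  by apply/funext => x; rewrite big_cons.
split; first by apply: L2D => //; exact: L2Z.
rewrite L2dotDr//; last exact: L2Z.
by rewrite L2dotZr// F0 mulr0 add0r.
Qed.

Lemma aform_elementary e p : sobolev0 1 e -> (forall d, elementary d p) ->
  aform e p = - L2dot e (lap p).
Proof.
move=> se ep; rewrite -(sobolev0_ibp se ep) aformE; apply: eq_bigr => i _.
rewrite L2dotC (wderiv_dotl (is_wderiv_elementary i (ep 1)) (L2_wderiv _ _)).
exact: L2dotC.
Qed.

Lemma VN_orth_poly N K e p : sobolev0 1 e -> (forall v, VN Y N v -> aform e v = 0) ->
  (K.+2 <= N)%N -> poly K p -> L2dot e p = 0.
Proof.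
move=> se ae.
have eL : L2 e by case: se => /sobolevL2.
have hE n (h : pt -> R) : hom n h -> forall d, elementary d h by move=> hh d;
  exact: hom_elementary hh.
have hs i n h : hom n h -> hom (i.*2 + n) (fun x => sqnorm x ^+ i * h x).
  exact/homM/hom_power.
(* In the member (|x|^(2i+2) - 1) Y of V_N the term Y restores the boundary condition and disappears
   under the Laplacian. *)
have ey i n (l : 'I_(n.*2.+1)) : (i.+1.*2 + n <= N)%N ->
    L2dot e (fun x => sqnorm x ^+ i * Y l x) = 0.
  move=> iN; have hl := hom_basis l; have [/(_ l)[_ Yh] _ _] := hY n.
  have [c c0 lE] := lap_power_harmonic i hl Yh.
  have hsl := hs i.+1 _ _ hl.
  have := ae _ (VN_power l iN).
  rewrite (_ : (fun=> _) = fun x => sqnorm x ^+ i.+1 * Y l x - Y l x); last first.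
    by apply/funext => x; rewrite mulrBl mul1r.
  rewrite (aform_elementary se); last by move=> d; apply: (@elementary_sub _ d _ (Y l));
    [exact: hE hsl d|exact: hE hl d].
  rewrite (lapB (hE _ _ hsl 1) (hE _ _ hl 1)) lE => /eqP; rewrite oppr_eq0 => /eqP.
  rewrite (_ : (fun=> _) = fun x => c * (sqnorm x ^+ i * Y l x)); last first.
    by apply/funext => x; rewrite -[lap (Y l) x]/(\sum_(i < 3) _) Yh subr0.
  rewrite L2dotZr//; last exact: L2_elementary (hE _ _ (hs i _ _ hl) 1).
  by move=> /eqP; rewrite mulf_eq0 (gt_eqF c0) => /eqP.
have eh i n h : hom n h -> Defs.harmonic h -> (i.+1.*2 + n <= N)%N ->
    L2dot e (fun x => sqnorm x ^+ i * h x) = 0.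
  move=> hh hh0 iN; have [_ _ /(_ h (hom_homogeneous hh) hh0)[c hc]] := hY n.
  rewrite (_ : (fun=> _) = fun x => \sum_l c l * (sqnorm x ^+ i * Y l x)); last first.
    by apply/funext => x; rewrite hc mulr_sumr; apply: eq_bigr => l _; rewrite mulrCA.
  apply: L2dot_comb0 => // l; last exact: ey.
  exact: L2_elementary (hE _ _ (hs i _ _ (hom_basis l)) 1).
(* The harmonic splitting trades two degrees of h for one more power of |x|^2, so the constraint
   with N is preserved along the induction. *)
have ep n : forall i h, hom n h -> (i.+1.*2 + n <= N)%N ->
    L2dot e (fun x => sqnorm x ^+ i * h x) = 0.
  have [m] := ubnP n; elim: m n => // m IH n nm i h hh iN.
  have [g [q [hg g0 hq ->]]] := harmonic_split hh.
  have qE : hom n.-2 q by case: n hq {nm hh iN hg} => [|[|n]]// ->; exact: hom0.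
  rewrite (_ : (fun=> _) = fun x => sqnorm x ^+ i * g x + sqnorm x ^+ i.+1 * q x); last first.
    by apply/funext => x; rewrite exprSr mulrDr mulrA.
  rewrite L2dotDr//; [|exact: L2_elementary (hE _ _ (hs i _ _ hg) 1)|
    exact: L2_elementary (hE _ _ (hs i.+1 _ _ qE) 1)].
  rewrite (eh _ _ _ hg g0 iN) add0r.
  have q0 : q = cst 0 -> L2dot e (fun x => sqnorm x ^+ i.+1 * q x) = 0.
    move=> ->; rewrite L2dotC; apply: (eq_trans _ (@ip0l _ _ L2_inner e eL)).
    by apply: L2dot_congr => x _ /=; rewrite mulr0.
  case: n hq nm {hh hg} iN qE => [|[|n]] hq nm iN qE; [exact: q0|exact: q0|].
  by apply: (IH n) => //; lia.
elim: K p => [|K IH] p KN /=.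
  by move=> hp; have := ep 0%N 0%N p hp KN; congr (L2dot e _ = 0); apply/funext => x; rewrite mul1r.
move=> [h [q [hh pq ->]]].
rewrite (L2dotDr (L2_elementary (hE _ _ hh 1)) (L2_poly pq) eL) (IH _ (ltnW KN) pq) addr0.
by have := ep _ 0%N h hh KN; congr (L2dot e _ = 0); apply/funext => x; rewrite mul1r.
Qed.

End SpectralSpace.

(** * The error estimate *)

Section ErrorEstimate.
Context {R : realType}.
Local Notation pt := (point3 R).
Implicit Types (f e g h u v w sigma : pt -> R) (x : pt) (c : R) (k n N m j : nat) (i : 'I_3).

Lemma sobolev0_test phi : test_function phi -> sobolev0 1 (phi : pt -> R).
Proof.
move=> tp; apply/sobolev0_1P; split; first exact: sobolev1_test.
have pL := L2_test tp.
move=> eps eps0; exists phi; split => // [|i].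
  rewrite (_ : L2dot _ _ = 0) ?(ltW eps0)//.
  rewrite (L2dotBl pL pL (L2B pL pL)); exact: subrr.
rewrite (is_wderiv_uniq (sobolev1_is_wpartial i (sobolev1_test tp)) (is_wderiv_test i tp)).
exact: ltW.
Qed.

Lemma aformC u v : aform u v = aform v u.
Proof. by rewrite !aformE; apply: eq_bigr => i _; exact: L2dotC. Qed.

Lemma aformBl u v w : sobolev 1 u -> sobolev 1 v ->
  aform (u \- v) w = aform u w - aform v w.
Proof.
move=> su sv; rewrite !aformE -sumrB; apply: eq_bigr => i _.
by apply: wpartialB_dotl => //; exact: L2_wderiv.
Qed.

Lemma L2dot_AM f g : L2 f -> L2 g -> 2 * L2dot f g <= L2dot f f + L2dot g g.
Proof.
move=> fL gL; have := L2dot_ge0 (f \- g); have -> := L2dotBl fL gL (L2B fL gL).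
have -> := L2dotBr fL gL fL; have -> := L2dotBr fL gL gL; rewrite (L2dotC g f).
by move: (L2dot f f) (L2dot f g) (L2dot g g) => A B D; lra.
Qed.

(** The mixed term is at most half the sum of the two energies. It is applied to the energy identity
    of the error, with v = sigma. *)
Lemma aform_le u v : aform u u = aform v u -> aform u u <= aform v v.
Proof.
suff : 2 * aform v u <= aform v v + aform u u.
  by move: (aform u u) (aform v u) (aform v v) => A B D h AB; lra.
rewrite !aformE mulr_sumr -big_split/=; apply: ler_sum => i _.
exact: L2dot_AM (L2_wderiv _ _) (L2_wderiv _ _).
Qed.

Lemma aform_Hnorm u : aform u u <= 3 * Hnorm 1 u ^+ 2.
Proof.
rewrite aformE (_ : 3 * _ = \sum_(i < 3) Hnorm 1 u ^+ 2); last first.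
  by rewrite sumr_const card_ord mulr_natl.
by apply: ler_sum => i _; apply: Hnorm_ge; rewrite sum_munit.
Qed.

(** The sign makes this minus the Laplacian, so that it represents f. *)
Definition weak_laplacian sigma : pt -> R :=
  fun x => \sum_(i < 3) -1 * wderiv (fun l => (munit i l + munit i l)%N) sigma x.

Lemma weak_laplacian_bound m sigma : sobolev m.+2 sigma ->
  sob_bound m (weak_laplacian sigma) (4 * Hnorm m.+2 sigma).
Proof.
move=> ss; apply: sob_bound_sum; first exact: Hnorm_ge0.
move=> i; apply: sob_boundZ; first by rewrite normrN1.
by apply: (sobolev_sob_bound ss); rewrite big_split/= sum_munit.
Qed.

(** Testing the equation with cutoffs identifies f with - Lap sigma up to a null function, which
    transfers the regularity of sigma to f. *)
Lemma weak_laplacian_dot m f sigma : L2 f -> sobolev0 1 sigma ->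
  (forall v, sobolev0 1 v -> aform sigma v = L2dot f v) -> sobolev m.+2 sigma ->
  forall v, L2 v -> L2dot f v = L2dot (weak_laplacian sigma) v.
Proof.
move=> fL s0 sf ss v vL; have hL := sob_bound_L2 (weak_laplacian_bound ss).
apply: L2dot_null_eq => //; apply: cutoff_null; first exact: L2B.
move=> d phi d0 cphi; have tphi := test_function_cutoff d0 cphi; have pL := L2_test tphi.
rewrite (L2dotBl fL hL pL) -(sf _ (sobolev0_test tphi)) aformE /weak_laplacian.
have wL i : L2 (fun x => -1 * wderiv (fun l => (munit i l + munit i l)%N) sigma x).
  by apply: L2Z; exact: L2_wderiv.
rewrite -(L2dot_suml wL pL) -sumrB big1// => i _.
rewrite (L2dotC (wpartial i sigma)) (wderiv_dotl (is_wderiv_test i tphi) (L2_wderiv _ _)).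
rewrite L2dotC L2dotZl//; last exact: L2_wderiv.
have m1 : (\sum_(k < 3) munit i k < m.+2)%N by rewrite sum_munit.
have [_ _ wp] := weak_partial_wderiv i ss m1.
by rewrite (wp d phi d0 cphi) mulN1r subrr.
Qed.

(** * The Galerkin error, with N = K + 2 *)

Section Galerkin.
Variable Y : forall n : nat, 'I_(n.*2.+1) -> point3 R -> R.
Hypothesis hY : harmonic_basis Y.
Variables (K : nat) (f sigma sigmaN : pt -> R).
Hypotheses (fL : L2 f) (s0 : sobolev0 1 sigma).
Hypothesis sf : forall v, sobolev0 1 v -> aform sigma v = L2dot f v.
Hypothesis VsN : VN Y K.+2 sigmaN.
Hypothesis sNf : forall v, VN Y K.+2 v -> aform sigmaN v = L2dot f v.
Local Notation e := (sigma \- sigmaN).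
Local Notation lam := (legendre_eig K.+1 : R).

Lemma error_sobolev0 : sobolev0 1 e.
Proof. exact: sobolev0_1B s0 (VN_sobolev0 hY VsN). Qed.

Lemma error_L2 : L2 e.
Proof. by case: error_sobolev0 => /sobolevL2. Qed.

Lemma error_orth v : VN Y K.+2 v -> aform e v = 0.
Proof.
move=> Vv; have [s1 _] := s0; have [sN1 _] := VN_sobolev0 hY VsN.
have -> := aformBl v s1 sN1; have -> := sNf Vv; have -> := sf (VN_sobolev0 hY Vv).
exact: subrr.
Qed.

(** As the projection of e is 0, estimates of the distance to the polynomials become estimates of e
    itself. *)
Lemma error_projection : projection L2_inner (poly K) e 0.
Proof.
split; first by case: (subspace_poly (R := R) K).
move=> v Pv; rewrite subr0; exact: (VN_orth_poly hY error_sobolev0 error_orth (leqnn _) Pv).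
Qed.

Lemma error_energy : aform e e = aform sigma e.
Proof.
have [s1 _] := s0; have [sN1 _] := VN_sobolev0 hY VsN.
have -> := aformBl e s1 sN1; have -> := aformC sigmaN e; have -> := error_orth VsN.
exact: subr0.
Qed.

(** This takes the place of a duality argument: the additional power of N in L2 comes from the
    gradient estimate applied to e. *)
Lemma error_L2_energy : lam * L2dot e e <= aform e e.
Proof.
have we i : weak_partial i e (wpartial i e).
  have [se _] := error_sobolev0.
  split; [exact: error_L2|exact: L2_wderiv|] => d phi d0 cphi.
  have [_ /(_ _ (test_function_cutoff d0 cphi))] := sobolev1_is_wpartial i se.
  by rewrite Dmulti_munit sum_munit expr1 mulN1r.
have := poly_dist_grad we error_projection; rewrite -aformE.
by rewrite (_ : e \- 0 = e)//; apply/funext => x /=; rewrite subr0.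
Qed.

Lemma error_energy_sobolev1 : aform e e <= 3 * Hnorm 1 sigma ^+ 2.
Proof. exact: le_trans (aform_le error_energy) (aform_Hnorm sigma). Qed.

(** With A the energy of e, E = |e|^2 and D = |h - hK|^2, Cauchy-Schwarz gives A^2 <= D E and
    [error_L2_energy] gives lam E <= A; together lam A <= D after division by A, whence the separate
    case A = 0. *)
Lemma error_energy_dist m h hK : sobolev m.+2 sigma -> projection L2_inner (poly K) h hK ->
  h = weak_laplacian sigma -> lam * aform e e <= L2dot (h \- hK) (h \- hK).
Proof.
move=> ss [PhK _] hE; have eL := error_L2; have [e1 _] := error_sobolev0.
have hL : L2 h by rewrite hE; exact: sob_bound_L2 (weak_laplacian_bound ss).
have hKL := L2_poly PhK.
have AE : aform e e = L2dot (h \- hK) e.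
  have [_ oe] := error_projection.
  have e0 : L2dot e hK = 0 by have := oe _ PhK; rewrite subr0.
  rewrite error_energy (sf error_sobolev0) (weak_laplacian_dot fL s0 sf ss eL) -hE.
  by rewrite (L2dotBl hL hKL eL) (L2dotC hK) e0 subr0.
have := L2dot_CS (L2B hL hKL) eL; rewrite -AE.
have := error_L2_energy; have := L2dot_ge0 (h \- hK); have := L2dot_ge0 e.
have A0 : 0 <= aform e e by rewrite aformE; apply: sumr_ge0 => i _; exact: L2dot_ge0.
have := legendre_eigS_gt0 (R := R) K; move: A0.
move: (aform e e) (L2dot (h \- hK) (h \- hK)) (L2dot _ _) lam => A D E l A0 l0 E0 D0 lE AD.
have [->|Apos] := eqVneq A 0; first by rewrite mulr0.
have {}A0 : 0 < A by rewrite lt0r Apos.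
rewrite -(ler_pM2r A0); apply: (@le_trans _ _ (D * (l * E))); last exact: (ler_wpM2l D0 lE).
by rewrite mulrCA -mulrA; apply: ler_wpM2l; [exact: ltW|rewrite -expr2].
Qed.

End Galerkin.

(** For m = 0 only first derivatives of sigma are available and energy stability suffices. Otherwise
    f = - Lap sigma has m - 1 weak derivatives: these give m - 1 powers of the eigenvalue, and
    [error_energy_dist] gives the last one. *)
Theorem error_energy_sobolev m : exists2 c : R, 0 <= c &
  forall Y (hY : harmonic_basis Y) K f sigma sigmaN, L2 f -> sobolev0 1 sigma ->
  (forall v, sobolev0 1 v -> aform sigma v = L2dot f v) -> VN Y K.+2 sigmaN ->
  (forall v, VN Y K.+2 v -> aform sigmaN v = L2dot f v) -> sobolev m.+1 sigma ->
  legendre_eig K.+1 ^+ m * aform (sigma \- sigmaN) (sigma \- sigmaN) <=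
    c * Hnorm m.+1 sigma ^+ 2.
Proof.
case: m => [|m].
  exists 3 => // Y hY K f sigma sigmaN fL s0 sf VsN sNf _.
  rewrite expr0 mul1r. exact (error_energy_sobolev1 hY s0 sf VsN sNf).
have [c c0 hc] := @sob_bound_dist R m.
(* 16 is the square of the constant 4 in [weak_laplacian_bound]. *)
exists (16 * c) => [|Y hY K f sigma sigmaN fL s0 sf VsN sNf ss]; first by rewrite mulr_ge0.
have hL := sob_bound_L2 (weak_laplacian_bound ss).
have [hK phK] := projectable_poly K hL.
have := error_energy_dist hY fL s0 sf VsN sNf ss phK erefl.
have H0 : 0 <= 4 * Hnorm m.+2 sigma by rewrite mulr_ge0// Hnorm_ge0.
have := hc _ _ _ _ H0 (weak_laplacian_bound ss) phK.
have l0 := ltW (legendre_eigS_gt0 (R := R) K).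
move=> h1 h2; rewrite exprSr -mulrA.
apply: le_trans (ler_wpM2l (exprn_ge0 m l0) h2) _; apply: le_trans h1 _.
by rewrite exprMn mulrCA mulrA (_ : 4 ^+ 2 = 16)// -natrX.
Qed.

End ErrorEstimate.

(** (K + 1)(K + 4) = (K + 2)^2 + K, so for N = K + 2 powers of the eigenvalue dominate powers of N^2
    with constant 1. *)
Lemma legendre_eig_sq (R : realType) K : (K.+2%:R : R) ^+ 2 <= legendre_eig K.+1.
Proof.
rewrite /legendre_eig -[K.+2]addn2 -[K.+1]addn1 !natrD.
by have := ler0n R K; move: (K%:R : R) => k k0; nra.
Qed.

Lemma le_of_sq_le (R : realType) (a b : R) : 0 <= b -> a ^+ 2 <= b ^+ 2 -> a <= b.
Proof.
move=> b0 ab; have [a0|/ltW a0] := leP 0 a; last exact: le_trans a0 b0.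
by rewrite -(@ler_pXn2r _ 2%N)// nnegrE.
Qed.

Lemma exprz_3B (R : realType) (x : R) m : x ^ (3 - (3 + m)%N%:Z) = x ^- m.
Proof. by rewrite exprnN; congr (_ ^ _); lia. Qed.

Lemma exprz_2B (R : realType) (x : R) m : x ^ (2 - (3 + m)%N%:Z) = x ^- m.+1.
Proof. by rewrite exprnN; congr (_ ^ _); lia. Qed.

Unset Implicit Arguments.
Set Strict Implicit.
Set Printing Implicit Defensive.

Theorem theorem3p1 (R : realType)
    (Y : forall n : nat, 'I_(n.*2.+1) -> point3 R -> R)
    (hY : harmonic_basis Y) (s : nat) (hs : (3 <= s)%N) :
  exists C : R, 0 < C /\
    forall (N : nat) (f sigma u sigmaN uN : point3 R -> R),
      (2 <= N)%N -> L2 f ->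
      mixed_solution f sigma u -> discrete_solution Y N f sigmaN uN ->
      sobolev (s - 2) sigma ->
      Hnorm 1 (sigma \- sigmaN)
        <= C * N%:R ^ (3 - s%:Z) * Hnorm (s - 2) sigma /\
      L2norm (sigma \- sigmaN)
        <= C * N%:R ^ (2 - s%:Z) * Hnorm (s - 2) sigma.
Proof.
have [m {hs}->] : exists m, s = (3 + m)%N by exists (s - 3)%N; rewrite subnKC.
rewrite (_ : (3 + m - 2)%N = m.+1)//.
have [c c0 hc] := @error_energy_sobolev R m.
(* 8 is the constant of [Hnorm1_le]; adding 1 makes C positive and gives 8 c <= C^2, which is what
   the squared inequalities need. *)
exists (8 * c + 1); split; first by rewrite ltr_wpDl// mulr_ge0.
case=> [|[|K]]// f sigma u sigmaN uN _ fL [s0 _ sf _] [VsN _ sNf _] ss.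
have := hc Y hY K f sigma sigmaN fL s0 sf VsN sNf ss.
have := error_L2_energy hY s0 sf VsN sNf.
have [e1 _] := error_sobolev0 hY s0 VsN; have eL := sobolevL2 e1.
set e := sigma \- sigmaN in e1 eL *.
have H0 := Hnorm_ge0 m.+1 sigma; set H := Hnorm m.+1 sigma in H0 *.
have A0 : 0 <= aform e e by rewrite aformE; apply: sumr_ge0 => i _; exact: L2dot_ge0.
have E0 := L2dot_ge0 e.
have eig := legendre_eig_sq R K; set n : R := K.+2%:R in eig *.
have n1 : 1 <= n by rewrite ler1n.
move=> lE lA.
have nE : n ^+ 2 * L2dot e e <= aform e e.
  by apply: le_trans lE; apply: ler_wpM2r.
have nA : n ^+ 2 ^+ m * aform e e <= c * H ^+ 2.
  by apply: le_trans lA; apply: ler_wpM2r => //; apply: lerXn2r => //;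
    rewrite nnegrE ?exprn_ge0 ?(le_trans _ eig)// exprn_ge0// (le_trans _ n1).
have n0 : 0 < n by exact: lt_le_trans n1.
(* A Poincare inequality for the error, which lets the energy control its full H^1 norm. *)
have eE : L2dot e e <= aform e e.
  by apply: le_trans nE; rewrite ler_peMl// exprn_ege1.
have Hn : Hnorm 1 e ^+ 2 <= 8 * aform e e.
  apply: Hnorm1_le => //; first by rewrite (wderiv_dot (is_wderiv0 eL)).
  move=> i; rewrite aformE (bigD1 i)//= lerDl; apply: sumr_ge0 => j _; exact: L2dot_ge0.
have c8 : 8 * c <= (8 * c + 1) ^+ 2 by nra.
have C0 : 0 <= 8 * c + 1 by rewrite addr_ge0// mulr_ge0.
split.
  rewrite exprz_3B; apply: le_of_sq_le.
    by rewrite !mulr_ge0// invr_ge0 exprn_ge0// ltW.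
  rewrite !exprMn exprVn -exprM mulnC exprM mulrAC ler_pdivlMr ?exprn_gt0//.
  apply: le_trans (ler_wpM2r (exprn_ge0 _ (exprn_ge0 _ (ltW n0))) Hn) _.
  rewrite -mulrA (mulrC (aform e e)); apply: le_trans (ler_wpM2l _ nA) _ => //.
  by rewrite mulrA; apply: ler_wpM2r; rewrite ?exprn_ge0.
rewrite exprz_2B; apply: le_of_sq_le.
  by rewrite !mulr_ge0// invr_ge0 exprn_ge0// ltW.
rewrite L2norm_sq// !exprMn exprVn -exprM mulnC exprM mulrAC ler_pdivlMr ?exprn_gt0//.
(* One factor N^2 is spent on passing from |e|^2 to the energy, the other m on the energy
   estimate. *)
rewrite exprS mulrA (mulrC (L2dot e e)).
apply: le_trans (ler_wpM2r (exprn_ge0 _ (exprn_ge0 _ (ltW n0))) nE) _.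
rewrite mulrC; apply: le_trans nA _; apply: ler_wpM2r; first exact: exprn_ge0.
by apply: le_trans c8; lra.
Qed.
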